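(* Let $n\geq 1$, and let $G$ and $H$ be two separable TSI Lie groups such that $G_0\cong H_0\cong\mathbb{R}^n$ and $|\mathrm{Inn}_H(H_0)|<+\infty$. Then $E(G)\leq_B E(H)$ if and only if there exists a topological isomorphism $\phi:G_0\to H_0$ such that $\phi\,\mathrm{Inn}_G(G_0)\,\phi^{-1}\subseteq\mathrm{Inn}_H(H_0)$.
   Context: A Lie group is a group which is also a smooth manifold with smooth group operations. A Polish group is a topological group whose topology is separable and completely metrizable; a group is TSI if it admits a compatible two-sided invariant metric. $G_0$ denotes the identity component (connected component of $1_G$) of $G$; $\cong$ is isomorphism of topological groups. For a Polish group $G$, $E(G)$ is the equivalence relation on $G^\omega$ defined by: $x\,E(G)\,y$ iff $\lim_n x(n)y(n)^{-1}$ converges in $G$. For Borel equivalence relations $E,F$ on Polish spaces $X,Y$, $E\leq_B F$ means there is a Borel map $\theta:X\to Y$ with $xEy\iff\theta(x)F\theta(y)$ for all $x,y\in X$. For $u\in G$, $\iota_u:G_0\to G_0$ is $\iota_u(g)=ugu^{-1}$, and $\mathrm{Inn}_G(G_0)=\{\iota_u:u\in G\}$; similarly for $H$. $\phi\,\mathrm{Inn}_G(G_0)\,\phi^{-1}=\{\phi\circ\iota_u\circ\phi^{-1}:u\in G\}$. *)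

(* Defs.v *)
From HB Require Import structures.
From mathcomp Require Import all_boot all_order all_algebra.
From mathcomp Require Import all_classical all_reals all_analysis.

Set Implicit Arguments.
Unset Strict Implicit.
Unset Printing Implicit Defensive.

Import Order.TTheory GRing.Theory Num.Theory.
Import numFieldNormedType.Exports.


Local Open Scope classical_set_scope.
Local Open Scope ring_scope.

HB.mixin Record isTopologicalGroup G of Topological G & Group G := {
  mulg_continuous : continuous (fun xy : G * G => (xy.1 * xy.2)%g);
  invg_continuous : continuous (fun x : G => (x^-1)%g)
}.

#[short(type="topologicalGroupType")]
HB.structure Definition TopologicalGroup :=
  {G of Topological G & Group G & isTopologicalGroup G}.

Record topological_isomorphism (G H : topologicalGroupType) := TopIso {
  tiso_fun :> G -> H;
  tiso_inv : H -> G;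
  tiso_morph : {morph tiso_fun : x y / (x * y)%g};
  tiso_funK : cancel tiso_fun tiso_inv;
  tiso_invK : cancel tiso_inv tiso_fun;
  tiso_fun_continuous : continuous tiso_fun;
  tiso_inv_continuous : continuous tiso_inv
}.

Definition topologically_isomorphic (G H : topologicalGroupType) : Prop :=
  inhabited (topological_isomorphism G H).

(** The additive group of [V], written multiplicatively. *)
Definition additive_group (V : topologicalZmodType) : Type := V.

HB.instance Definition _ (V : topologicalZmodType) :=
  Topological.on (additive_group V).
HB.instance Definition _ (V : topologicalZmodType) :=
  @isGroup.Build (additive_group V) (0 : V) (fun x : V => - x)
    (fun x y : V => x + y)
    (@addrA V) (@add0r V) (@addr0 V) (@addNr V) (@addrN V).
HB.instance Definition _ (V : topologicalZmodType) :=
  @isTopologicalGroup.Build (additive_group V)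
    (@add_continuous V) (@opp_continuous V).

Section IdentityComponent.
Variable G : topologicalGroupType.
Implicit Types x y u : G.

Definition identity_component : set G := connected_component [set: G] 1%g.

Lemma identity_component_image (f : G -> G) x :
  continuous f -> identity_component (f 1%g) -> identity_component x ->
  identity_component (f x).
Proof.
move=> cf If1 Ix; rewrite /identity_component (same_connected_component If1).
apply: (@connected_component_max _ _ (f @` identity_component)) => //.
- by exists 1%g => //; exact: connected_component_refl.
- apply: connected_continuous_connected; last exact: continuous_subspaceT.
  exact: component_connected.
Qed.

Lemma mulg_continuousl x : continuous (fun y => (x * y)%g).
Proof.
move=> y; apply: (@continuous_comp _ _ _ (pair x) (fun z : G * G => (z.1 * z.2)%g)).
  by apply: cvg_pair => /=; [exact: cvg_cst|exact: cvg_id].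
exact: mulg_continuous.
Qed.

Lemma mulg_continuousr y : continuous (fun x => (x * y)%g).
Proof.
move=> x; apply: (@continuous_comp _ _ _ (pair^~ y) (fun z : G * G => (z.1 * z.2)%g)).
  by apply: cvg_pair => /=; [exact: cvg_id|exact: cvg_cst].
exact: mulg_continuous.
Qed.

Lemma identity_component1 : identity_component 1%g.
Proof. exact: connected_component_refl. Qed.

Lemma identity_componentM x y : identity_component x -> identity_component y ->
  identity_component (x * y)%g.
Proof.
move=> Ix; apply: (identity_component_image (f := fun y => (x * y)%g)).
  exact: mulg_continuousl.
by rewrite mulg1.
Qed.

Lemma identity_componentV x : identity_component x -> identity_component (x^-1)%g.
Proof.
apply: (identity_component_image (f := fun x => (x^-1)%g)).
  exact: invg_continuous.
by rewrite invg1; exact: identity_component1.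
Qed.

Lemma identity_componentJ u x :
  identity_component x -> identity_component (u * x * u^-1)%g.
Proof.
apply: (identity_component_image (f := fun x => (u * x * u^-1)%g)).
  move=> y; apply: (@continuous_comp _ _ _ (fun y => (u * y)%g)
    (fun y => (y * u^-1)%g)).
    exact: mulg_continuousl.
  exact: mulg_continuousr.
by rewrite mulg1 mulgV; exact: identity_component1.
Qed.

Definition identity_component_type : Type := set_type identity_component.

HB.instance Definition _ := SubChoice.on identity_component_type.
HB.instance Definition _ := Topological.on identity_component_type.

Fact identity_component_group_closed :
  group_closed (fun x => x \in identity_component).
Proof.
split; first exact/mem_set/identity_component1.
move=> x y /set_mem Ix /set_mem Iy; apply/mem_set.
exact/identity_componentM/identity_componentV.
Qed.

HB.instance Definition _ :=
  SubChoice_isSubGroup.Build G _ identity_component_type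
    identity_component_group_closed.

Let val_continuous : continuous (val : identity_component_type -> G).
Proof. exact: initial_continuous. Qed.

Fact identity_component_mulg_continuous : continuous
  (fun xy : identity_component_type * identity_component_type =>
     (xy.1 * xy.2)%g).
Proof.
apply: (@continuous_comp_initial _ _ _ (set_val : set_type identity_component -> G)).
move=> xy; apply: (@continuous_comp _ _ _
  (fun z : identity_component_type * identity_component_type =>
     (val z.1, val z.2)) (fun z : G * G => (z.1 * z.2)%g)).
  apply: cvg_pair => /=.
    by apply: (cvg_comp fst val); [exact: cvg_fst|exact: val_continuous].
  by apply: (cvg_comp snd val); [exact: cvg_snd|exact: val_continuous].
exact: mulg_continuous.
Qed.

Fact identity_component_invg_continuous :
  continuous (fun x : identity_component_type => (x^-1)%g).
Proof.
apply: (@continuous_comp_initial _ _ _ (set_val : set_type identity_component -> G)).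
move=> x; apply: (cvg_comp val (fun z : G => (z^-1)%g)).
  exact: val_continuous.
exact: invg_continuous.
Qed.

HB.instance Definition _ :=
  isTopologicalGroup.Build identity_component_type
    identity_component_mulg_continuous identity_component_invg_continuous.

Definition conj_identity_component u (g : identity_component_type) :
    identity_component_type :=
  exist _ (u * val g * u^-1)%g
    (mem_set (identity_componentJ u (set_mem (valP g)))).

Definition Inn : set (identity_component_type -> identity_component_type) :=
  range conj_identity_component.

End IdentityComponent.

Section Smooth.
Variable R : realType.

(** Class C^k on an open set [U], by iterated continuous partial derivatives.
    [f] is total, but only its values on [U] matter. *)
Fixpoint continuously_differentiable m p (k : nat) (U : set 'rV[R]_m)
    (f : 'rV[R]_m -> 'rV[R]_p) : Prop :=
  (forall x, U x -> {for x, continuous f}) /\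
  if k is k'.+1 then
    forall i : 'I_m,
      (forall x, U x -> derivable f x (delta_mx 0 i)) /\
      continuously_differentiable k' U ('D_(delta_mx 0 i) f)
  else True.

Definition smooth_on m p (U : set 'rV[R]_m) (f : 'rV[R]_m -> 'rV[R]_p) : Prop :=
  forall k, continuously_differentiable k U f.

(** A homeomorphism from the open set [chart_dom] onto an open subset of R^m;
    both maps are total, with irrelevant values outside these sets. *)
Record chart m (M : topologicalType) := Chart {
  chart_dom : set M;
  chart_fun :> M -> 'rV[R]_m;
  chart_inv : 'rV[R]_m -> M;
  chart_dom_open : open chart_dom;
  chart_img_open : open (chart_fun @` chart_dom);
  chart_funK : {in chart_dom, cancel chart_fun chart_inv};
  chart_fun_continuous : {in chart_dom, continuous chart_fun};
  chart_inv_continuous : {in chart_fun @` chart_dom, continuous chart_inv}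
}.

Definition smooth_atlas m (M : topologicalType) (A : set (chart m M)) : Prop :=
  (forall x, exists2 c, A c & chart_dom c x) /\
  (forall c d, A c -> A d ->
     smooth_on (c @` (chart_dom c `&` chart_dom d)) (d \o chart_inv c)).

Definition smooth_map m p (M N : topologicalType)
    (A : set (chart m M)) (B : set (chart p N)) (f : M -> N) : Prop :=
  continuous f /\
  (forall c d, A c -> B d ->
     smooth_on (c @` (chart_dom c `&` f @^-1` chart_dom d))
       (d \o f \o chart_inv c)).

(** Smoothness of a map on the product manifold [M1 * M2], read in the product
    charts [(c1, c2)], which take values in ['rV[R]_(m1 + m2)]. *)
Definition smooth_map2 m1 m2 p (M1 M2 N : topologicalType)
    (A1 : set (chart m1 M1)) (A2 : set (chart m2 M2)) (B : set (chart p N))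
    (f : M1 * M2 -> N) : Prop :=
  continuous f /\
  (forall c1 c2 d, A1 c1 -> A2 c2 -> B d ->
     smooth_on
       [set row_mx (c1 z.1) (c2 z.2) | z in
          (chart_dom c1 `*` chart_dom c2) `&` f @^-1` chart_dom d]
       (fun v => d (f (chart_inv c1 (lsubmx v), chart_inv c2 (rsubmx v))))).

Definition is_Lie_group (G : topologicalGroupType) : Prop :=
  hausdorff_space G /\
  exists m (A : set (chart m G)),
    [/\ smooth_atlas A,
        smooth_map2 A A A (fun xy : G * G => (xy.1 * xy.2)%g) &
        smooth_map A A (fun x : G => (x^-1)%g)].

End Smooth.

Definition separable (T : topologicalType) : Prop :=
  exists D : set T, countable D /\ dense D.

Section Metric.
Variable R : realType.

Definition is_metric T (d : T -> T -> R) : Prop :=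
  [/\ forall x y, 0 <= d x y,
      forall x y, d x y = 0 <-> x = y,
      forall x y, d x y = d y x &
      forall x y z, d x z <= d x y + d y z].

Definition compatible_metric (T : topologicalType) (d : T -> T -> R) : Prop :=
  is_metric d /\
  forall x : T,
    nbhs x = filter_from [set e : R | 0 < e] (fun e => [set y | d x y < e]).

Definition TSI (G : topologicalGroupType) : Prop :=
  exists d : G -> G -> R, compatible_metric d /\
    forall g h x y : G, d (g * x * h)%g (g * y * h)%g = d x y.

End Metric.

Definition borel_map (X Y : topologicalType) (f : X -> Y) : Prop :=
  forall B : set Y, <<s open >> B -> <<s open >> (f @^-1` B).

Definition borel_reducible (X Y : topologicalType)
    (E : X -> X -> Prop) (F : Y -> Y -> Prop) : Prop :=
  exists theta : X -> Y, borel_map theta /\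
    forall x y, E x y <-> F (theta x) (theta y).

(** [{ptws nat -> G}] carries the product topology. *)
Definition E (G : topologicalGroupType) (x y : {ptws nat -> G}) : Prop :=
  exists l : G, (fun n => x n * (y n)^-1)%g @ \oo --> l.

(* Main.v *)
Require Import Defs.
From mathcomp Require Import all_boot all_order all_algebra.
From mathcomp Require Import all_classical all_reals all_analysis.
From mathcomp Require Import lra zify.
Set Implicit Arguments.
Unset Strict Implicit.
Unset Printing Implicit Defensive.
Import Order.TTheory GRing.Theory Num.Theory.
Import numFieldNormedType.Exports.
Local Open Scope classical_set_scope.
Local Open Scope ring_scope.

(** Write [x n] as a product of increments. Both [E G] and [E H] only see how
    the ratio of two such products moves in the end, and a small movement takes
    place inside the identity component, which is open since the group is
    locally Euclidean ([identity_component_open]) and is a copy of [R^n] in which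
    every Cauchy sequence converges ([E_cauchy]).

    From [phi] to a reduction. Choose a dense sequence [D k] of [G] and elements
    [t k] of [H] which act by conjugation on [H_0] as [D k] does on [G_0], read
    through [phi]. Every increment is [D k * g] for some index [k] and some [g]
    in [G_0]; replacing it by [t k * phi g] and multiplying up gives a sequence
    of [H] ([transport]). If two sequences use the same indices from some point
    on, then their ratio and the ratio of the images change by corresponding
    elements of [G_0] and [H_0] ([transport_ratio]), so that one converges if
    and only if the other does. Equivalent sequences do use the same indices in
    the end, and bits inserted between the terms of the image force the same for
    inequivalent indices ([coset_bits_agree]). The resulting map is even
    continuous.

    From a Borel reduction to [phi]. Let the letters [e 0, e 1, ...] enumerate a
    countable dense subgroup of [G] which contains the halves of its vectors in
    [G_0] and a basis of [G_0]; a sequence of letters codes the sequence of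
    its partial products. A Borel map on the space of codes is continuous on a
    comeager set, and a change of finitely many letters changes its value only
    within a class of [E H]. Inserting generic words with product [1] between the
    letters ([fusion]) makes the value depend on the letters block by block:
    letter number [i] being [a] contributes a factor [T i a] of [H], up to an
    error summable over [i] ([coded_reduction]). The reduction property now says
    that the ratio of two products of letters converges if and only if the ratio
    of the corresponding products of the [T i a] does, together with a quantity
    that measures the oscillation within a block.

    This equivalence is automatically uniform, as infinitely many violations
    could be lined up in one sequence ([uniform_transfer]). Moreover small words
    which multiply to [1] in [G] have images that tend to [1]: otherwise many of
    them could be multiplied without leaving a small ball, whereas the subsums of
    a sequence of vectors that are not small are unbounded ([small_loops],
    [bounded_subsums_small]). Applied to short loops this yields that [T i b]
    converges as [i] grows for every small letter [b], that the limit is additive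
    in [b], and that it is compatible with conjugation by [T i u]
    ([letter_limits]). On the vectors of [G_0] the limit therefore is given by a
    matrix ([letter_matrix]), which is invertible because the reverse implication
    bounds a vector by its image ([letter_matrix_unit]). Finally, conjugation by
    [u] in [G_0] is intertwined with conjugation by [T i u] only in the limit,
    but as [Inn_H(H_0)] is finite, one of its elements occurs for infinitely many
    [i] and is the conjugation sought ([letter_matrix_conj]). *)

(** * Baire category on the space of integer sequences *)

Section Forcing.
Implicit Types (s t u v : seq nat) (y : nat -> nat) (P Q : (nat -> nat) -> Prop).

Definition extends_string s y := mkseq y (size s) = s.

Definition dense_strings (D : set (seq nat)) := forall s, exists t, D (s ++ t).

Definition hits y (D : set (seq nat)) := exists n, D (mkseq y n).

(** [P] holds on a comeager subset of the branches through [t]; the dense open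
    sets whose intersection witnesses this are given by dense sets of strings. *)
Definition forces t P := exists Ds : nat -> set (seq nat),
  (forall k, dense_strings (Ds k)) /\
  forall y, extends_string t y -> (forall k, hits y (Ds k)) -> P y.

Lemma mkseq_cat y m n : mkseq y (m + n) = mkseq y m ++ mkseq (fun i => y (m + i)) n.
Proof.
rewrite /mkseq iotaD map_cat; congr (_ ++ _).
by rewrite add0n -[m in iota m]addn0 iotaDl -map_comp.
Qed.

Lemma extends_string_mkseq y n : extends_string (mkseq y n) y.
Proof. by rewrite /extends_string size_mkseq. Qed.

Lemma extends_string_catl s t y : extends_string (s ++ t) y -> extends_string s y.
Proof.
rewrite /extends_string size_cat mkseq_cat => /eqP.
by rewrite eqseq_cat ?size_mkseq // => /andP[/eqP].
Qed.

Lemma extends_string_nth s y i : extends_string s y -> (i < size s)%N -> y i = nth 0%N s i.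
Proof. by move=> <-; rewrite size_mkseq => lti; rewrite nth_mkseq. Qed.

Lemma extends_stringP s y :
  (forall i, (i < size s)%N -> y i = nth 0%N s i) -> extends_string s y.
Proof.
move=> eqy; apply: (@eq_from_nth _ 0%N); rewrite size_mkseq // => i lti.
by rewrite nth_mkseq // eqy.
Qed.

Lemma forcesI (I : countType) (Ds : I -> set (seq nat)) t P :
  (forall i, dense_strings (Ds i)) ->
  (forall y, extends_string t y -> (forall i, hits y (Ds i)) -> P y) -> forces t P.
Proof.
move=> dDs DsP.
exists (fun n => if unpickle n is Some i then Ds i else setT); split.
  by move=> n; case: unpickle => [i|] //; move=> s; exists [::].
move=> y ty meetsy; apply: DsP => // i.
by have := meetsy (pickle i); rewrite pickleK.
Qed.

Lemma forces_mono t P Q : (forall y, extends_string t y -> P y -> Q y) ->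
  forces t P -> forces t Q.
Proof. by move=> PQ [Ds [dDs DsP]]; exists Ds; split=> // y ty /(DsP y ty); exact: PQ. Qed.

Lemma forces_cat t s P : forces t P -> forces (t ++ s) P.
Proof.
move=> [Ds [dDs DsP]]; exists Ds; split=> // y /extends_string_catl; exact: DsP.
Qed.

Lemma forces_all (I : countType) t (P : I -> (nat -> nat) -> Prop) :
  (forall i, forces t (P i)) -> forces t (fun y => forall i, P i y).
Proof.
move=> /choice[Ds DsP].
apply: (@forcesI (I * nat)%type (fun ij => Ds ij.1 ij.2)) => [[i j]|y ty my i].
  exact: (DsP i).1.
by apply: (DsP i).2 => // k; exact: (my (i, k)).
Qed.

Lemma forces_and t P Q : forces t P -> forces t Q -> forces t (fun y => P y /\ Q y).
Proof.
move=> tP tQ; have : forces t (fun y => forall b : bool, if b then P y else Q y).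
  by apply: forces_all => -[].
by apply: forces_mono => y _ PQ; split; [exact: (PQ true)|exact: (PQ false)].
Qed.

Lemma extends_string_comparable s t y : extends_string s y -> extends_string t y ->
  (exists r, t = s ++ r) \/ (exists r, s = t ++ r).
Proof.
move=> sy ty; have [le_st|/ltnW le_ts] := leqP (size s) (size t).
  left; exists (mkseq (fun i => y (size s + i)%N) (size t - size s)).
  by rewrite -[in LHS]ty -[X in X ++ _]sy -mkseq_cat subnKC.
right; exists (mkseq (fun i => y (size t + i)%N) (size s - size t)).
by rewrite -[in LHS]sy -[X in X ++ _]ty -mkseq_cat subnKC.
Qed.

(** A property that is comeager in an open set which is dense below [t] is comeager
    below [t]: the countably many witnesses for the strings involved are put
    together with that dense open set. *)
Lemma forces_densely t P :
  (forall s, exists s', forces (t ++ s ++ s') P) -> forces t P.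
Proof.
move=> densP.
pose D0 : set (seq nat) :=
  [set u | forces u P \/ forall y, extends_string u y -> ~ extends_string t y].
have dD0 : dense_strings D0.
  move=> s; have [[y [sy ty]]|no] := pselect (exists y, extends_string s y /\ extends_string t y).
    have [[r def_t]|[r def_s]] := extends_string_comparable sy ty.
      have [s' Ps'] := densP [::]; exists (r ++ s'); left.
      by rewrite catA -def_t.
    by have [s' Ps'] := densP r; exists s'; left; rewrite def_s -catA.
  by exists [::]; right; rewrite cats0 => y sy ty; apply: no; exists y.
have /choice[Es EsP] : forall u, exists Ds : nat -> set (seq nat),
    (forall k, dense_strings (Ds k)) /\ (forces u P ->
    forall y, extends_string u y -> (forall k, hits y (Ds k)) -> P y).
  move=> u; have [[Ds [dDs DsP]]|nuP] := pselect (forces u P); first by exists Ds.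
  by exists (fun=> setT); split=> // _ s; exists [::].
apply: (@forcesI (option (seq nat * nat))
  (fun o => if o is Some uk then Es uk.1 uk.2 else D0)) => [[[u k]|] //|].
  exact: (EsP u).1.
move=> y ty my; have [n [fn|no]] := my None.
  apply: (EsP _).2 fn _ (extends_string_mkseq y n) _ => k.
  exact: (my (Some (mkseq y n, k))).
by case: (no y (extends_string_mkseq y n)).
Qed.

(** The Baire category theorem: a decreasing sequence of strings meeting the
    dense sets one after the other has a limit. *)
Lemma forces_ex t P : forces t P -> exists2 y, extends_string t y & P y.
Proof.
move=> [Ds [dDs DsP]].
have /choice[next nextP] : forall ks : nat * seq nat, exists u,
    (exists r, u = ks.2 ++ 0%N :: r) /\ Ds ks.1 u.
  move=> [k s]; have [r Dr] := dDs k (rcons s 0%N).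
  by exists (rcons s 0%N ++ r); split => //; exists r; rewrite cat_rcons.
pose st := fix st k := if k is k'.+1 then next (k', st k') else t.
have stS k : exists r, st k.+1 = st k ++ 0%N :: r by exact: (nextP (k, st k)).1.
have stD k d : exists r, st (k + d)%N = st k ++ r.
  elim: d => [|d [r IH]]; first by exists [::]; rewrite addn0 cats0.
  have [r'] := stS (k + d)%N; rewrite -addnS IH => ->.
  by exists (r ++ 0%N :: r'); rewrite -catA.
have size_st k : (k <= size (st k))%N.
  elim: k => // k IH; have [r ->] := stS k.
  by rewrite size_cat /= addnS ltnS (leq_trans IH) ?leq_addr.
pose y i := nth 0%N (st i.+1) i.
have sty k : extends_string (st k) y.
  apply: extends_stringP => i lti; rewrite /y.
  have [le_ik|/ltnW le_ki] := leqP i.+1 k.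
    have [r def_k] := stD i.+1 (k - i.+1)%N; rewrite subnKC // in def_k.
    by rewrite def_k nth_cat size_st.
  have [r def_i] := stD k (i.+1 - k)%N; rewrite subnKC // in def_i.
  by rewrite def_i nth_cat lti.
exists y; first exact: (sty 0%N).
apply: DsP => [|k]; first exact: (sty 0%N).
exists (size (st k.+1)); rewrite sty; exact: (nextP (k, st k)).2.
Qed.

(** The Baire property of [A], in the form in which it is applied. *)
Definition decided (A : set (nat -> nat)) :=
  forall s, exists t, forces (s ++ t) A \/ forces (s ++ t) (~` A).

Lemma decided_setC A : decided A -> decided (~` A).
Proof.
move=> dA s; have [t [tA|tA]] := dA s; exists t; [right|by left].
by rewrite setCK.
Qed.

(** If no extension of [s] forces one of the [A i], then densely many of them force
    the complement of each, and so [s] forces all complements at once. *)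
Lemma decided_bigcup (A : nat -> set (nat -> nat)) :
  (forall i, decided (A i)) -> decided (\bigcup_i A i).
Proof.
move=> dA s.
have [[t [i tA]]|no] := pselect (exists t i, forces (s ++ t) (A i)).
  by exists t; left; apply: forces_mono tA => y _ Ay; exists i.
exists [::]; right; rewrite cats0.
have : forces s (fun y => forall i, (~` A i) y).
  apply: forces_all => i; apply: forces_densely => t.
  have [t' [tA|tA]] := dA i (s ++ t); last by exists t'; rewrite catA.
  by case: no; exists (t ++ t'), i; rewrite catA.
by apply: forces_mono => y _ nA [i _ /nA].
Qed.

Definition open_branches (A : set (nat -> nat)) :=
  forall y, A y -> exists n, forall y', extends_string (mkseq y n) y' -> A y'.

Lemma decided_open A : open_branches A -> decided A.
Proof.
move=> oA s; have [[t tA]|no] := pselect (exists t, forces (s ++ t) A).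
  by exists t; left.
exists [::]; right; rewrite cats0; exists (fun=> setT); split.
  by move=> _ u; exists [::].
move=> y sy _ Ay; have [n nA] := oA y Ay; apply: no.
exists (mkseq (fun i => y (size s + i)%N) n); exists (fun=> setT); split.
  by move=> _ u; exists [::].
move=> y'; rewrite -{1}sy -mkseq_cat addnC mkseq_cat => /extends_string_catl y'y _.
exact: nA.
Qed.

Definition overwrite r y i := if (i < size r)%N then nth 0%N r i else y i.

Lemma mkseq_overwrite r y n : (size r <= n)%N ->
  mkseq (overwrite r y) n = r ++ drop (size r) (mkseq y n).
Proof.
move=> le_rn; apply: (@eq_from_nth _ 0%N).
  by rewrite size_cat size_drop !size_mkseq subnKC.
move=> i; rewrite size_mkseq => lti; rewrite nth_mkseq // nth_cat /overwrite.
by case: ltnP => // le_ri; rewrite nth_drop subnKC // nth_mkseq.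
Qed.

Lemma extends_overwrite r s t y : size r = size s ->
  extends_string (s ++ t) y -> extends_string (r ++ t) (overwrite r y).
Proof.
move=> eq_rs sty; apply: extends_stringP => i; rewrite nth_cat /overwrite size_cat => lti.
case: ltnP => // le_ri; rewrite (extends_string_nth sty) ?size_cat -?eq_rs //.
by rewrite nth_cat -eq_rs ltnNge le_ri.
Qed.

(** Exchanging the initial segments [r] and [s] is a homeomorphism between the
    branches through them, and so it preserves category. *)
Lemma forces_overwrite r s t P : size r = size s ->
  forces (r ++ t) P -> forces (s ++ t) (P \o overwrite r).
Proof.
move=> eq_rs [Ds [dDs DsP]].
exists (fun k u => (size r <= size u)%N /\ Ds k (r ++ drop (size r) u)); split.
  move=> k u; have [v Dv] := dDs k (r ++ drop (size r) (u ++ nseq (size r) 0%N)).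
  exists (nseq (size r) 0%N ++ v); split.
    by rewrite !size_cat size_nseq addnCA leq_addr.
  have : (size r <= size (u ++ nseq (size r) 0%N))%N.
    by rewrite size_cat size_nseq leq_addl.
  move: Dv; rewrite !catA; move: (u ++ _) => w; rewrite drop_cat => Dv.
  rewrite leq_eqVlt => /predU1P[eq_rw|->]; last by rewrite catA.
  by move: Dv; rewrite eq_rw ltnn subnn drop0 drop_size cats0.
move=> y sty my; apply: DsP; first exact: extends_overwrite sty.
move=> k; have [n []] := my k; rewrite size_mkseq => le_rn Dn.
by exists n; rewrite mkseq_overwrite.
Qed.

End Forcing.

(** * Two-sided invariant metrics *)

Lemma ltr_half_exp (R : realType) (e : R) : 0 < e -> exists k, 2^-1 ^+ k < e.
Proof.
move=> e0; exists (Num.bound e^-1).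
rewrite exprVn invf_plt ?posrE ?exprn_gt0 //.
rewrite (lt_trans (archi_boundP _)) ?invr_ge0 ?ltW //.
by rewrite -natrX ltr_nat ltn_expl.
Qed.

Section InvariantMetric.
Variables (R : realType) (K : groupType) (d : K -> K -> R).

Definition biinvariant_metric :=
  is_metric d /\ forall g h x y : K, d (g * x * h)%g (g * y * h)%g = d x y.

Definition cauchy_sequence (u : nat -> K) :=
  forall e, 0 < e -> exists N, forall n, (N <= n)%N -> d (u n) (u N) < e.

Hypothesis dP : biinvariant_metric.

Lemma dist_ge0 x y : 0 <= d x y. Proof. by case: dP => [[]]. Qed.
Lemma distxx x : d x x = 0. Proof. by case: dP => [[_ d0 _ _] _]; apply/d0. Qed.
Lemma dist_eq0 x y : d x y = 0 -> x = y.
Proof. by case: dP => [[_ d0 _ _] _] /d0. Qed.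
Lemma distC x y : d x y = d y x. Proof. by case: dP => [[]]. Qed.
Lemma dist_triangle y x z : d x z <= d x y + d y z.
Proof. by case: dP => [[]]. Qed.
Lemma dist_mulr h x y : d (x * h)%g (y * h)%g = d x y.
Proof. by case: dP => [_ dI]; rewrite -(dI 1%g h x y) !mul1g. Qed.
Lemma dist_mull g x y : d (g * x)%g (g * y)%g = d x y.
Proof. by case: dP => [_ dI]; rewrite -(dI g 1%g x y) !mulg1. Qed.
Lemma dist_mul x y x' y' : d (x * y)%g (x' * y')%g <= d x x' + d y y'.
Proof.
by apply: le_trans (dist_triangle (x' * y)%g _ _) _; rewrite dist_mulr dist_mull.
Qed.
Lemma dist_div1 x y : d (x * y^-1)%g 1%g = d x y.
Proof. by rewrite -(dist_mulr y) mulgVK mul1g. Qed.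
Lemma dist_Vmul1 x y : d (x^-1 * y)%g 1%g = d x y.
Proof. by rewrite -(dist_mull x) mulVKg mulg1 distC. Qed.
Lemma dist_inv x y : d (x^-1)%g (y^-1)%g = d x y.
Proof. by rewrite -(dist_mull x) mulgV distC dist_div1. Qed.
Lemma dist_conj1 g x : d (g * x * g^-1)%g 1%g = d x 1%g.
Proof. by rewrite dist_div1 -{2}(mulg1 g) dist_mull. Qed.

(** The distance between the increments of two sequences is the distance that their
    ratio moves, which requires invariance on both sides. *)
Lemma dist_Vmul_div a a' b b' :
  d (a^-1 * a')%g (b^-1 * b')%g = d (a' * b'^-1)%g (a * b^-1)%g.
Proof. by rewrite -(dist_mull a) mulVKg -(dist_mulr b'^-1) !mulgA mulgK. Qed.

Lemma cauchy_mul u v : cauchy_sequence u -> cauchy_sequence v ->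
  cauchy_sequence (fun n => u n * v n)%g.
Proof.
move=> cu cv e e0; have e40 : 0 < e / 4 by rewrite divr_gt0.
have [[N uN] [M vM]] := (cu _ e40, cv _ e40).
exists (maxn N M) => n; rewrite geq_max => /andP[leN leM].
apply: le_lt_trans (dist_mul _ _ _ _) _.
have un : d (u n) (u (maxn N M)) < e / 2.
  apply: le_lt_trans (dist_triangle (u N) _ _) _.
  have -> : e / 2 = e / 4 + e / 4 by lra.
  by rewrite ltrD ?uN // distC uN ?leq_maxl.
have vn : d (v n) (v (maxn N M)) < e / 2.
  apply: le_lt_trans (dist_triangle (v M) _ _) _.
  have -> : e / 2 = e / 4 + e / 4 by lra.
  by rewrite ltrD ?vM // distC vM ?leq_maxr.
by rewrite [e]splitr ltrD.
Qed.

Lemma cauchy_inv u : cauchy_sequence u -> cauchy_sequence (fun n => (u n)^-1)%g.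
Proof. by move=> cu e /cu[N uN]; exists N => n /uN; rewrite dist_inv. Qed.

Lemma cauchy_ext u v : u =1 v -> cauchy_sequence u -> cauchy_sequence v.
Proof. by move=> /funext ->. Qed.

Lemma cauchy_sequenceP u : cauchy_sequence u <->
  forall e : R, 0 < e -> exists N, forall m n, (N <= m)%N -> (N <= n)%N -> d (u m) (u n) < e.
Proof.
split=> cu e e0; last by have [N uN] := cu e e0; exists N => n leN; exact: uN.
have [|N uN] := cu (e / 2); first by rewrite divr_gt0.
exists N => m n lem len; apply: le_lt_trans (dist_triangle (u N) _ _) _.
by rewrite [e]splitr ltrD ?uN // distC uN.
Qed.

(** Here [u] is [v] with its terms repeated, [g n] is the index of the term at
    position [n], and [k i] is a position at which the [i]-th term occurs. *)
Lemma cauchy_reindex u v (g k : nat -> nat) :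
  (forall n, (k 0 <= n)%N -> u n = v (g n)) -> (forall i, g (k i) = i) ->
  (forall N, exists M, forall n, (M <= n)%N -> (N <= g n)%N) ->
  (forall i j, (i <= j)%N -> (k i <= k j)%N) -> (forall i, (i <= k i)%N) ->
  cauchy_sequence u <-> cauchy_sequence v.
Proof.
move=> uv gk g_inf k_mono le_k; rewrite !cauchy_sequenceP; split=> cu e e0.
  have [N uN] := cu e e0; exists N => m n lem len.
  by rewrite -(gk m) -(gk n) -!uv ?k_mono //; apply: uN; exact: leq_trans (le_k _).
have [N vN] := cu e e0; have [M gM] := g_inf N.
exists (maxn M (k 0)) => m n; rewrite !geq_max => /andP[lem lem'] /andP[len len'].
by rewrite !uv //; apply: vN; exact: gM.
Qed.

Lemma cauchy_shift u : cauchy_sequence (fun n => u n.+1) <-> cauchy_sequence u.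
Proof.
rewrite !cauchy_sequenceP; split=> cu e e0; have [N uN] := cu e e0.
  by exists N.+1 => -[//|m] [//|n]; exact: uN.
by exists N => m n lem len; apply: uN; exact: leqW.
Qed.

Lemma cauchy_geometric u (c : R) : (forall i, d (u i.+1) (u i) <= c * 2^-1 ^+ i) ->
  cauchy_sequence u.
Proof.
move=> uc e e0; have c0 : 0 <= c.
  by have := uc 0%N; rewrite expr0 mulr1; apply: le_trans; exact: dist_ge0.
have c1 : 0 < 2 * c + 1 by rewrite ltr_wpDl // mulr_ge0.
have [N ltN] := ltr_half_exp (divr_gt0 e0 c1); exists N => n le_Nn.
rewrite -(subnKC le_Nn); set i := (n - N)%N.
have half0 j : 0 < 2^-1 ^+ j :> R by rewrite exprn_gt0 // invr_gt0.
have step : d (u (N + i)%N) (u N) <= 2 * c * 2^-1 ^+ N - 2 * c * 2^-1 ^+ (N + i).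
  elim: i => [|i IH]; first by rewrite addn0 distxx subrr.
  apply: le_trans (dist_triangle (u (N + i)%N) _ _) _.
  by have := uc (N + i)%N; rewrite addnS exprS; move: IH; lra.
rewrite ltr_pdivlMr // in ltN.
have := mulr_ge0 c0 (ltW (half0 (N + i)%N)); have := half0 N.
by move: step ltN; lra.
Qed.

End InvariantMetric.

(** * Products coded by integer sequences *)

(** Only the letters [0, ..., i] are allowed at position [i]. Every letter is thus
    allowed from some position on, while only finitely many words have a given
    length, as the inductive construction in [fusion] requires. *)
Definition valid_segment N (s : seq (nat * nat)) :=
  forall t, (t < size s)%N ->
    ((nth (0, 0) s t).1 <= N + t)%N /\ ((nth (0, 0) s t).2 <= N + t)%N.

Definition valid_pairs (x : nat -> nat * nat) :=
  forall n, ((x n).1 <= n)%N /\ ((x n).2 <= n)%N.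

Section Coding.
Variables (R : realType) (K : groupType) (d : K -> K -> R).
Variables (T : nat -> nat -> K) (D : nat -> nat -> nat -> R).

Fixpoint coded_product (w : nat -> nat) n : K :=
  if n is m.+1 then (coded_product w m * T m (w m))%g else 1%g.

Fixpoint segment_product N (s : seq nat) : K :=
  if s is a :: s' then (T N a * segment_product N.+1 s')%g else 1%g.

Definition segment_ratio N (s : seq (nat * nat)) : K :=
  (segment_product N (unzip1 s) * (segment_product N (unzip2 s))^-1)%g.

Definition coded_ratio (x : nat -> nat * nat) n : K :=
  (coded_product (fst \o x) n * (coded_product (snd \o x) n)^-1)%g.

(** The [n]-th factor may stand for a whole block of terms of some sequence of
    which the coded product gives the value at the end of the block. [D n a b]
    measures how far the letters [a] and [b] let two such sequences drift apart
    within the block; the ratio of the sequences converges if and only if it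
    does so along the ends of the blocks and these drifts tend to [0]. *)
Definition coded_equivalent (x : nat -> nat * nat) :=
  cauchy_sequence d (coded_ratio x) /\
  forall e, 0 < e -> exists N, forall n, (N <= n)%N -> D n (x n).1 (x n).2 < e.

(** A pair of words placed at position [N] which changes the ratio by less than [e]
    all along; by invariance the amount does not depend on what precedes. *)
Definition small_segment N s e :=
  (forall t, (t <= size s)%N -> d (segment_ratio N (take t s)) 1%g < e) /\
  (forall t, (t < size s)%N ->
     D (N + t) (nth (0, 0) s t).1 (nth (0, 0) s t).2 < e).

Lemma segment_product_cat N s s' : segment_product N (s ++ s') =
  (segment_product N s * segment_product (N + size s) s')%g.
Proof.
elim: s N => [|a s IH] N; first by rewrite mul1g addn0.
by rewrite /= IH mulgA addSnnS.
Qed.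

Lemma coded_product_segment w N n : coded_product w (N + n) =
  (coded_product w N * segment_product N (mkseq (fun i => w (N + i)%N) n))%g.
Proof.
elim: n => [|n IH]; first by rewrite addn0 mulg1.
by rewrite addnS [LHS]/= IH mkseqS -cats1 segment_product_cat /= size_mkseq mulg1 mulgA.
Qed.

Lemma segment_ratio_cat N s s' : segment_ratio N (s ++ s') =
  (segment_product N (unzip1 s) * segment_ratio (N + size s) s' *
   (segment_product N (unzip2 s))^-1)%g.
Proof.
rewrite /segment_ratio /unzip1 /unzip2 !map_cat !segment_product_cat !size_map.
by rewrite invgM !mulgA.
Qed.

Lemma coded_ratio_segment x N s :
  (forall t, (t < size s)%N -> x (N + t)%N = nth (0%N, 0%N) s t) ->
  forall t, (t <= size s)%N -> coded_ratio x (N + t) =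
    (coded_product (fst \o x) N * segment_ratio N (take t s) *
     (coded_product (snd \o x) N)^-1)%g.
Proof.
move=> xs t le_t; rewrite /coded_ratio !coded_product_segment invgM.
have xt : mkseq (fun i => x (N + i)%N) t = take t s.
  apply: (@eq_from_nth _ (0%N, 0%N)); rewrite size_mkseq ?size_takel // => i lti.
  by rewrite nth_mkseq // nth_take // xs // (leq_trans lti).
rewrite /segment_ratio -xt /unzip1 /unzip2 /mkseq -!map_comp !mulgA //.
Qed.

Hypothesis dP : biinvariant_metric d.
Hypothesis T0 : forall i, T i 0 = 1%g.
Hypothesis Dxx : forall i a, D i a a = 0.

Lemma dist_coded_ratio x N s :
  (forall t, (t < size s)%N -> x (N + t)%N = nth (0%N, 0%N) s t) ->
  forall t, (t <= size s)%N ->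
  d (coded_ratio x (N + t)) (coded_ratio x N) = d (segment_ratio N (take t s)) 1%g.
Proof.
move=> xs t le_t; rewrite (coded_ratio_segment xs) // /coded_ratio.
by rewrite (dist_mulr dP) -{2}(mulg1 (coded_product _ N)) (dist_mull dP).
Qed.

(** Since letter [0] stands for [1], padding moves a segment to a later position,
    where more letters are allowed. *)
Definition padding j : seq (nat * nat) := nseq j (0, 0)%N.

Lemma segment_product_padding N j : segment_product N (nseq j 0%N) = 1%g.
Proof. by elim: j N => //= j IH N; rewrite T0 mul1g IH. Qed.

Lemma unzip1_padding j : unzip1 (padding j) = nseq j 0%N.
Proof. by rewrite /unzip1 map_nseq. Qed.

Lemma unzip2_padding j : unzip2 (padding j) = nseq j 0%N.
Proof. by rewrite /unzip2 map_nseq. Qed.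

Lemma segment_ratio_padding N j s :
  segment_ratio N (padding j ++ s) = segment_ratio (N + j) s.
Proof.
rewrite segment_ratio_cat unzip1_padding unzip2_padding !segment_product_padding.
by rewrite invg1 mulg1 mul1g size_nseq.
Qed.

Lemma segment_ratio_nil N : segment_ratio N [::] = 1%g.
Proof. by rewrite /segment_ratio /= mulgV. Qed.

Lemma small_segment_padding N j s e : 0 < e ->
  small_segment N (padding j ++ s) e <-> small_segment (N + j) s e.
Proof.
move=> e0; rewrite /small_segment size_cat size_nseq; split=> -[sr sD]; split=> t lt_t.
- have := sr (j + t)%N; rewrite leq_add2l => /(_ lt_t).
  rewrite takeD take_size_cat ?size_nseq // drop_size_cat ?size_nseq //.
  by rewrite segment_ratio_padding.
- have := sD (j + t)%N; rewrite ltn_add2l => /(_ lt_t).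
  by rewrite nth_cat size_nseq ltnNge leq_addr /= addKn addnA.
- have [lt_tj|le_jt] := ltnP t j.
    rewrite take_cat size_nseq lt_tj take_nseq ?(ltnW lt_tj) // -[nseq _ _]cats0.
    by rewrite segment_ratio_padding segment_ratio_nil (distxx dP).
  have := sr (t - j)%N; rewrite leq_subLR => /(_ lt_t).
  by rewrite take_cat size_nseq ltnNge le_jt segment_ratio_padding.
- have [lt_tj|le_jt] := ltnP t j.
    by rewrite !nth_cat !size_nseq lt_tj !nth_nseq lt_tj Dxx.
  have := sD (t - j)%N; rewrite ltn_subLR // => /(_ lt_t).
  by rewrite nth_cat size_nseq ltnNge le_jt -addnA subnKC.
Qed.

End Coding.

Lemma valid_segment_padding N j s :
  valid_segment N (padding j ++ s) <-> valid_segment (N + j) s.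
Proof.
rewrite /valid_segment size_cat size_nseq; split=> vs t lt_t.
  have := vs (j + t)%N; rewrite ltn_add2l => /(_ lt_t).
  by rewrite nth_cat size_nseq ltnNge leq_addr /= addKn addnA.
have [lt_tj|le_jt] := ltnP t j.
  by rewrite nth_cat size_nseq lt_tj nth_nseq lt_tj.
have := vs (t - j)%N; rewrite ltn_subLR // => /(_ lt_t).
by rewrite nth_cat size_nseq ltnNge le_jt -addnA subnKC.
Qed.

(** [P k] is the position where the [k]-th segment starts; the segment has to depend
    on it because the meaning of a letter depends on its position. *)
Lemma concatenate_segments (A : Type) (a0 : A) (seg : nat -> nat -> seq A) :
  (forall k N, 0 < size (seg k N))%N ->
  exists (x : nat -> A) (P : nat -> nat), [/\ P 0 = 0%N,
    forall k, P k.+1 = (P k + size (seg k (P k)))%N &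
    forall k t, (t < size (seg k (P k)))%N -> x (P k + t)%N = nth a0 (seg k (P k)) t].
Proof.
move=> seg0.
pose pre := fix pre k := if k is k'.+1 then pre k' ++ seg k' (size (pre k')) else [::].
have preD k j : exists r, pre (k + j)%N = pre k ++ r.
  elim: j => [|j [r IH]]; first by exists [::]; rewrite addn0 cats0.
  by rewrite addnS /= IH; eexists; rewrite -catA.
have size_pre k : (k <= size (pre k))%N.
  by elim: k => //= k IH; rewrite size_cat -addn1 leq_add.
exists (fun n => nth a0 (pre n.+1) n), (fun k => size (pre k)); split => // [k|k t lt_t].
  by rewrite /= size_cat.
set N := size _.
have xE m : (N + t < size (pre m))%N -> nth a0 (pre m) (N + t) = nth a0 (pre (N + t).+1) (N + t).
  move=> ltm; have [le_m|/ltnW le_m] := leqP m (N + t).+1.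
    by have [r] := preD m ((N + t).+1 - m)%N; rewrite subnKC // => ->; rewrite nth_cat ltm.
  have [r] := preD (N + t).+1 (m - (N + t).+1)%N; rewrite subnKC // => ->.
  by rewrite nth_cat size_pre.
rewrite -(xE k.+1) /= ?size_cat ?ltn_add2l //.
by rewrite nth_cat ltnNge leq_addr /= addKn.
Qed.

(** * Uniformity of a reduction between coded products *)

Section Transfer.
Variables (R : realType) (K1 K2 : groupType).
Variables (d1 : K1 -> K1 -> R) (d2 : K2 -> K2 -> R).
Variables (T1 : nat -> nat -> K1) (T2 : nat -> nat -> K2).
Variables (D1 D2 : nat -> nat -> nat -> R).
Hypotheses (d1P : biinvariant_metric d1) (d2P : biinvariant_metric d2).
Hypotheses (T10 : forall i, T1 i 0 = 1%g) (T20 : forall i, T2 i 0 = 1%g).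
Hypotheses (D1xx : forall i a, D1 i a a = 0) (D2xx : forall i a, D2 i a a = 0).

(** If uniformity fails for [del], then there are, arbitrarily far out, segments
    that are [2^-k]-small on the left but not [del]-small on the right. Put end
    to end they form a pair of sequences that is equivalent on the left, because
    the [2^-k] are summable, and not on the right. *)
Lemma uniform_transfer :
  (forall x, valid_pairs x -> coded_equivalent d1 T1 D1 x -> coded_equivalent d2 T2 D2 x) ->
  forall del : R, 0 < del -> exists eta : R, 0 < eta /\ exists N0, forall N s, (N0 <= N)%N ->
    valid_segment N s -> small_segment d1 T1 D1 N s eta -> small_segment d2 T2 D2 N s del.
Proof.
move=> imp del del0; apply: contrapT => bad.
have /choice[seg segP] : forall kN : nat * nat, exists s,
    [/\ (0 < size s)%N, valid_segment kN.2 s, small_segment d1 T1 D1 kN.2 s (2^-1 ^+ kN.1) &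
     ~ small_segment d2 T2 D2 kN.2 s del].
  move=> [k M] /=; have eta0 : 0 < 2^-1 ^+ k :> R by rewrite exprn_gt0 // invr_gt0.
  apply: contrapT => no; apply: bad; exists (2^-1 ^+ k); split => //; exists M => N s leMN vs s1.
  apply: contrapT => s2; apply: no; exists (padding (N - M) ++ s).
  split; last 3 first.
  - by apply/valid_segment_padding; rewrite subnKC.
  - by apply/(small_segment_padding d1P T10 D1xx) => //; rewrite subnKC.
  - by move/(small_segment_padding d2P T20 D2xx _ _ _ del0); rewrite subnKC.
  rewrite size_cat addn_gt0; case: s vs s1 s2 => [|? ?] vs s1 s2; last by rewrite orbT.
  case: s2; split => // t; rewrite leqn0 => /eqP->.
  by rewrite segment_ratio_nil (distxx d2P).
have seg0 k N : (0 < size (seg (k, N)))%N by have [] := segP (k, N).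
have [x [P [P0 PS xP]]] := concatenate_segments (0, 0)%N seg0.
have PD k i : (P k + i <= P (k + i))%N.
  elim: i => [|i IH]; first by rewrite !addn0.
  rewrite !addnS PS; have := seg0 (k + i)%N (P (k + i)%N); lia.
have locate n : exists k t, n = (P k + t)%N /\ (t < size (seg (k, P k)))%N.
  elim: n => [|n [k [t [-> lt_t]]]]; first by exists 0%N, 0%N; rewrite P0.
  have [lt_t1|le_t1] := ltnP t.+1 (size (seg (k, P k))).
    by exists k, t.+1; rewrite addnS.
  exists k.+1, 0%N; split => //; rewrite PS addn0 -addnS; congr addn.
  by apply/eqP; rewrite eqn_leq lt_t le_t1.
have vx : valid_pairs x.
  move=> n; have [k [t [-> lt_t]]] := locate n; rewrite xP //.
  by have [_ /(_ t lt_t)] := segP (k, P k).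
have /imp[//|c2 D2s] : coded_equivalent d1 T1 D1 x.
  have step k t : (t <= size (seg (k, P k)))%N ->
      d1 (coded_ratio T1 x (P k + t)) (coded_ratio T1 x (P k)) < 2^-1 ^+ k.
    move=> le_t; rewrite (dist_coded_ratio T1 d1P (xP k)) //.
    by have [_ _ [/(_ t le_t)]] := segP (k, P k).
  have steps k i : d1 (coded_ratio T1 x (P (k + i)%N)) (coded_ratio T1 x (P k)) <=
      2 * 2^-1 ^+ k - 2 * 2^-1 ^+ (k + i)%N.
    elim: i => [|i IH]; first by rewrite addn0 (distxx d1P) subrr.
    apply: le_trans (dist_triangle d1P (coded_ratio T1 x (P (k + i)%N)) _ _) _.
    have := step (k + i)%N (size (seg (k + i, P (k + i)))%N) (leqnn _).
    rewrite -PS addnS exprS; move: IH; lra.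
  have located k n : (P k <= n)%N -> exists i t,
      n = (P (k + i) + t)%N /\ (t < size (seg (k + i, P (k + i))))%N.
    move=> le_n; have [j [t [def_n lt_t]]] := locate n.
    have [le_kj|lt_jk] := leqP k j; first by exists (j - k)%N, t; rewrite subnKC.
    have : (P j.+1 <= P k)%N.
      by have := PD j.+1 (k - j.+1)%N; rewrite subnKC //; lia.
    by rewrite PS; lia.
  split=> e e0.
    have [k ltk] : exists k, 2^-1 ^+ k < e / 2 by apply: ltr_half_exp; rewrite divr_gt0.
    exists (P k) => n /located[i [t [-> lt_t]]].
    apply: le_lt_trans (dist_triangle d1P (coded_ratio T1 x (P (k + i)%N)) _ _) _.
    have : 0 < 2^-1 ^+ (k + i)%N :> R by rewrite exprn_gt0 // invr_gt0.
    have := step _ _ (ltnW lt_t); have := steps k i; move: ltk; lra.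
  have [k ltk] : exists k, 2^-1 ^+ k < e by apply: ltr_half_exp.
  exists (P k) => n /located[i [t [-> lt_t]]]; rewrite xP //.
  have [_ _ [_ /(_ t lt_t) ltD] _] := segP ((k + i)%N, P (k + i)%N).
  apply: lt_trans ltD _; apply: le_lt_trans ltk.
  by rewrite exprD ler_piMr ?exprn_ge0 ?exprn_ile1 ?invr_ge0 ?invf_le1 ?ler1n.
have del20 : 0 < del / 2 by rewrite divr_gt0.
have [[N1 c2N] [N2 D2N]] := (c2 _ del20, D2s _ del0).
pose k := maxn N1 N2; have leN i : (k <= P k + i)%N.
  by have := PD 0%N k; rewrite P0 !add0n => /leq_trans; apply; exact: leq_addr.
have [_ _ _ []] := segP (k, P k); split=> t lt_t.
  rewrite -(dist_coded_ratio T2 d2P (xP k)) //.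
  apply: le_lt_trans (dist_triangle d2P (coded_ratio T2 x N1) _ _) _.
  rewrite [del]splitr ltrD //; last rewrite (distC d2P).
    by apply: c2N; rewrite (leq_trans _ (leN t)) ?leq_maxl.
  by apply: c2N; rewrite -[P k]addn0 (leq_trans _ (leN 0%N)) ?leq_maxl.
rewrite -(xP k t lt_t); apply: D2N; rewrite (leq_trans _ (leN t)) ?leq_maxr //.
Qed.

End Transfer.

(** * Open vector subgroups *)

Lemma coord_le_norm (R : realType) n (x : 'rV[R]_n) j : `|x ord0 j| <= `|x|.
Proof.
rewrite [leRHS]mx_normrE.
exact: (le_bigmax _ (fun ij => `|x ij.1 ij.2|) (ord0, j)).
Qed.

Lemma norm_le_sum_coord (R : realType) n (x : 'rV[R]_n) : `|x| <= \sum_j `|x ord0 j|.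
Proof.
have [->|x0] := eqVneq (`|x|) 0; first by rewrite sumr_ge0.
have [[i j] /= nx] := mx_norm_neq0 x0.
have -> : `|x| = `|x i j| by exact: nx.
by rewrite (ord1 i) (bigD1 j) //= lerDl sumr_ge0.
Qed.

(** If all partial subsums of a sequence of vectors stay in the unit ball, then
    the norms are summable, since the positive and the negative parts of each
    coordinate are; in particular the norms are not bounded below. *)
Lemma bounded_subsums_small (R : realType) n (x : nat -> 'rV[R]_n) (c : R) : 0 < c ->
  (forall (A : nat -> bool) k, `|\sum_(i < k | A i) x i| < 1) ->
  exists i, `|x i| < c.
Proof.
move=> c0 bnd; apply: contrapT => /forallNP no.
have cx i : c <= `|x i| by rewrite leNgt; apply/negP/no.
pose k := Num.bound (2 * n%:R / c).
have kP : 2 * n%:R < k%:R * c.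
  by rewrite -ltr_pdivrMr // archi_boundP ?divr_ge0 ?mulr_ge0 // ltW.
suff : k%:R * c <= 2 * n%:R by rewrite leNgt kP.
apply: (@le_trans _ _ (\sum_(i < k) \sum_j `|x i ord0 j|)).
  have -> : k%:R * c = \sum_(i < k) c by rewrite sumr_const card_ord mulr_natl.
  by apply: ler_sum => i _; rewrite (le_trans (cx i)) // norm_le_sum_coord.
rewrite exchange_big /= (le_trans (ler_sum _ (_ : forall j, _ -> _ <= 2)%R)) //; last first.
  by rewrite sumr_const card_ord mulr_natr.
move=> j _; rewrite (bigID (fun i : 'I_k => 0 <= x i ord0 j)) /=.
have sub (A : nat -> bool) : `|\sum_(i < k | A i) x i ord0 j| <= 1.
  by rewrite -summxE (le_trans (coord_le_norm _ _)) // ltW.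
rewrite -[2]/(1 + 1) lerD //.
  rewrite (eq_bigr (fun i : 'I_k => x i ord0 j)); last by move=> i; exact: ger0_norm.
  exact: le_trans (ler_norm _) (sub (fun i => 0 <= x i ord0 j)).
rewrite (eq_bigr (fun i : 'I_k => - x i ord0 j)).
  rewrite sumrN (le_trans (ler_norm _)) // normrN.
  exact: (sub (fun i => ~~ (0 <= x i ord0 j))).
by move=> i; rewrite -ltNge => /ltr0_norm.
Qed.

Section VectorComponent.
Variables (R : realType) (K : groupType) (d : K -> K -> R) (n : nat).
Variables (psi : 'rV[R]_n -> K) (kap : K -> 'rV[R]_n).

(** An open normal subgroup of [K] with a topological isomorphism [psi] from the
    additive group of row vectors; [kap] is its inverse, and the topology of [K]
    is given by [d]. *)
Record vector_component : Prop := VectorComponent {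
  vectorD : forall x y, psi (x + y) = (psi x * psi y)%g;
  vectorK : cancel psi kap;
  vector_conj : forall g x, exists y, (g * psi x * g^-1)%g = psi y;
  vector_small : forall e : R, 0 < e ->
    exists2 r : R, 0 < r & forall x, `|x| < r -> d (psi x) 1%g < e;
  coord_small : forall e : R, 0 < e ->
    exists2 r : R, 0 < r & forall g, d g 1%g < r -> psi (kap g) = g /\ `|kap g| < e }.

Hypothesis dP : biinvariant_metric d.
Hypothesis vP : vector_component.

Lemma vector0 : psi 0 = 1%g.
Proof.
by apply: (@mulgI _ (psi 0)); rewrite -(vectorD vP) addr0 mulg1.
Qed.

Lemma vectorN x : psi (- x) = (psi x)^-1%g.
Proof.
by apply: (@mulgI _ (psi x)); rewrite -(vectorD vP) subrr vector0 mulgV.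
Qed.

Lemma vectorB x y : psi (x - y) = (psi x * (psi y)^-1)%g.
Proof. by rewrite (vectorD vP) vectorN. Qed.

Lemma vectorC x y : (psi x * psi y)%g = (psi y * psi x)%g.
Proof. by rewrite -!(vectorD vP) addrC. Qed.

Definition conj_coord g x := kap (g * psi x * g^-1)%g.

Lemma conj_coordE g x : psi (conj_coord g x) = (g * psi x * g^-1)%g.
Proof. by rewrite /conj_coord; have [y ->] := vector_conj vP g x; rewrite (vectorK vP). Qed.

Lemma conj_coordD g : {morph conj_coord g : x y / x + y}.
Proof.
move=> x y; apply: (can_inj (vectorK vP)); rewrite (vectorD vP) !conj_coordE (vectorD vP).
by rewrite !mulgA mulgVK.
Qed.

Lemma conj_coord_small (e : R) : 0 < e ->
  exists2 r : R, 0 < r & forall g x, `|x| < r -> `|conj_coord g x| < e.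
Proof.
move=> e0; have [s s0 sP] := coord_small vP e0; have [r r0 rP] := vector_small vP s0.
by exists r => // g x /rP lts; apply: (sP _ _).2; rewrite (dist_conj1 dP).
Qed.

(** A Cauchy sequence eventually stays in one coset of the open subgroup, and the
    coordinates relative to that coset form a Cauchy sequence of vectors. *)
Lemma vector_component_complete u : cauchy_sequence d u ->
  exists l, forall e : R, 0 < e -> exists N, forall m, (N <= m)%N -> d (u m) l < e.
Proof.
move=> cu; have [r r0 rP] := coord_small vP ltr01; have [N uN] := cu _ r0.
pose y m := kap ((u N)^-1 * u m)%g.
have psiy m : (N <= m)%N -> psi (y m) = ((u N)^-1 * u m)%g.
  by move=> /uN uNm; have [] := rP ((u N)^-1 * u m)%g; rewrite // (dist_Vmul1 dP) (distC dP).
have cy : cvg (y @ \oo).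
  apply/cauchy_cvgP/cauchy_exP => e /= e0.
  have [s s0 sP] := coord_small vP e0.
  have [M uM] : exists M, forall m, (M <= m)%N -> d (u m) (u M) < s / 2.
    by apply: cu; rewrite divr_gt0.
  exists (y (maxn N M)); exists (maxn N M) => // m /=.
  rewrite geq_max -ball_normE /= => /andP[leN leM].
  rewrite -[y _ - _](vectorK vP) vectorB !psiy ?leq_maxl //.
  apply: (sP _ _).2; rewrite (dist_div1 dP) (dist_mull dP).
  apply: le_lt_trans (dist_triangle dP (u M) _ _) _.
  by rewrite [s]splitr ltrD ?uM ?leq_maxr // (distC dP) uM.
pose l := lim (y @ \oo); exists (u N * psi l)%g => e e0.
have [s s0 sP] := vector_small vP e0.
have /cvg_ballP/(_ _ s0) [M _ yM] : y @ \oo --> l by exact: cy.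
exists (maxn N M) => m; rewrite geq_max => /andP[leN leM].
have -> : u m = (u N * psi (y m))%g by rewrite psiy // mulVKg.
rewrite (dist_mull dP) -(dist_div1 dP) -vectorB; apply: sP.
by have := yM m leM; rewrite -ball_normE /= distrC.
Qed.
End VectorComponent.

(** * Loops *)

Lemma valid_segment_cat N s s' : valid_segment N s ->
  valid_segment (N + size s) s' -> valid_segment N (s ++ s').
Proof.
move=> vs vs' t; rewrite size_cat nth_cat => lt_t; case: ltnP => [|le_t]; first exact: vs.
have := vs' (t - size s)%N; rewrite ltn_subLR // => /(_ lt_t).
by rewrite -addnA subnKC.
Qed.

Section Loops.
Variables (R : realType) (K : groupType) (d : K -> K -> R).
Variables (T : nat -> nat -> K) (D : nat -> nat -> nat -> R).
Hypothesis dP : biinvariant_metric d.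
Hypothesis Dxx : forall i a, D i a a = 0.

(** Has the same second word as [s] and ratio [1]: replacing [s] by [diagonal s]
    switches a perturbation off without changing the context of the others. *)
Definition diagonal (s : seq (nat * nat)) := [seq (p.2, p.2) | p <- s].

Lemma unzip1_diagonal s : unzip1 (diagonal s) = unzip2 s.
Proof. by rewrite /unzip1 -map_comp. Qed.

Lemma unzip2_diagonal s : unzip2 (diagonal s) = unzip2 s.
Proof. by rewrite /unzip2 -map_comp. Qed.

Lemma segment_ratio_diagonal N s : segment_ratio T N (diagonal s) = 1%g.
Proof. by rewrite /segment_ratio unzip1_diagonal unzip2_diagonal mulgV. Qed.

Lemma valid_segment_diagonal N s : valid_segment N s -> valid_segment N (diagonal s).
Proof.
move=> vs t; rewrite size_map => lt_t; rewrite (nth_map (0, 0)%N) //=.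
by split; exact: (vs t lt_t).2.
Qed.

Lemma small_segment_diagonal N s e : 0 < e -> small_segment d T D N (diagonal s) e.
Proof.
move=> e0; split=> t; rewrite size_map => lt_t.
  by rewrite -map_take segment_ratio_diagonal (distxx dP).
by rewrite (nth_map (0, 0)%N) //= Dxx.
Qed.

Lemma small_segment_cat N s s' e : segment_ratio T N s = 1%g ->
  small_segment d T D N s e -> small_segment d T D (N + size s) s' e ->
  small_segment d T D N (s ++ s') e.
Proof.
move=> loop_s [rs Ds] [rs' Ds']; split=> t; rewrite size_cat => le_t.
  rewrite take_cat; case: ltnP => [lt_t|le_st]; first exact/rs/ltnW.
  rewrite segment_ratio_cat (divg1_eq loop_s) (dist_conj1 dP).
  by apply: rs'; rewrite leq_subLR.
rewrite nth_cat; case: ltnP => [lt_t|le_st]; first exact: Ds.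
have := Ds' (t - size s)%N; rewrite ltn_subLR // => /(_ le_t).
by rewrite -addnA subnKC.
Qed.

Lemma segment_ratio_loop_cat N s s' : segment_ratio T N s = 1%g ->
  segment_ratio T (N + size s) s' = 1%g -> segment_ratio T N (s ++ s') = 1%g.
Proof.
by move=> loop_s loop_s'; rewrite segment_ratio_cat loop_s' mulg1 (divg1_eq loop_s) mulgV.
Qed.

End Loops.

Section SmallLoops.
Variables (R : realType) (K1 K2 : groupType).
Variables (d1 : K1 -> K1 -> R) (d2 : K2 -> K2 -> R).
Variables (T1 : nat -> nat -> K1) (T2 : nat -> nat -> K2).
Variables (D1 D2 : nat -> nat -> nat -> R).
Hypotheses (d1P : biinvariant_metric d1) (d2P : biinvariant_metric d2).
Hypotheses (T10 : forall i, T1 i 0 = 1%g) (T20 : forall i, T2 i 0 = 1%g).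
Hypotheses (D1xx : forall i a, D1 i a a = 0) (D2xx : forall i a, D2 i a a = 0).
Variables (n : nat) (psi : 'rV[R]_n -> K2) (kap : K2 -> 'rV[R]_n).
Hypothesis vP : vector_component d2 psi kap.

(** Suppose that there are small loops arbitrarily far out whose images have
    distance at least [e] from [1]. Put end to end, with an arbitrary subset of
    them switched off, they still form a small loop, as each of them returns to
    [1]. The image of such a product lies in a fixed neighbourhood of [1] and is
    the sum of vectors [x k] over the subset, so that [bounded_subsums_small]
    makes some [x k] smaller than [e]. *)
Lemma small_loops :
  (forall del : R, 0 < del -> exists eta : R, 0 < eta /\ exists N0, forall N s, (N0 <= N)%N ->
    valid_segment N s -> small_segment d1 T1 D1 N s eta -> small_segment d2 T2 D2 N s del) ->
  exists eta : R, 0 < eta /\ forall e : R, 0 < e -> exists N0, forall N s, (N0 <= N)%N ->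
    valid_segment N s -> small_segment d1 T1 D1 N s eta -> segment_ratio T1 N s = 1%g ->
    d2 (segment_ratio T2 N s) 1%g < e.
Proof.
move=> unif; have [rho rho0 rhoP] := coord_small vP ltr01.
have [eta [eta0 [N1 etaP]]] := unif _ rho0.
exists eta; split => // e e0; apply: contrapT => bad.
have [c c0 cP] := vector_small vP e0.
have /choice[seg segP] : forall N, exists s, (N1 <= N)%N ->
    [/\ valid_segment N s, small_segment d1 T1 D1 N s eta, segment_ratio T1 N s = 1%g &
     e <= d2 (segment_ratio T2 N s) 1%g].
  move=> M; have [leM|ltM] := leqP N1 M; last by exists [::].
  apply: contrapT => no; apply: bad; exists M => N s leMN vs s1 loop.
  rewrite ltNge; apply/negP => le_e; apply: no; exists (padding (N - M) ++ s) => _.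
  rewrite !segment_ratio_padding ?subnKC //; split => //.
    by apply/valid_segment_padding; rewrite subnKC.
  by apply/(small_segment_padding d1P T10 D1xx) => //; rewrite subnKC.
pose P := fix P k := if k is k'.+1 then (P k' + size (seg (P k')))%N else N1.
have leP k : (N1 <= P k)%N by elim: k => //= k IH; rewrite (leq_trans IH) ?leq_addr.
pose cat A := fix cat k := if k is k'.+1 then
  cat k' ++ (if A k' then seg (P k') else diagonal (seg (P k'))) else [::].
have size_cat A k : P k = (N1 + size (cat A k))%N.
  elim: k => [|k IH] /=; first by rewrite addn0.
  by rewrite size_cat addnA -IH; case: ifP; rewrite ?size_map.
have catP A k : [/\ valid_segment N1 (cat A k), small_segment d1 T1 D1 N1 (cat A k) eta &
    segment_ratio T1 N1 (cat A k) = 1%g].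
  elim: k => [|k [IHv IHs IHr]] /=.
    split => //; last by rewrite segment_ratio_nil.
    by split=> // t; rewrite leqn0 => /eqP ->; rewrite segment_ratio_nil (distxx d1P).
  have [vs ss loop le_e] := segP (P k) (leP k); split.
  - apply: valid_segment_cat => //; rewrite -size_cat; case: ifP => // _.
    exact: valid_segment_diagonal.
  - apply: small_segment_cat => //; rewrite -size_cat; case: ifP => // _.
    exact: small_segment_diagonal.
  - apply: segment_ratio_loop_cat => //; rewrite -size_cat; case: ifP => // _.
    exact: segment_ratio_diagonal.
(* The [k]-th perturbation appears conjugated by the product [V k] of the second
   words before it, which does not depend on the subset [A]. *)
pose V k := segment_product T2 N1 (unzip2 (cat xpredT k)).
have VE A k : segment_product T2 N1 (unzip2 (cat A k)) = V k.
  congr segment_product; elim: k => //= k IH; rewrite /unzip2 !map_cat; congr (_ ++ _).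
    exact: IH.
  by case: ifP => // _; exact: unzip2_diagonal.
pose x k := kap (V k * segment_ratio T2 (P k) (seg (P k)) * (V k)^-1)%g.
have psix k : psi (x k) = (V k * segment_ratio T2 (P k) (seg (P k)) * (V k)^-1)%g.
  apply: (rhoP _ _).1; rewrite (dist_conj1 d2P).
  have [vs ss loop le_e] := segP (P k) (leP k).
  by have [/(_ _ (leqnn _))] := etaP _ _ (leP k) vs ss; rewrite take_size.
have ratioE A k : segment_ratio T2 N1 (cat A k) = psi (\sum_(i < k | A i) x i).
  elim: k => [|k IH] /=.
    by rewrite segment_ratio_nil big_ord0 (vector0 vP).
  rewrite big_mkcond big_ord_recr -big_mkcond /= (vectorD vP) -IH segment_ratio_cat VE -size_cat.
  rewrite [segment_ratio T2 N1 (cat A k)]/segment_ratio VE.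
  case: ifP => _; first by rewrite psix !mulgA mulgVK.
  by rewrite segment_ratio_diagonal (vector0 vP) !mulg1.
have [A k|i] := @bounded_subsums_small _ _ x c c0; last first.
  move=> /cP; rewrite psix (dist_conj1 d2P) ltNge.
  by have [_ _ _ ->] := segP (P i) (leP i).
have [vs ss _] := catP A k.
have [/(_ _ (leqnn _))] := etaP _ _ (leqnn _) vs ss.
by rewrite take_size ratioE => /rhoP[_]; rewrite (vectorK vP).
Qed.

End SmallLoops.

(** * Additive maps on dyadic groups *)

Lemma norm_mulmx_le (R : realType) n m (A : 'M[R]_(n, m)) :
  exists2 C, 0 < C & forall x : 'rV[R]_n, `|x *m A| <= C * `|x|.
Proof.
exists (1 + \sum_j \sum_i `|A i j|) => [|x].
  by rewrite ltr_wpDr // sumr_ge0 // => j _; rewrite sumr_ge0.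
apply: (@le_trans _ _ ((\sum_j \sum_i `|A i j|) * `|x|)); last first.
  by rewrite ler_wpM2r // lerDr.
rewrite (le_trans (norm_le_sum_coord _)) // mulr_suml ler_sum // => j _.
rewrite mxE (le_trans (ler_norm_sum _ _ _)) // mulr_suml ler_sum // => i _.
by rewrite normrM mulrC ler_wpM2l // coord_le_norm.
Qed.

Section DyadicLinear.
Variables (R : realType) (n m : nat).
Local Notation U := 'rV[R]_n.
Local Notation V := 'rV[R]_m.

Lemma half_exp_norm (x : U) (r : R) : 0 < r -> exists k, `|2^-1 ^+ k *: x| < r.
Proof.
move=> r0; have x1 : 0 < `|x| + 1 by rewrite ltr_wpDl.
have [k ltk] := @ltr_half_exp R (r / (`|x| + 1)) (divr_gt0 r0 x1).
exists k; rewrite normrZ ger0_norm ?exprn_ge0 ?invr_ge0 //.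
rewrite ltr_pdivlMr // in ltk; apply: le_lt_trans ltk.
by rewrite ler_wpM2l ?exprn_ge0 ?invr_ge0 // lerDl.
Qed.

Variables (S : set U) (r : R).
Hypothesis r0 : 0 < r.

(** Additivity extends a zero of [g] near the origin to all multiples, and
    continuity from the dense set [S] to all vectors. *)
Lemma additive_dense_eq0 (g : U -> V) :
  {morph g : x y / x + y} ->
  (forall e : R, 0 < e -> exists2 del : R, 0 < del & forall x, `|x| < del -> `|g x| < e) ->
  (forall x (e : R), 0 < e -> exists2 s, S s & `|x - s| < e) ->
  (forall x, S x -> `|x| < r -> g x = 0) -> forall x, g x = 0.
Proof.
move=> gD g_small dS gS x.
have g0 : g 0 = 0 by apply: (@addrI _ (g 0)); rewrite -gD !addr0.
have gX (y : U) k : g (y *+ k) = g y *+ k.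
  by elim: k => [|k IH]; rewrite ?mulr0n // !mulrS gD IH.
have [k ltk] := half_exp_norm x (divr_gt0 r0 (ltr0n _ 2)).
pose z := 2^-1 ^+ k *: x.
have -> : x = z *+ 2 ^ k.
  by rewrite -scaler_nat scalerA natrX exprVn mulfV ?scale1r // expf_neq0 // pnatr_eq0.
rewrite gX; suff -> : g z = 0 by rewrite mul0rn.
apply/eqP; rewrite -normr_eq0 eq_le normr_ge0 andbT; apply/ler_addgt0Pr => e e0.
rewrite add0r; have [del del0 gdel] := g_small e e0.
have [|s Ss] := dS z (Num.min del (r / 2)); first by rewrite lt_min del0 divr_gt0.
rewrite lt_min => /andP[lts1 lts2]; have gs : g s = 0.
  apply: gS => //; have -> : s = z - (z - s) by rewrite subKr.
  by rewrite (le_lt_trans (ler_normB _ _)) // [ltRHS]splitr ltrD.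
have -> : g z = g (z - s) by rewrite -[in LHS](subrK s z) gD gs addr0.
exact/ltW/gdel.
Qed.

Hypothesis S_add : forall x y, S x -> S y -> S (x + y).
Hypothesis S_opp : forall x, S x -> S (- x).
Hypothesis S_half : forall x, S x -> S (2^-1 *: x).
Hypothesis S_basis : forall j, S (delta_mx 0 j).
Variable F : U -> V.
Hypothesis F_add : forall x y, S x -> S y -> `|x| < r -> `|y| < r -> `|x + y| < r ->
  F (x + y) = F x + F y.
Hypothesis F_small : forall e : R, 0 < e ->
  exists2 del : R, 0 < del & forall x, S x -> `|x| < del -> `|F x| < e.

(** For large [k] the vector [2^k F(2^-k x)] does not depend on [k] and extends [F]
    to an additive map on [S]. It agrees with the linear map [A] given by its
    values on the standard basis at all dyadic combinations of basis vectors;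
    these are dense, and [F] and [A] are continuous at [0]. *)
Lemma local_additive_linear :
  exists A : 'M[R]_(n, m), forall x, S x -> `|x| < r -> F x = x *m A.
Proof.
have S_exp k x : S x -> S (2^-1 ^+ k *: x).
  by elim: k => [|k IH] Sx; rewrite ?expr0 ?scale1r // exprS -scalerA; apply/S_half/IH.
have half0 k : 0 < 2^-1 ^+ k :> R by rewrite exprn_gt0 // invr_gt0.
have halfD k : 2^-1 ^+ k.+1 + 2^-1 ^+ k.+1 = 2^-1 ^+ k :> R by rewrite exprS; lra.
have norm_half k x : `|2^-1 ^+ k *: x| = 2^-1 ^+ k * `|x| :> R.
  by rewrite normrZ ger0_norm // ltW.
have norm_halfS k x : `|2^-1 ^+ k *: x| < r -> `|2^-1 ^+ k.+1 *: x| < r.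
  apply: le_lt_trans; rewrite !norm_half ler_wpM2r // exprS ler_piMl ?ltW //.
  by rewrite invf_lt1 // ltr1n.
have norm_halfD k j x : `|2^-1 ^+ k *: x| < r -> `|2^-1 ^+ (k + j)%N *: x| < r.
  by move=> ltk; elim: j => [|j IH]; rewrite ?addn0 // addnS norm_halfS.
have F_half k j x : S x -> `|2^-1 ^+ k *: x| < r ->
    2 ^+ k *: F (2^-1 ^+ k *: x) = 2 ^+ (k + j)%N *: F (2^-1 ^+ (k + j)%N *: x).
  move=> Sx ltk; elim: j => [|j ->]; rewrite ?addn0 // addnS.
  have -> : 2^-1 ^+ (k + j)%N *: x = 2^-1 ^+ (k + j).+1 *: x + 2^-1 ^+ (k + j).+1 *: x.
    by rewrite -scalerDl halfD.
  rewrite F_add; try exact: S_exp; try exact/norm_halfS/norm_halfD.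
    by rewrite [2 ^+ _.+1]exprS [2 * _]mulrC -[RHS]scalerA scaler_nat mulr2n.
  by rewrite -scalerDl halfD norm_halfD.
have [k kP] := choice (fun x => half_exp_norm x r0).
pose Ft x := 2 ^+ k x *: F (2^-1 ^+ k x *: x).
have FtE j x : S x -> `|2^-1 ^+ j *: x| < r -> Ft x = 2 ^+ j *: F (2^-1 ^+ j *: x).
  by move=> Sx ltj; rewrite /Ft (F_half _ j) // (F_half j (k x)) // addnC.
have Ft_add x y : S x -> S y -> Ft (x + y) = Ft x + Ft y.
  move=> Sx Sy; pose j := (k x + k y + k (x + y)%R)%N.
  have [jx jy jxy] : [/\ `|2^-1 ^+ j *: x| < r, `|2^-1 ^+ j *: y| < r &
      `|2^-1 ^+ j *: (x + y)| < r].
    by split; rewrite /j; [rewrite -addnA|rewrite addnAC addnC|rewrite addnC]; exact: norm_halfD.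
  have F_addj : F (2^-1 ^+ j *: x + 2^-1 ^+ j *: y) =
      F (2^-1 ^+ j *: x) + F (2^-1 ^+ j *: y).
    by apply: F_add; rewrite -?scalerDr //; exact: S_exp.
  rewrite (FtE j x) // (FtE j y) // (FtE j (x + y)) //; last exact: S_add.
  by rewrite scalerDr F_addj scalerDr.
have Ft_F x : S x -> `|x| < r -> Ft x = F x.
  by move=> Sx ltx; rewrite (FtE 0%N) ?expr0 ?scale1r.
pose A : 'M[R]_(n, m) := \matrix_j Ft (delta_mx 0 j).
exists A => x Sx ltx; rewrite -Ft_F //.
pose g y := Ft y - y *m A.
have g_add y z : S y -> S z -> g (y + z) = g y + g z.
  by move=> Sy Sz; rewrite /g Ft_add // mulmxDl opprD addrACA.
have g_basis j : g (delta_mx 0 j) = 0 by rewrite /g -rowE rowK subrr.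
pose P y := S y /\ g y = 0.
have P0 : P 0.
  have S0 : S 0 by rewrite -(subrr x); apply/S_add/S_opp.
  by split => //; apply: (@addrI _ (g 0)); rewrite -g_add // !addr0.
have PD y z : P y -> P z -> P (y + z).
  by move=> [Sy gy] [Sz gz]; split; [exact: S_add|rewrite g_add // gy gz addr0].
have PN y : P y -> P (- y).
  move=> [Sy gy]; split; first exact: S_opp.
  by apply: (@addrI _ (g y)); rewrite -g_add // ?subrr ?P0.2 ?gy ?addr0 //; exact: S_opp.
have PZ y (z : int) : P y -> P (z%:~R *: y).
  move=> Py; rewrite scaler_int; case: z => z; rewrite ?NegzE ?mulrNz.
    by elim: z => [|z IH]; rewrite ?mulr0z // -pmulrn mulrS; apply: PD.
  by apply: PN; elim: z => [|z IH]; rewrite ?mulr1z // -pmulrn mulrS; apply: PD.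
have P_half i y : P y -> P (2^-1 ^+ i *: y).
  elim: i => [|i IH] Py; rewrite ?expr0 ?scale1r // exprS -scalerA.
  have [Sz gz] := IH Py; set z := _ *: y in Sz gz *; have Sw := S_half Sz; split => //.
  have zE : z = 2^-1 *: z + 2^-1 *: z.
    by rewrite -scalerDl -[LHS]scale1r; congr (_ *: _); lra.
  move: gz; rewrite {1}zE g_add // -mulr2n -scaler_nat => /eqP.
  by rewrite scaler_eq0 pnatr_eq0 => /eqP.
apply/eqP; rewrite -subr_eq0 -/(g x) -normr_eq0 eq_le normr_ge0 andbT.
apply/ler_addgt0Pr => e e0; rewrite add0r.
have [C C0 CP] := norm_mulmx_le A.
have [del del0 F_del] := F_small (divr_gt0 e0 (ltr0n _ 2)).
have eps0 : 0 < Num.min (Num.min del r) (e / 2 / C) by rewrite !lt_min del0 r0 !divr_gt0.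
have n1 : 0 < n%:R + 1 :> R by rewrite ltr_wpDl.
have [N ltN] := ltr_half_exp (divr_gt0 eps0 n1).
(* The dyadic combination obtained by cutting off the binary digits of the
   coordinates of [x] after the first [N]. *)
pose a : U := \sum_j (Num.floor (2 ^+ N * x 0 j))%:~R *: (2^-1 ^+ N *: delta_mx 0 j).
have [Sa ga] : P a.
  rewrite /a; elim/big_ind: _ => // j _; apply/PZ/P_half; split => //.
have Sxa : S (x - a) by apply/S_add/S_opp.
have ltxa : `|x - a| < Num.min (Num.min del r) (e / 2 / C).
  apply: le_lt_trans (_ : `|x - a| <= n%:R * 2^-1 ^+ N) _; last first.
    by rewrite ltr_pdivlMr // mulrC in ltN; apply: le_lt_trans ltN; rewrite ler_wpM2r ?lerDl // ltW.
  rewrite (le_trans (norm_le_sum_coord _)) // mulr_natl -[n in leRHS]card_ord -sumr_const.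
  apply: ler_sum => j _; rewrite /a !mxE summxE (bigD1 j) //= big1 => [|i neq_ij]; last first.
    by rewrite !mxE eqxx eq_sym (negPf neq_ij) !mulr0.
  rewrite !mxE !eqxx mulr1 addr0.
  have /andP[le_fl lt_fl] := floor_itv (2 ^+ N * x 0 j).
  have -> : x 0 j - (Num.floor (2 ^+ N * x 0 j))%:~R * 2^-1 ^+ N =
      (2 ^+ N * x 0 j - (Num.floor (2 ^+ N * x 0 j))%:~R) * 2^-1 ^+ N.
    by rewrite mulrBl mulrAC -exprMn mulfV ?expr1n ?mul1r.
  rewrite ger0_norm; last by rewrite mulr_ge0 ?subr_ge0 // ltW.
  by rewrite ler_piMl ?(ltW (half0 N)) // lerBlDl ltW //; rewrite intrD in lt_fl.
move: ltxa; rewrite !lt_min => /andP[/andP[lt_del lt_r] lt_C].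
have := g_add _ _ Sxa Sa; rewrite subrK ga addr0 => ->.
rewrite /g (le_trans (ler_normB _ _)) // [leRHS]splitr lerD //.
  by rewrite Ft_F //; apply/ltW/F_del.
by rewrite (le_trans (CP _)) // mulrC -ler_pdivlMr // ltW.
Qed.

End DyadicLinear.

(** * The matrix of a reduction between coded products *)

Section LetterLimits.
Variables (R : realType) (K1 K2 : groupType) (n : nat).
Variables (d1 : K1 -> K1 -> R) (d2 : K2 -> K2 -> R).
Hypotheses (d1P : biinvariant_metric d1) (d2P : biinvariant_metric d2).
Variables (psi2 : 'rV[R]_n -> K2) (kap2 : K2 -> 'rV[R]_n).
Hypothesis v2 : vector_component d2 psi2 kap2.
Variables (e : nat -> K1) (T : nat -> nat -> K2) (D : nat -> nat -> nat -> R).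
Hypotheses (e0 : e 0 = 1%g) (T0 : forall i, T i 0 = 1%g).
Hypothesis Dxx : forall i a, D i a a = 0.

Local Notation T1 := (fun=> e).
Local Notation D1 := (fun _ _ _ => 0 : R).

Hypothesis fwd : forall x, valid_pairs x ->
  coded_equivalent d1 T1 D1 x -> coded_equivalent d2 T D x.

(** [uniform_transfer] for segments of length one. *)
Lemma letter_transfer (del : R) : 0 < del -> exists eta : R, 0 < eta /\
  exists N, forall i a b, (N <= i)%N -> (a <= i)%N -> (b <= i)%N ->
  d1 (e a) (e b) < eta -> d2 (T i a) (T i b) < del /\ D i a b < del.
Proof.
move=> del0; have T10 (i : nat) : e 0 = 1%g by [].
have [eta [eta0 [N etaP]]] := uniform_transfer d1P d2P T10 T0 (fun _ _ => erefl) Dxx fwd del0.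
exists eta; split => //; exists N => i a b leNi leai lebi ltab.
have [] := etaP i [:: (a, b)] leNi.
- by case=> // _; rewrite addn0.
- split=> [[|[|//]] _|[|//] _] //=; first by rewrite segment_ratio_nil (distxx d1P).
  by rewrite /segment_ratio /= !mulg1 (dist_div1 d1P).
move=> /(_ 1%N isT) + /(_ 0%N isT); rewrite /segment_ratio /= !mulg1 addn0.
by rewrite (dist_div1 d2P).
Qed.

(** Its ratio compares letter [a] at the first position with letter [b] at a
    distant later one. *)
Definition transfer_segment (a b g : nat) : seq (nat * nat) :=
  (a, 0)%N :: padding g ++ [:: (0, b)%N].

Lemma segment_ratio_cons (K : groupType) (T' : nat -> nat -> K) N a b s :
  segment_ratio T' N ((a, b) :: s) = (T' N a * segment_ratio T' N.+1 s * (T' N b)^-1)%g.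
Proof. by rewrite /segment_ratio /= invgM !mulgA. Qed.

Lemma segment_ratio_transfer (K : groupType) (T' : nat -> nat -> K) N a b g :
  (forall i, T' i 0 = 1%g) -> segment_ratio T' N (transfer_segment a b g) =
    (T' N a * (T' (N + g).+1 b)^-1)%g.
Proof.
move=> T'0; rewrite segment_ratio_cons segment_ratio_padding // segment_ratio_cons.
by rewrite segment_ratio_nil !T'0 invg1 !mulg1 mul1g addSn.
Qed.

Lemma small_transfer eta N a b g : 0 < eta -> d1 (e a) 1%g < eta -> d1 (e a) (e b) < eta ->
  small_segment d1 T1 D1 N (transfer_segment a b g) eta.
Proof.
have T10 (i : nat) : e 0 = 1%g by [].
move=> eta0 lta ltab; split=> // -[_|t]; first by rewrite segment_ratio_nil (distxx d1P).
rewrite /transfer_segment /= size_cat size_nseq addn1 ltnS leq_eqVlt => /predU1P[->|lt_t].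
  rewrite take_oversize ?size_cat ?size_nseq ?addn1 //.
  by rewrite segment_ratio_transfer // (dist_div1 d1P).
rewrite take_cat size_nseq; case: ltnP => [lt_tg|le_gt].
  rewrite take_nseq ?(ltnW lt_tg) // segment_ratio_cons -[nseq _ _]cats0.
  by rewrite segment_ratio_padding // segment_ratio_nil e0 invg1 !mulg1.
have -> : (t - g = 0)%N by apply/eqP; rewrite subn_eq0.
rewrite take0 segment_ratio_cons.
by rewrite segment_ratio_padding // segment_ratio_nil e0 invg1 !mulg1.
Qed.

Lemma valid_transfer N a b g : (a <= N)%N -> (b <= N)%N ->
  valid_segment N (transfer_segment a b g).
Proof.
move=> leaN lebN [_|t]; first by rewrite addn0.
rewrite /= size_cat size_nseq addn1 ltnS => lt_t; rewrite nth_cat size_nseq.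
case: ltnP => [lt_tg|le_gt]; first by rewrite nth_nseq lt_tg.
have -> : (t - g = 0)%N by apply/eqP; rewrite subn_eq0.
by split => //=; rewrite (leq_trans lebN) // leq_addr.
Qed.

(** Each claim comes from a small loop, whose image is near [1] by [small_loops].
    The loop with [b] at an early position of the first word and at a late
    position of the second shows that [T i b] is Cauchy in [i]. The words [c] and
    [a b] with [c] the product of [a] and [b] give additivity, and the words
    [u b] and [b' u] with [b'] the conjugate of [b] by [u] give the last claim.
    As [u] need not be small, [T i u] itself need not converge. *)
Lemma letter_limits : exists (eta : R) (lim : nat -> K2), [/\ 0 < eta,
  forall b, d1 (e b) 1%g < eta -> forall r, 0 < r ->
    exists N, forall i, (N <= i)%N -> d2 (T i b) (lim b) < r,
  forall a b c, d1 (e a) 1%g < eta -> d1 (e b) 1%g < eta -> d1 (e c) 1%g < eta ->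
    e c = (e a * e b)%g -> lim c = (lim a * lim b)%g &
  forall u b b', d1 (e b) 1%g < eta -> d1 (e b') 1%g < eta ->
    e b' = (e u * e b * (e u)^-1)%g -> forall r, 0 < r ->
    exists N, forall i, (N <= i)%N -> d2 (T i u * lim b * (T i u)^-1)%g (lim b') < r].
Proof.
have T10 (i : nat) : e 0 = 1%g by [].
have [eta [eta0 loops]] := small_loops d1P d2P T10 T0 (fun _ _ => erefl) v2
  (uniform_transfer d1P d2P T10 T0 (fun _ _ => erefl) Dxx fwd).
have /choice[lim limP] : forall b, exists l, d1 (e b) 1%g < eta -> forall r, 0 < r ->
    exists N, forall i, (N <= i)%N -> d2 (T i b) l < r.
  move=> b; have [ltb|leb] := ltP (d1 (e b) 1%g) eta; last by exists 1%g.
  have [|l lP] := vector_component_complete d2P v2 (u := T^~ b); last by exists l.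
  move=> r r0; have [N NP] := loops r r0; exists (maxn N b) => i le_i.
  have := le_i; rewrite leq_eqVlt => /predU1P[<-|lt_i]; first by rewrite (distxx d2P).
  have -> : i = (maxn N b + (i - (maxn N b).+1)).+1 by rewrite -addSn subnKC.
  rewrite (distC d2P) -(dist_div1 d2P) -segment_ratio_transfer //.
  apply: NP; rewrite ?leq_maxl //.
  - by apply: valid_transfer; rewrite ?leq_maxr.
  - by apply: small_transfer; rewrite ?(distxx d1P).
  - by rewrite segment_ratio_transfer // mulgV.
have r40 (r : R) : 0 < r -> 0 < r / 4 by move=> r0; rewrite divr_gt0.
exists eta, lim; split => //.
- move=> a b c lta ltb ltc ecab.
  apply/(dist_eq0 d2P)/eqP; rewrite eq_le (dist_ge0 d2P) andbT.
  apply/ler_addgt0Pr => r r0; rewrite add0r.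
  have [[N1 aN] [N2 bN] [N3 cN]] :=
    And3 (limP a lta _ (r40 _ r0)) (limP b ltb _ (r40 _ r0)) (limP c ltc _ (r40 _ r0)).
  have [N4 NP] := loops _ (r40 _ r0).
  pose i := (N1 + N2 + N3 + N4 + a + b + c)%N.
  have : d2 (segment_ratio T i [:: (c, a); (0%N, b)]) 1%g < r / 4.
    apply: NP; first by rewrite /i; lia.
    - by case=> [|[|//]] _ /=; rewrite /i; split; lia.
    - split=> [[|[|[|//]]] _|[|[|//]] _] //=; rewrite ?segment_ratio_nil ?(distxx d1P) //.
        rewrite segment_ratio_cons segment_ratio_nil mulg1 ecab (dist_conj1 d1P) //.
      rewrite !segment_ratio_cons segment_ratio_nil e0 mul1g mul1g ecab mulgK.
      by rewrite mulgV (distxx d1P).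
    by rewrite !segment_ratio_cons segment_ratio_nil e0 !mul1g ecab mulgK mulgV.
  rewrite !segment_ratio_cons segment_ratio_nil T0 !mul1g -mulgA -invgM (dist_div1 d2P) => ltc'.
  have lt1 : d2 (T i a * T i.+1 b)%g (lim a * lim b)%g < r / 4 + r / 4.
    apply: le_lt_trans (dist_mul d2P _ _ _ _) _.
    by rewrite ltrD ?aN ?bN // /i; lia.
  have lt2 : d2 (lim c) (T i c) < r / 4 by rewrite (distC d2P) cN // /i; lia.
  have := dist_triangle d2P (T i c) (lim c) (lim a * lim b)%g.
  have := dist_triangle d2P (T i a * T i.+1 b)%g (T i c) (lim a * lim b)%g.
  by move: lt1 lt2 ltc'; lra.
- move=> u b b' ltb ltb' eub r r0.
  have [[N1 bN] [N2 b'N]] := (limP b ltb _ (r40 _ r0), limP b' ltb' _ (r40 _ r0)).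
  have [N4 NP] := loops _ (r40 _ r0).
  exists (N1 + N2 + N4 + u + b + b').+1 => -[//|i]; rewrite ltnS => lei.
  have : d2 (segment_ratio T i [:: (0%N, b'); (u, u); (b, 0%N)]) 1%g < r / 4.
    apply: NP; first by lia.
    - by case=> [|[|[|//]]] _ /=; split; lia.
    - split=> [[|[|[|[|//]]]] _|[|[|[|//]]] _] //=; rewrite ?segment_ratio_nil ?(distxx d1P) //.
      + rewrite segment_ratio_cons segment_ratio_nil e0 !mul1g.
        by rewrite -[X in d1 _ X]invg1 (dist_inv d1P).
      + rewrite !segment_ratio_cons segment_ratio_nil e0 mulg1 mulgV !mul1g.
        by rewrite -[X in d1 _ X]invg1 (dist_inv d1P).
      + rewrite !segment_ratio_cons segment_ratio_nil e0 invg1 !mulg1 !mul1g.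
        by rewrite eub mulgV (distxx d1P).
    by rewrite !segment_ratio_cons segment_ratio_nil e0 invg1 !mulg1 !mul1g eub mulgV.
  rewrite !segment_ratio_cons segment_ratio_nil !T0 invg1 !mulg1 !mul1g (dist_div1 d2P) => lt1.
  have lt2 : d2 (T i.+1 u * lim b * (T i.+1 u)^-1)%g (T i.+1 u * T i.+2 b * (T i.+1 u)^-1)%g < r / 4.
    by rewrite (dist_mulr d2P) (dist_mull d2P) (distC d2P) bN //; lia.
  have lt3 : d2 (T i b') (lim b') < r / 4 by rewrite b'N //; lia.
  have := dist_triangle d2P (T i.+1 u * T i.+2 b * (T i.+1 u)^-1)%g
    (T i.+1 u * lim b * (T i.+1 u)^-1)%g (lim b').
  have := dist_triangle d2P (T i b') (T i.+1 u * T i.+2 b * (T i.+1 u)^-1)%g (lim b').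
  by move: lt1 lt2 lt3; lra.
Qed.

End LetterLimits.

Lemma infinite_pigeonhole (X : Type) (f : nat -> X) (A : set X) :
  finite_set A -> (forall i, A (f i)) ->
  exists c, forall N, exists2 i, (N <= i)%N & f i = c.
Proof.
move=> finA fA; apply: contrapT => /forallNP no; apply: infinite_nat.
have -> : [set: nat] = \bigcup_(c in A) (f @^-1` [set c]).
  by apply/seteqP; split => // i _; exists (f i).
apply: bigcup_finite => // c _; have /existsNP[N NP] := no c.
apply: (sub_finite_set _ (finite_II N)) => i /= fic.
by rewrite ltnNge; apply/negP => leNi; apply: NP; exists i.
Qed.

Section LetterMatrix.
Variables (R : realType) (K1 K2 : groupType) (n : nat).
Variables (d1 : K1 -> K1 -> R) (d2 : K2 -> K2 -> R).
Hypotheses (d1P : biinvariant_metric d1) (d2P : biinvariant_metric d2).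
Variables (psi1 : 'rV[R]_n -> K1) (kap1 : K1 -> 'rV[R]_n).
Variables (psi2 : 'rV[R]_n -> K2) (kap2 : K2 -> 'rV[R]_n).
Hypotheses (v1 : vector_component d1 psi1 kap1) (v2 : vector_component d2 psi2 kap2).
Variables (e : nat -> K1) (T : nat -> nat -> K2) (D : nat -> nat -> nat -> R).
Hypotheses (e0 : e 0 = 1%g) (T0 : forall i, T i 0 = 1%g).
Hypothesis Dxx : forall i a, D i a a = 0.

Local Notation T1 := (fun=> e).
Local Notation D1 := (fun _ _ _ => 0 : R).

Hypothesis fwd : forall x, valid_pairs x ->
  coded_equivalent d1 T1 D1 x -> coded_equivalent d2 T D x.
Hypothesis bwd : forall x, valid_pairs x ->
  coded_equivalent d2 T D x -> coded_equivalent d1 T1 D1 x.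

Hypothesis e_mul : forall a b, exists c, e c = (e a * e b)%g.
Hypothesis e_inv : forall a, exists b, e b = (e a)^-1%g.
Hypothesis e_half : forall a x, e a = psi1 x -> exists b, e b = psi1 (2^-1 *: x).
Hypothesis e_basis : forall j, exists a, e a = psi1 (delta_mx 0 j).
Hypothesis e_dense : forall g (r : R), 0 < r -> exists a, d1 (e a) g < r.

(** The coded vectors: a dense subgroup closed under halving. *)
Let S : set 'rV[R]_n := [set x | exists a, e a = psi1 x].

Lemma coded_vectors_dense x (r : R) : 0 < r -> exists2 s, S s & `|x - s| < r.
Proof.
move=> r0; have [q q0 qP] := coord_small v1 r0; have [a ax] := e_dense (psi1 x) q0.
have [psiy lty] : psi1 (kap1 ((psi1 x)^-1 * e a)%g) = ((psi1 x)^-1 * e a)%g /\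
    `|kap1 ((psi1 x)^-1 * e a)%g| < r.
  by apply: qP; rewrite (dist_Vmul1 d1P) (distC d1P).
exists (x + kap1 ((psi1 x)^-1 * e a)%g); last by rewrite opprD addNKr normrN.
by exists a; rewrite (vectorD v1) psiy mulVKg.
Qed.

(** On short coded vectors the limits of [letter_limits] lie in the component of
    [K2], and in coordinates they form a map [F] to which
    [local_additive_linear] applies. *)
Lemma letter_matrix : exists (A : 'M[R]_n) (r : R), [/\ 0 < r,
  forall b x, e b = psi1 x -> `|x| < r -> forall q : R, 0 < q ->
    exists N, forall i, (N <= i)%N -> d2 (T i b) (psi2 (x *m A)) < q &
  forall u b x y, e b = psi1 x -> `|x| < r -> `|y| < r ->
    psi1 y = (e u * psi1 x * (e u)^-1)%g -> forall q : R, 0 < q ->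
    exists N, forall i, (N <= i)%N ->
      d2 (T i u * psi2 (x *m A) * (T i u)^-1)%g (psi2 (y *m A)) < q].
Proof.
have [eta [lim [eta0 limP limM limJ]]] := letter_limits d1P d2P v2 e0 T0 Dxx fwd.
have e01 : d1 (e 0) 1%g < eta by rewrite e0 (distxx d1P).
have lim0 : lim 0%N = 1%g.
  apply: (@mulgI _ (lim 0%N)); rewrite mulg1.
  by apply/esym/limM; rewrite ?e0 ?mulg1 // (distxx d1P).
have lim_eq b b' : d1 (e b) 1%g < eta -> e b = e b' -> lim b = lim b'.
  by move=> ltb ebb'; rewrite (limM b' 0%N b) ?lim0 ?mulg1 -?ebb' ?e0 ?mulg1 // (distxx d1P).
have lim_small (q : R) : 0 < q -> exists2 r : R, 0 < r & forall b, d1 (e b) 1%g < eta ->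
    d1 (e b) 1%g < r -> d2 (lim b) 1%g < q.
  move=> q0; have q20 : 0 < q / 2 by rewrite divr_gt0.
  have [r [r0 [N rP]]] := letter_transfer d1P d2P e0 T0 Dxx fwd q20.
  exists r => // b ltb ltr; have [M MP] := limP b ltb _ q20.
  apply: le_lt_trans (dist_triangle d2P (T (N + M + b) b) _ _) _.
  rewrite [q]splitr ltrD //; first by rewrite (distC d2P) MP //; lia.
  by rewrite -(T0 (N + M + b)%N); apply: (rP _ b 0%N _ _ _ _).1; rewrite ?e0 //; lia.
have [rho rho0 rhoP] := coord_small v2 ltr01.
have [eta2 eta20 eta2P] := lim_small _ rho0.
have [r r0 rP] : exists2 r : R, 0 < r & forall x, `|x| < r ->
    d1 (psi1 x) 1%g < eta /\ d1 (psi1 x) 1%g < eta2.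
  have [|r r0 rP] := vector_small v1 (e := Num.min eta eta2); first by rewrite lt_min eta0.
  by exists r => // x /rP; rewrite lt_min => /andP[].
have /choice[letter letterP] : forall x, exists a, S x -> e a = psi1 x.
  by move=> x; have [[a ax]|nx] := pselect (S x); [exists a|exists 0%N].
pose F x := kap2 (lim (letter x)).
have FP x b : e b = psi1 x -> `|x| < r -> lim b = psi2 (F x).
  move=> bx /rP[lt1 lt2]; have Sx : S x by exists b.
  rewrite (lim_eq b (letter x)) ?bx ?letterP //; apply/esym/(rhoP _ _).1.
  by apply: eta2P; rewrite letterP.
have S_add x y : S x -> S y -> S (x + y).
  by move=> [a ax] [b bx]; have [c cP] := e_mul a b; exists c; rewrite cP ax bx (vectorD v1).
have S_opp x : S x -> S (- x).
  by move=> [a ax]; have [b bP] := e_inv a; exists b; rewrite bP ax (vectorN v1).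
have S_half x : S x -> S (2^-1 *: x) by move=> [a /e_half].
have [|q q0|A AP] := local_additive_linear r0 S_add S_opp S_half e_basis (F := F).
- move=> x y Sx Sy ltx lty ltxy; have Sxy := S_add _ _ Sx Sy.
  rewrite -[RHS](vectorK v2) (vectorD v2) -(FP x (letter x)) ?letterP //.
  rewrite -(FP y (letter y)) ?letterP // -(limM _ _ (letter (x + y))) ?letterP ?(rP _ _).1 //.
  exact: (vectorD v1).
- have [s s0 sP] := coord_small v2 q0; have [t t0 tP] := lim_small _ s0.
  have [|del del0 delP] := vector_small v1 (e := Num.min eta t); first by rewrite lt_min eta0.
  exists del => // x Sx /delP; rewrite lt_min => /andP[lt1 lt2].
  by apply: (sP _ _).2; apply: tP; rewrite letterP.
exists A, r; split => // [b x bx ltx q q0|u b x y bx ltx lty yx q q0].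
  rewrite -AP //; last by exists b.
  by rewrite -(FP x b bx ltx); apply: limP; rewrite // bx (rP _ ltx).1.
have Sx : S x by exists b.
have [b' b'y] : S y.
  have [c cP] := e_mul u b; have [v vP] := e_inv u; have [w wP] := e_mul c v.
  by exists w; rewrite wP cP vP yx bx.
rewrite -!AP // -?(FP x b bx ltx) -?(FP y b' b'y lty); last by exists b'.
by apply: limJ; rewrite ?bx ?b'y ?(rP _ _).1.
Qed.

Lemma segment_product_repeat (y : 'rV[R]_n) b (q : R) N : 0 <= q ->
  (forall i, (N <= i)%N -> d2 (T i b) (psi2 y) <= q) ->
  forall t, d2 (segment_product T N (nseq t b)) (psi2 (y *+ t)) <= q *+ t.
Proof.
move=> q0 + t; elim: t N => [|t IH] N Tq.
  by rewrite !mulr0n (vector0 v2) (distxx d2P).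
rewrite /= !mulrS (vectorD v2); apply: le_trans (dist_mul d2P _ _ _ _) _.
by rewrite lerD ?Tq // IH // => i leNi; rewrite Tq // ltnW.
Qed.

(** A vector with a small image is small: adding up many copies of one of its
    dyadic fractions gives a segment whose codes all stay small, so that its
    letters multiply to something small. *)
Lemma letter_matrix_lower_bound (A : 'M[R]_n) (r : R) : 0 < r ->
  (forall b x, e b = psi1 x -> `|x| < r -> forall q : R, 0 < q ->
    exists N, forall i, (N <= i)%N -> d2 (T i b) (psi2 (x *m A)) < q) ->
  forall del : R, 0 < del -> exists2 q : R, 0 < q &
  forall s, S s -> `|s| < r -> `|s *m A| < q -> d1 (psi1 s) 1%g < del.
Proof.
move=> r0 AP del del0; have T10 (i : nat) : e 0 = 1%g by [].
have [eta [eta0 [N etaP]]] :=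
  uniform_transfer d2P d1P T0 T10 Dxx (fun _ _ => erefl) bwd del0.
have eta20 : 0 < eta / 2 by rewrite divr_gt0.
have [q q0 qP] := vector_small v2 eta20.
have [eta' [eta'0 [N' eta'P]]] := letter_transfer d1P d2P e0 T0 Dxx fwd eta0.
exists q => // s [a sa] lts ltsA.
have [r' r'0 r'P] := vector_small v1 eta'0.
have [k ltk] := half_exp_norm s r'0.
have [b bk] : exists b, e b = psi1 (2^-1 ^+ k *: s).
  elim: k {ltk} => [|k [b /e_half]]; first by exists a; rewrite expr0 scale1r.
  by rewrite scalerA -exprS.
have half_ge0 : 0 <= 2^-1 ^+ k :> R by rewrite exprn_ge0 ?invr_ge0.
have half_le1 : 2^-1 ^+ k <= 1 :> R by rewrite exprn_ile1 ?invr_ge0 ?invf_le1 ?ler1n.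
have norm_half m (x : 'rV[R]_m) : `|2^-1 ^+ k *: x| <= `|x|.
  by rewrite normrZ ger0_norm // ler_piMl.
(* The segment repeats, [2^k] times, a letter coding [2^-k s], against the identity.
   The dyadic fraction is short enough for the drift of a single letter to stay
   below [eta]; the errors of the [2^k] factors add up to at most [eta / 2]. *)
pose y := 2^-1 ^+ k *: s *m A.
have [M MP] : exists M, forall i, (M <= i)%N -> d2 (T i b) (psi2 y) < eta / 2 / (2 ^ k)%:R.
  by apply: AP; rewrite ?divr_gt0 ?ltr0n ?expn_gt0 // (le_lt_trans (norm_half _ _)).
pose seg := nseq (2 ^ k) (b, 0%N); pose P := (N + N' + M + b)%N.
have [leN leN' leM leb] : [/\ (N <= P)%N, (N' <= P)%N, (M <= P)%N & (b <= P)%N].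
  by rewrite /P; clear; split; lia.
have two_k (x : 'rV[R]_n) : (2^-1 ^+ k *: x) *+ 2 ^ k = x.
  by rewrite -scaler_nat scalerA natrX exprVn mulfV ?scale1r // expf_neq0 // pnatr_eq0.
have ratio_seg (K : groupType) (T' : nat -> nat -> K) t : (forall i, T' i 0 = 1%g) ->
    segment_ratio T' P (nseq t (b, 0%N)) = segment_product T' P (nseq t b).
  move=> T'0; rewrite /segment_ratio /unzip1 /unzip2 !map_nseq.
  by rewrite segment_product_padding // invg1 mulg1.
have small : small_segment d2 T D P seg eta.
  split=> t; rewrite size_nseq => le_t; last first.
    rewrite nth_nseq le_t /=; apply: (eta'P _ _ _ _ _ _ _).2 => //.
    - exact: leq_trans leN' (leq_addr _ _).
    - exact: leq_trans leb (leq_addr _ _).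
    - by rewrite bk e0 r'P.
  rewrite take_nseq // ratio_seg //.
  apply: le_lt_trans (dist_triangle d2P (psi2 (y *+ t)) _ _) _.
  rewrite [eta]splitr ler_ltD //.
    apply: le_trans (segment_product_repeat (q := eta / 2 / (2 ^ k)%:R) _ _ _) _.
    - by rewrite divr_ge0 ?ltW.
    - by move=> i /(leq_trans leM) lei; exact/ltW/MP.
    rewrite -[leLHS]mulr_natr (mulrAC (eta / 2)) ler_pdivrMr ?ltr0n ?expn_gt0 //.
    by rewrite ler_wpM2l ?(ltW eta20) // ler_nat.
  apply: qP; apply: le_lt_trans ltsA.
  have -> : s *m A = y *+ 2 ^ k.
    by rewrite -{1}(two_k s) -scaler_nat -scalemxAl -/y scaler_nat.
  by rewrite !normrMn; apply: ler_wpMn2l.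
have vseg : valid_segment P seg.
  move=> t; rewrite size_nseq nth_nseq => -> /=; split => //.
  exact: leq_trans leb (leq_addr _ _).
have [/(_ _ (leqnn _)) + _] := etaP P seg leN vseg small; rewrite take_size.
have prodE t P' : segment_product T1 P' (nseq t b) = psi1 ((2^-1 ^+ k *: s) *+ t).
  elim: t P' => [|t IH] P' /=; first by rewrite mulr0n (vector0 v1).
  by rewrite IH [_ *+ t.+1]mulrS (vectorD v1) bk.
by rewrite /seg ratio_seg // prodE two_k.
Qed.

(** A vector in the kernel of [A] may be scaled to have norm [r / 2]; a coded vector
    close to it then has a small image but is not small, against
    [letter_matrix_lower_bound]. *)
Lemma letter_matrix_unit (A : 'M[R]_n) (r : R) : 0 < r ->
  (forall b x, e b = psi1 x -> `|x| < r -> forall q : R, 0 < q ->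
    exists N, forall i, (N <= i)%N -> d2 (T i b) (psi2 (x *m A)) < q) ->
  A \in unitmx.
Proof.
move=> r0 AP; rewrite -row_free_unit; apply: inj_row_free => x xA.
apply: contrapT => /eqP x0; have nx0 : 0 < `|x| by rewrite normr_gt0.
have r20 : 0 < r / 2 by rewrite divr_gt0.
have r40 : 0 < r / 2 / 2 by rewrite divr_gt0.
pose z := (r / 2 / `|x|) *: x.
have nz : `|z| = r / 2.
  by rewrite normrZ gtr0_norm ?divr_gt0 // divfK // gt_eqF.
have zA : z *m A = 0 by rewrite -scalemxAl xA scaler0.
have [del del0 delP] := coord_small v1 r40.
have [q q0 qP] := letter_matrix_lower_bound r0 AP del0.
have [C C0 CP] := norm_mulmx_le A.
have [|s Ss] := coded_vectors_dense z (r := Num.min (r / 2 / 2) (q / C)).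
  by rewrite lt_min r40 divr_gt0.
rewrite lt_min distrC => /andP[lts1 lts2].
have lts : `|s| < r.
  rewrite -[s](subrK z) (le_lt_trans (ler_normD _ _)) // nz; move: lts1; lra.
have ltsA : `|s *m A| < q.
  rewrite -[s](subrK z) mulmxDl zA addr0 (le_lt_trans (CP _)) //.
  by rewrite mulrC -ltr_pdivlMr.
have [_] := delP _ (qP s Ss lts ltsA); rewrite (vectorK v1).
have := ler_normB z s; have := ler_normD s (z - s); rewrite subrKC nz.
rewrite distrC in lts1; move: lts1; lra.
Qed.

(** The conjugations of the component by [T i u] take finitely many values, so one
    of them occurs infinitely often and is then the limit. *)
Lemma letter_matrix_conj (A : 'M[R]_n) (r : R) : 0 < r ->
  (forall u b x y, e b = psi1 x -> `|x| < r -> `|y| < r ->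
    psi1 y = (e u * psi1 x * (e u)^-1)%g -> forall q : R, 0 < q ->
    exists N, forall i, (N <= i)%N ->
      d2 (T i u * psi2 (x *m A) * (T i u)^-1)%g (psi2 (y *m A)) < q) ->
  finite_set (range (fun (h : K2) x => (h * psi2 x * h^-1)%g)) ->
  forall u, exists h, forall x y, psi1 y = (u * psi1 x * u^-1)%g ->
    (h * psi2 (x *m A) * h^-1)%g = psi2 (y *m A).
Proof.
move=> r0 AP finJ u.
have [s s0 sP] := coord_small v1 ltr01; have [a au] := e_dense u s0.
(* The component is commutative, so [u] acts on it as a letter in its coset. *)
have [w uE] : exists w, u = (e a * psi1 w)%g.
  by exists (kap1 ((e a)^-1 * u)%g); rewrite (sP _ _).1 ?mulVKg // (dist_Vmul1 d1P).
have uJ x : (u * psi1 x * u^-1)%g = (e a * psi1 x * (e a)^-1)%g.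
  by rewrite uE invgM !mulgA -(mulgA (e a)) (vectorC v1 w) mulgA mulgK.
have [|c cP] := infinite_pigeonhole
  (f := fun i x => (T i a * psi2 x * (T i a)^-1)%g) finJ; first by move=> i; exists (T i a).
have [i0 _ hE] := cP 0%N; pose h := T i0 a.
exists h; pose g x := conj_coord psi2 kap2 h (x *m A) - conj_coord psi1 kap1 u x *m A.
suff g0 : forall x, g x = 0.
  move=> x y yx; rewrite -(conj_coordE v2); congr psi2; apply/eqP.
  by have /eqP := g0 x; rewrite /g subr_eq0 /conj_coord -yx (vectorK v1).
have [r' r'0 r'P] := conj_coord_small d1P v1 r0.
apply: (@additive_dense_eq0 _ _ _ S (Num.min r r')).
- by rewrite lt_min r0.
- move=> x y; rewrite /g mulmxDl (conj_coordD v2) (conj_coordD v1) mulmxDl opprD.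
  exact: addrACA.
- move=> q q0; have q20 : 0 < q / 2 by rewrite divr_gt0.
  have [C C0 CP] := norm_mulmx_le A; have qC0 : 0 < q / 2 / C by rewrite divr_gt0.
  have [t t0 tP] := conj_coord_small d2P v2 q20.
  have [t' t'0 t'P] := conj_coord_small d1P v1 qC0.
  exists (Num.min (t / C) t') => [|x]; first by rewrite lt_min divr_gt0.
  rewrite lt_min => /andP[ltx /(t'P u) ltx'].
  rewrite (le_lt_trans (ler_normB _ _)) // [q]splitr ltrD //.
    by apply: tP; rewrite (le_lt_trans (CP _)) // mulrC -ltr_pdivlMr.
  by rewrite (le_lt_trans (CP _)) // mulrC -ltr_pdivlMr.
- exact: coded_vectors_dense.
move=> x [b bx]; rewrite lt_min => /andP[ltx /(r'P u) lty].
apply/eqP; rewrite subr_eq0; apply/eqP/(can_inj (vectorK v2)).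
apply/(dist_eq0 d2P)/eqP; rewrite eq_le (dist_ge0 d2P) andbT.
apply/ler_addgt0Pr => q q0; rewrite add0r.
have yx : psi1 (conj_coord psi1 kap1 u x) = (e a * psi1 x * (e a)^-1)%g.
  by rewrite (conj_coordE v1).
have [N NP] := AP a b x _ bx ltx lty yx q q0; have [i leNi ci] := cP N.
have := NP i leNi; rewrite (conj_coordE v2).
by rewrite -[X in d2 X _]/((fun x => T i a * psi2 x * (T i a)^-1)%g (x *m A)) ci -hE => /ltW.
Qed.

End LetterMatrix.

(** * Fusion *)

Section Approximable.
Variables (R : realType) (K : groupType) (d : K -> K -> R).
Hypothesis dP : biinvariant_metric d.

(** For a map to a separable metric space this amounts to the Baire property of the
    preimages of the open sets. *)
Definition approximable (f : (nat -> nat) -> K) := forall s (q : R), 0 < q ->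
  exists t h, forces (s ++ t) (fun y => d (f y) h < q).

Lemma approximable_div f g : approximable f -> approximable g ->
  approximable (fun y => f y * (g y)^-1)%g.
Proof.
move=> fP gP s q q0; have q20 : 0 < q / 2 by rewrite divr_gt0.
have [t [h th]] := fP s _ q20; have [t' [h' th']] := gP (s ++ t) _ q20.
exists (t ++ t'), (h * h'^-1)%g; rewrite catA.
apply: forces_mono (forces_and (forces_cat t' th) th') => y _ [lt1 lt2].
apply: le_lt_trans (dist_mul dP _ _ _ _) _.
by rewrite (dist_inv dP) [q]splitr ltrD.
Qed.

Lemma approximable_overwrite r f : approximable f -> approximable (f \o overwrite r).
Proof.
move=> fP s q q0; pose s' := s ++ nseq (size r) 0%N.
have le_r : (size r <= size s')%N by rewrite size_cat size_nseq leq_addl.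
have [t [h th]] := fP (r ++ drop (size r) s') q q0.
exists (nseq (size r) 0%N ++ t), h; rewrite catA -/s' -[s'](cat_take_drop (size r)) -catA.
rewrite -catA in th.
have eq_size : size r = size (take (size r) s') by rewrite size_takel.
exact: (forces_overwrite eq_size th).
Qed.

Definition stable_from (c : (nat -> nat) -> nat -> K) M (q : R) y :=
  forall m m', (M <= m)%N -> (M <= m')%N -> d (c y m) (c y m') <= q.

(** Otherwise, for every [M], densely many strings below [s] force an oscillation
    of more than [q / 2] past [M], since the values [c y m] and [c y m'] are known
    up to [q / 8] after extending a string. A branch that meets all these
    conditions has a sequence [c y] that is not Cauchy. *)
Lemma forces_stable (c : (nat -> nat) -> nat -> K) :
  (forall m, approximable (c^~ m)) -> (forall y, cauchy_sequence d (c y)) ->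
  forall (q : R), 0 < q -> forall s, exists t M, forces (s ++ t) (stable_from c M q).
Proof.
move=> cP cC q q0 s; apply: contrapT => no.
have q40 : 0 < q / 4 by rewrite divr_gt0.
have q80 : 0 < q / 8 by rewrite divr_gt0.
have unstable M : forces s (fun y => exists m m', [/\ (M <= m)%N, (M <= m')%N &
    q / 2 < d (c y m) (c y m')]).
  apply: forces_densely => t; apply: contrapT => not_forced; apply: no; exists t, M.
  apply: (@forces_mono _ (fun y => forall mm : nat * nat, (M <= mm.1)%N -> (M <= mm.2)%N ->
      d (c y mm.1) (c y mm.2) <= q)) => [y _ stab m m' leM leM'|].
    exact: (stab (m, m')).
  apply: forces_all => -[m m'] /=; apply: forces_densely => u.
  have [v [h vh]] := cP m (s ++ t ++ u) _ q80.
  have [v' [h' vh']] := cP m' ((s ++ t ++ u) ++ v) _ q80.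
  have := forces_and (forces_cat v' vh) vh'; rewrite -!catA => hh'.
  exists (v ++ v'); rewrite -!catA; apply: forces_mono hh' => y sy [lt1 lt2] leM leM'.
  rewrite leNgt; apply/negP => gtq; apply: not_forced.
  exists (u ++ v ++ v'); have := forces_and (forces_cat v' vh) vh'; rewrite -!catA.
  apply: forces_mono => y' _ [lt1' lt2']; exists m, m'; split => //.
  have := dist_triangle dP h (c y m) (c y m'); have := dist_triangle dP h' h (c y m').
  have := dist_triangle dP (c y' m) h h'; have := dist_triangle dP (c y' m') (c y' m) h'.
  rewrite ![d h (c _ _)](distC dP) ![d h' (c _ _)](distC dP).
  move: gtq lt1 lt2 lt1' lt2'; lra.
have [y _ yP] := forces_ex (forces_all unstable).
have [N NP] := cC y _ q40; have [m [m' [leN leN' gtq]]] := yP N.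
have := dist_triangle dP (c y N) (c y m) (c y m').
have := NP _ leN; have := NP _ leN'; rewrite [d (c y N) _](distC dP).
move: gtq; lra.
Qed.

End Approximable.

Section OpenDense.

(** Closure under extension makes it possible to meet such a set for several initial
    segments simultaneously, see [open_dense_strings]. *)
Definition open_dense (Q : set (seq nat)) :=
  dense_strings Q /\ forall u v, Q u -> Q (u ++ v).

Lemma open_dense_all k (Q : nat -> set (seq nat)) :
  (forall j, open_dense (Q j)) -> open_dense [set u | forall j, (j < k)%N -> Q j u].
Proof.
move=> QP; split=> [s|u v Qu j ltj]; last by apply: (QP j).2; exact: Qu.
elim: k => [|k [t IH]]; first by exists [::].
have [t' Qt'] := (QP k).1 (s ++ t); exists (t ++ t'); rewrite catA => j.
by rewrite ltnS leq_eqVlt => /predU1P[-> //|ltj]; apply: (QP j).2; exact: IH.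
Qed.

Lemma open_dense_strings (Q : set (seq nat)) (ss : seq (seq nat)) : open_dense Q ->
  forall t, exists t', forall s, s \in ss -> Q (s ++ t ++ t').
Proof.
move=> [dQ upQ] t; elim: ss => [|s ss [t' IH]]; first by exists [::].
have [t'' Qt''] := dQ (s ++ t ++ t'); exists (t' ++ t'') => s'.
rewrite inE => /predU1P[->|/IH Qs']; first by rewrite !catA in Qt'' *.
by rewrite !catA in Qs' *; exact: upQ.
Qed.

Lemma exists_uniform_bound (X : eqType) (ss : seq X) (P : X -> nat -> Prop) :
  (forall x m m', (m <= m')%N -> P x m -> P x m') ->
  (forall x, x \in ss -> exists m, P x m) -> exists m, forall x, x \in ss -> P x m.
Proof.
move=> Pm; elim: ss => [|x ss IH] ex; first by exists 0%N.
have [m mP] : exists m, forall x, x \in ss -> P x m.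
  by apply: IH => y yss; apply: ex; rewrite inE yss orbT.
have [m' xm'] := ex x (mem_head _ _); exists (maxn m m') => y.
rewrite inE => /predU1P[->|yss]; first exact: Pm (leq_maxr _ _) xm'.
exact: Pm (leq_maxl _ _) (mP y yss).
Qed.

End OpenDense.

Section Fusion.
Variables (R : realType) (K1 K2 : groupType) (d2 : K2 -> K2 -> R).
Hypothesis d2P : biinvariant_metric d2.
Variables (e : nat -> K1) (z : (nat -> nat) -> nat -> K2).
Hypothesis e_word_inv : forall s, exists a, (segment_product (fun=> e) 0 s * e a)%g = 1%g.
Hypothesis z_approx : forall m, approximable d2 (z^~ m).
Hypothesis z_cauchy : forall r y,
  cauchy_sequence d2 (fun m => z y m * (z (overwrite r y) m)^-1)%g.

Definition overwrite_ratio r y m := (z y m * (z (overwrite r y) m)^-1)%g.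

Let eps i : R := 2^-1 ^+ i.
Let eps_gt0 i : 0 < eps i. Proof. by rewrite exprn_gt0 ?invr_gt0. Qed.

(** Countably many of the forced statements are collected once and for all: a
    branch that hits all sets [Ds k] satisfies each of them. *)
Lemma generic_branches : exists (Ds : nat -> set (seq nat)) (h : seq nat -> nat -> nat -> K2),
  (forall k, dense_strings (Ds k)) /\ forall y, (forall k, hits y (Ds k)) ->
  (forall t r M i, forces t (stable_from d2 (overwrite_ratio r) M (eps i)) ->
     extends_string t y -> stable_from d2 (overwrite_ratio r) M (eps i) y) /\
  (forall t m i, (exists g, forces t (fun y => d2 (z y m) g < eps i)) ->
     extends_string t y -> d2 (z y m) (h t m i) < eps i).
Proof.
have /choice[h hP] : forall tmi : seq nat * nat * nat, exists g,
    (exists g, forces tmi.1.1 (fun y => d2 (z y tmi.1.2) g < eps tmi.2)) ->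
    forces tmi.1.1 (fun y => d2 (z y tmi.1.2) g < eps tmi.2).
  move=> tmi; have [[g gP]|no] := pselect (exists g,
    forces tmi.1.1 (fun y => d2 (z y tmi.1.2) g < eps tmi.2)); first by exists g.
  by exists 1%g => /no.
have relative t (P : (nat -> nat) -> Prop) (Q : Prop) : (Q -> forces t P) ->
    forces [::] (fun y => Q -> extends_string t y -> P y).
  move=> QP; have [q|nq] := pselect Q.
    have [Ds [dDs DsP]] := QP q; exists Ds; split=> // y _ my _ ty; exact: DsP.
  by exists (fun=> setT); split=> // _ s; exists [::].
have := forces_and
  (forces_all (fun j : seq nat * seq nat * nat * nat => relative j.1.1.1
    (stable_from d2 (overwrite_ratio j.1.1.2) j.1.2 (eps j.2)) _ id))
  (forces_all (fun j : seq nat * nat * nat => relative j.1.1 _ _ (hP j))).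
move=> [Ds [dDs DsP]]; exists Ds, (fun t m i => h (t, m, i)); split=> // y my.
have [stab appr] := DsP y (erefl : extends_string [::] y) my.
by split=> [t r M i|t m i]; [exact: (stab (t, r, M, i))|exact: (appr (t, m, i))].
Qed.

(** One word [s] serves all the finitely many initial segments [r] in [rs]. It meets
    the first dense sets, then fixes, up to [2^-i] and past some [M], the
    ratio of the values for any two initial segments, and then fixes the values up
    to index [M]; a last letter makes its product [1]. *)
Lemma fusion_step (Ds : nat -> set (seq nat)) : (forall k, dense_strings (Ds k)) ->
  forall i (rs : seq (seq nat)) M0, exists s M, [/\ (M0 < M)%N,
    segment_product (fun=> e) 0 s = 1%g &
    forall r, r \in rs ->
    [/\ forall j, (j <= i)%N -> exists2 n, (n <= size (r ++ s))%N & Ds j (take n (r ++ s)),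
     forall r', r' \in rs ->
       forces (r ++ s) (stable_from d2 (overwrite_ratio r') M (eps i)) &
     forall m, (m <= M)%N -> exists g, forces (r ++ s) (fun y => d2 (z y m) g < eps i)]].
Proof.
move=> dDs i rs M0.
have meet_open j : open_dense [set u | exists2 n, (n <= size u)%N & Ds j (take n u)].
  split=> [s|u v [n le_n Dn]].
    by have [t Dt] := dDs j s; exists t; exists (size (s ++ t)); rewrite ?take_size.
  by exists n; rewrite ?size_cat ?(leq_trans le_n) ?leq_addr // takel_cat.
have stable_open r' : open_dense [set u | exists M,
    forces u (stable_from d2 (overwrite_ratio r') M (eps i))].
  split=> [s|u v [M uM]]; last by exists M; exact: forces_cat.
  apply: forces_stable => // [m|y]; last exact: z_cauchy.
  exact: approximable_div (z_approx m) (approximable_overwrite r' (z_approx m)).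
have approx_open m : open_dense [set u | exists g, forces u (fun y => d2 (z y m) g < eps i)].
  by split=> [s|u v [g ug]]; [exact: z_approx|exists g; exact: forces_cat].
have [s1 s1P] := open_dense_strings rs (open_dense_all i.+1 meet_open) [::].
have [s2 s2P] := open_dense_strings rs
  (open_dense_all (size rs) (fun j => stable_open (nth [::] rs j))) s1.
have [M MP] : exists M, forall rr, rr \in [seq (r, r') | r <- rs, r' <- rs] ->
    forces (rr.1 ++ s1 ++ s2) (stable_from d2 (overwrite_ratio rr.2) M (eps i)).
  apply: exists_uniform_bound => [[r r'] M M' leM|[r r'] /allpairsP[[? ?] /= [rrs r'rs [-> ->]]]].
    by apply: forces_mono => y _ stab m m' lem lem'; apply: stab; exact: leq_trans leM _.
  have [M MP] := s2P _ rrs _ (etrans (index_mem _ _) r'rs).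
  by rewrite nth_index // in MP; exists M.
pose M' := maxn M M0.+1.
have [s3 s3P] := open_dense_strings rs (open_dense_all M'.+1 approx_open) (s1 ++ s2).
have [a aP] := e_word_inv ((s1 ++ s2) ++ s3).
exists (((s1 ++ s2) ++ s3) ++ [:: a]), M'; split; first by rewrite leq_max leqnn orbT.
  by rewrite segment_product_cat /= mulg1.
move=> r rrs; split=> [j lej|r' r'rs|m lem].
- rewrite -2!catA [r ++ _]catA; apply: (meet_open j).2; exact: s1P.
- rewrite -catA [r ++ _]catA; apply: forces_cat.
  have := MP (r, r'); rewrite allpairs_f // => /(_ isT).
  apply: forces_mono => y _ stab m m' lem lem'.
  by apply: stab; [apply: leq_trans lem|apply: leq_trans lem']; exact: leq_maxl.
- by have [g gP] := s3P r rrs m lem; exists g; rewrite catA; exact: forces_cat.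
Qed.

End Fusion.

Lemma segment_product_const (K : groupType) (e : nat -> K) N N' s :
  segment_product (fun=> e) N s = segment_product (fun=> e) N' s.
Proof. by elim: s N N' => //= a s IH N N'; rewrite (IH _ N'.+1). Qed.

Definition valid_word (w : nat -> nat) := forall i, (w i <= i)%N.

Section FusionLimit.
Variables (R : realType) (K1 K2 : groupType) (d1 : K1 -> K1 -> R) (d2 : K2 -> K2 -> R).
Hypotheses (d1P : biinvariant_metric d1) (d2P : biinvariant_metric d2).
Variables (e : nat -> K1) (z : (nat -> nat) -> nat -> K2).
Hypothesis e_word_inv : forall s, exists a, (segment_product (fun=> e) 0 s * e a)%g = 1%g.
Hypothesis z_approx : forall m, approximable d2 (z^~ m).
Hypothesis z_cauchy : forall r y,
  cauchy_sequence d2 (fun m => z y m * (z (overwrite r y) m)^-1)%g.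

(** [X w] is the sequence [w 0, pattern 0, w 1, pattern 1, ...] with the patterns of
    [fusion_step]. As the patterns have product [1], they do not affect
    convergence of ratios of products of letters. Up to [2^-i], the terms of
    [z (X w)] up to [M i] depend only on the letters up to [i], and the letters up
    to [i] have no influence on how ratios move after [M i]. *)
Theorem fusion : exists (X : (nat -> nat) -> nat -> nat) (M : nat -> nat),
  [/\ forall i, (M i < M i.+1)%N,
   forall w v i, valid_word w -> valid_word v -> (forall j, (i < j)%N -> w j = v j) ->
     forall m m', (M i <= m)%N -> (M i <= m')%N ->
     d2 (z (X w) m * (z (X v) m)^-1)%g (z (X w) m' * (z (X v) m')^-1)%g <= 2^-1 ^+ i,
   forall w v i, valid_word w -> valid_word v -> (forall j, (j <= i)%N -> w j = v j) ->
     forall m, (m <= M i)%N -> d2 (z (X w) m) (z (X v) m) < 2 * 2^-1 ^+ i &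
   forall w v,
     cauchy_sequence d1 (coded_ratio (fun=> e) (fun n => (X w n, X v n))) <->
     cauchy_sequence d1 (coded_ratio (fun=> e) (fun n => (w n, v n)))].
Proof.
have [Ds [h [dDs hP]]] := generic_branches d2 z.
have /choice[f /choice[g fgP]] := fun irM : nat * (seq (seq nat) * nat) =>
  fusion_step d2P e_word_inv z_approx z_cauchy dDs irM.1 irM.2.1 irM.2.2.
pose st := fix st i : seq (seq nat) * nat := if i is i'.+1 then
  ([seq r ++ f (i', st i') ++ [:: a] | r <- (st i').1, a <- iota 0 i'.+2],
   g (i', st i')) else ([:: [:: 0%N]], 0%N).
pose pat i := f (i, st i); pose M i := g (i, st i).
have stS i : st i.+1 =
  ([seq r ++ pat i ++ [:: a] | r <- (st i).1, a <- iota 0 i.+2], M i) by [].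
have {fgP} patP i := fgP (i, st i); rewrite /= -/(pat _) -/(M _) in patP.
(* [xs w i] is the initial segment of [X w] that ends with the letter [w i], and
   [k i] is its length; the list [(st i).1] contains [xs w i] for all valid [w]. *)
pose xs (w : nat -> nat) := fix xs i := if i is i'.+1 then
  xs i' ++ pat i' ++ [:: w i'.+1] else [:: w 0%N].
have xs_st w i : valid_word w -> xs w i \in (st i).1.
  move=> vw; elim: i => [|i IH]; first by have := vw 0%N; rewrite leqn0 /= => /eqP ->.
  apply: (allpairs_f (fun r a => r ++ pat i ++ [:: a])) => //.
  by rewrite mem_iota ltnS vw.
pose k i := size (xs id i).
have size_xs w i : size (xs w i) = k i.
  by rewrite /k; elim: i => //= i IH; rewrite !size_cat IH.
have kS i : k i.+1 = (k i + size (pat i)).+1.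
  by rewrite {1}/k /= !size_cat -/(k i) addn1 addnS.
have lt_k i : (i < k i)%N by elim: i => // i IH; rewrite kS ltnS (leq_trans IH) ?leq_addr.
have k_mono i j : (i <= j)%N -> (k i <= k j)%N.
  by move=> /subnKC <-; elim: (j - i)%N => [|l IH]; rewrite ?addn0 // addnS kS ltnW // ltnS (leq_trans IH) ?leq_addr.
have xs_tail w v i : (forall j, (i < j)%N -> w j = v j) -> forall l, exists t,
    xs w (i + l)%N = xs w i ++ t /\ xs v (i + l)%N = xs v i ++ t.
  move=> wv; elim=> [|l [t [IHw IHv]]]; first by exists [::]; rewrite addn0 !cats0.
  exists (t ++ pat (i + l)%N ++ [:: w (i + l).+1]); rewrite addnS /= IHw IHv -!catA.
  by rewrite -wv // ltnS leq_addr.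
pose X w n := nth 0%N (xs w n) n.
have X_xs w i n : (n < k i)%N -> X w n = nth 0%N (xs w i) n.
  rewrite /X => lt_n; have [le_ni|/ltnW le_in] := leqP n i.
    have [t []] := xs_tail w w n (fun _ _ => erefl) (i - n)%N.
    by rewrite subnKC // => -> _; rewrite nth_cat size_xs lt_k.
  have [t []] := xs_tail w w i (fun _ _ => erefl) (n - i)%N.
  by rewrite subnKC // => -> _; rewrite nth_cat size_xs lt_n.
have X_pat w i : extends_string (xs w i ++ pat i) (X w).
  apply: (@extends_string_catl _ [:: w i.+1]); rewrite -catA.
  apply: extends_stringP => n; rewrite -[_ ++ _]/(xs w i.+1) size_xs => lt_n.
  exact: X_xs.
have X_overwrite w v i : (forall j, (i < j)%N -> w j = v j) ->
    overwrite (xs v i) (X w) = X v.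
  move=> wv; apply/funext => n; rewrite /overwrite size_xs.
  case: ltnP => [lt_n|le_kn]; first by rewrite -X_xs.
  have le_in : (i <= n)%N by rewrite (leq_trans _ le_kn) // ltnW.
  have [t []] := xs_tail w v i wv (n - i)%N.
  by rewrite subnKC // /X => -> ->; rewrite !nth_cat !size_xs ltnNge le_kn.
have X_generic w : valid_word w -> forall j, hits (X w) (Ds j).
  move=> vw j; have [_ _ /(_ _ (xs_st w j vw))[/(_ j (leqnn j))[n le_n Dn] _ _]] := patP j.
  exists n; move: Dn; rewrite -{1}(X_pat w j) -{1}(subnKC le_n) mkseq_cat.
  by rewrite take_size_cat ?size_mkseq.
exists X, M; split.
- by move=> i; have [] := patP i.+1; rewrite stS.
- move=> w v i vw vv wv; have [stab _] := hP _ (X_generic w vw).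
  have [_ _ /(_ _ (xs_st w i vw))[_ /(_ _ (xs_st v i vv)) forced _]] := patP i.
  move=> m m' lem lem'; have := stab _ _ _ _ forced (X_pat w i) m m' lem lem'.
  by rewrite /overwrite_ratio X_overwrite.
- move=> w v i vw vv wv m lem.
  have [[_ apprw] [_ apprv]] := (hP _ (X_generic w vw), hP _ (X_generic v vv)).
  have eq_xs : xs w i = xs v i.
    elim: i wv {lem} => [|i IH] wv /=; first by rewrite wv.
    by rewrite IH ?wv // => j lej; apply: wv; exact: leqW.
  have [_ _ /(_ _ (xs_st w i vw))[_ _ /(_ m lem) forced]] := patP i.
  have ltw := apprw _ _ _ forced (X_pat w i).
  rewrite eq_xs in forced ltw; have ltv := apprv _ _ _ forced (X_pat v i).
  apply: le_lt_trans (dist_triangle d2P (h (xs v i ++ pat i) m i) _ _) _.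
  by rewrite mulr_natl mulr2n ltrD // (distC d2P).
move=> w v.
have prod_X u n : coded_product (fun=> e) (X u) n = segment_product (fun=> e) 0 (mkseq (X u) n).
  by rewrite -[n in LHS]add0n coded_product_segment mul1g.
have prod_xs u i : segment_product (fun=> e) 0 (xs u i) = coded_product (fun=> e) u i.+1.
  elim: i => [|i IH]; first by rewrite /= mulg1 mul1g.
  rewrite [LHS]segment_product_cat IH segment_product_cat (segment_product_const _ _ 0).
  by have [_ -> _] := patP i; rewrite /= mul1g mulg1.
have locate n : (k 0 <= n)%N -> exists i, (k i <= n < k i.+1)%N.
  move=> le_n; have [l le_kl] : exists l, (n < k l)%N by exists n; exact: lt_k.
  elim: l le_kl => [|l IH] lt_n; first by rewrite ltnNge le_n in lt_n.
  by have [/IH //|le_kl] := ltnP n (k l); exists l; rewrite le_kl.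
have /choice[stage stageP] : forall n, exists i, (k 0 <= n)%N -> (k i <= n < k i.+1)%N.
  move=> n; have [/locate[i iP]|lt_n] := leqP (k 0) n; first by exists i.
  by exists 0%N.
have prod_stage u n : (k 0 <= n)%N ->
    coded_product (fun=> e) (X u) n = (coded_product (fun=> e) u (stage n).+1 *
      segment_product (fun=> e) 0 (take (n - k (stage n)) (pat (stage n))))%g.
  move=> /stageP /andP[le_n]; rewrite kS ltnS => le_n'.
  rewrite prod_X -prod_xs.
  have -> : mkseq (X u) n = take n (xs u (stage n) ++ pat (stage n)).
    rewrite -(X_pat u) size_cat size_xs -(subnKC le_n') mkseq_cat.
    by rewrite take_size_cat ?size_mkseq // subnKC.
  rewrite take_cat size_xs ltnNge le_n /= segment_product_cat.
  by rewrite [X in (_ * X)%g](segment_product_const _ _ 0).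
have stage_k i : stage (k i) = i.
  have /stageP/andP[le_s lt_s] := k_mono _ _ (leq0n i).
  apply/eqP; rewrite eqn_leq; apply/andP; split.
    rewrite leqNgt; apply/negP => lt_is; move: le_s; rewrite leqNgt.
    by rewrite (leq_trans _ (k_mono _ _ lt_is)) // kS ltnS leq_addr.
  by rewrite leqNgt; apply/negP => /k_mono; rewrite leqNgt lt_s.
rewrite -[X in _ <-> X]cauchy_shift //.
apply: (cauchy_reindex d1P (g := stage) (k := k)) => //.
- move=> n le_n; rewrite /coded_ratio !prod_stage //; exact: mulgKA.
- move=> N; exists (k N) => n le_n; have le_0n := leq_trans (k_mono _ _ (leq0n N)) le_n.
  rewrite leqNgt; apply/negP => /k_mono; rewrite leqNgt => /negP; apply.
  by apply: leq_ltn_trans le_n _; have /andP[] := stageP _ le_0n.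
- by move=> i; exact/ltnW/lt_k.
Qed.

End FusionLimit.

(** * Block-wise reductions *)

Section CodedReduction.
Variables (R : realType) (K1 K2 : groupType) (d1 : K1 -> K1 -> R) (d2 : K2 -> K2 -> R).
Hypotheses (d1P : biinvariant_metric d1) (d2P : biinvariant_metric d2).
Variables (e : nat -> K1) (z : (nat -> nat) -> nat -> K2).
Hypothesis e_word_inv : forall s, exists a, (segment_product (fun=> e) 0 s * e a)%g = 1%g.
Hypothesis z_approx : forall m, approximable d2 (z^~ m).
Hypothesis z_reduction : forall y y',
  cauchy_sequence d1 (coded_ratio (fun=> e) (fun n => (y n, y' n))) <->
  cauchy_sequence d2 (fun m => z y m * (z y' m)^-1)%g.

(** Sequences that differ in finitely many letters are equivalent. *)
Lemma reduction_overwrite r y :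
  cauchy_sequence d2 (fun m => z y m * (z (overwrite r y) m)^-1)%g.
Proof.
apply/z_reduction => q q0; exists (size r) => n le_n.
have -> : coded_ratio (fun=> e) (fun n => (y n, overwrite r y n)) n =
    coded_ratio (fun=> e) (fun n => (y n, overwrite r y n)) (size r).
  rewrite -(subnKC le_n); elim: (n - size r)%N => [|i IH]; first by rewrite addn0.
  rewrite addnS -IH /coded_ratio /= /overwrite ltnNge leq_addr /=; exact: mulgKA.
by rewrite (distxx d1P).
Qed.

(** By [fusion] the increment of [Z w], that is of [z (X w)] relative to the word
    [0 0 ...], over the block from [M (i-1)] to [M i] depends almost only on the letter
    [w i]: later letters are not felt yet, and earlier ones no longer matter.
    [T i a] is this increment for the word that has [a] at position [i] and [0]
    elsewhere, and [D i a b] is the largest distance of the increments within the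
    block. *)
Theorem coded_reduction : exists (T : nat -> nat -> K2) (D : nat -> nat -> nat -> R),
  [/\ forall i, T i 0 = 1%g, forall i a, D i a a = 0,
   forall x, valid_pairs x -> coded_equivalent d1 (fun=> e) (fun _ _ _ => 0) x ->
     coded_equivalent d2 T D x &
   forall x, valid_pairs x -> coded_equivalent d2 T D x ->
     coded_equivalent d1 (fun=> e) (fun _ _ _ => 0) x].
Proof.
have [X [M [M_mono XF1 XF2 XF3]]] :=
  fusion d1P d2P e_word_inv z_approx reduction_overwrite.
pose o := fun _ : nat => 0%N.
pose Z w m := (z (X w) m * (z (X o) m)^-1)%g.
pose del i a := fun j : nat => if j == i then a else 0%N.
pose T' i a m := ((Z (del i a) (M i.-1))^-1 * Z (del i a) m)%g.
pose D i a b : R := \big[Num.max/0]_(M i.-1 <= m < (M i).+1) d2 (T' i a m) (T' i b m).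
have M_monoW i : (M i.-1 <= M i)%N by case: i => // i; exact/ltnW/M_mono.
have M_homo i j : (i <= j)%N -> (M i <= M j)%N.
  by move/subnKC<-; elim: (j - i)%N => [|l IH]; rewrite ?addn0 // addnS (leq_trans IH) // ltnW.
have le_M i : (i <= M i)%N by elim: i => // i IH; exact: leq_ltn_trans IH (M_mono i).
have le_D i a b m : (M i.-1 <= m <= M i)%N -> d2 (T' i a m) (T' i b m) <= D i a b.
  move=> m_i; rewrite /D; apply: (le_bigmax_seq _ m xpredT (fun m => d2 (T' i a m) (T' i b m))) => //.
  by rewrite mem_index_iota ltnS.
have D_lt i a b (q : R) : 0 < q -> (forall m, (M i.-1 <= m <= M i)%N ->
    d2 (T' i a m) (T' i b m) < q) -> D i a b < q.
  move=> q0 dq; rewrite /D big_seq; elim/big_ind: _ => // [x y ltx lty|m].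
    by rewrite gt_max ltx.
  by rewrite mem_index_iota ltnS => /dq.
have Z0 m : Z o m = 1%g by rewrite /Z mulgV.
have del0 i : del i 0%N = o by apply/funext => j; rewrite /del; case: ifP.
have half0 i : 0 < 2^-1 ^+ i :> R by rewrite exprn_gt0 // invr_gt0.
have valid_del i a : (a <= i)%N -> valid_word (del i a).
  by move=> le_a j; rewrite /del; case: eqP => // ->.
have ZR w v m : (Z w m * (Z v m)^-1)%g = (z (X w) m * (z (X v) m)^-1)%g.
  by rewrite /Z invgM invgK !mulgA mulgVK.
(* Cut [w] off after [i], which costs [2 * 2^-i] at both ends of the block, and then
   remove the letters before [i], which costs [2^-(i-1)]. *)
have est w i m : valid_word w -> (M i.-1 <= m <= M i)%N ->
    d2 ((Z w (M i.-1))^-1 * Z w m)%g (T' i (w i) m) <= 8 * 2^-1 ^+ i.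
  case: i => [|i] vw /= /andP[le_m le_m'].
    have -> : m = M 0%N by apply/eqP; rewrite eqn_leq le_m'.
    by rewrite /T' /= !mulVg (distxx d2P) mulr_ge0.
  pose w' j := if (j <= i.+1)%N then w j else 0%N.
  have vw' : valid_word w' by move=> j; rewrite /w'; case: ifP.
  have vd := valid_del i.+1 (w i.+1) (vw i.+1).
  have ZW j : (j <= M i.+1)%N -> d2 (Z w j) (Z w' j) <= 2 * 2^-1 ^+ i.+1.
    move=> le_j; rewrite (dist_mulr d2P); apply/ltW/XF2 => // l le_l.
    by rewrite /w' le_l.
  apply: le_trans (dist_triangle d2P ((Z w' (M i))^-1 * Z w' m)%g _ _) _.
  have := dist_mul d2P (Z w (M i))^-1%g (Z w m) (Z w' (M i))^-1%g (Z w' m).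
  rewrite (dist_inv d2P) => le1.
  have le2 : d2 ((Z w' (M i))^-1 * Z w' m)%g (T' i.+1 (w i.+1) m) <= 2^-1 ^+ i.
    rewrite (dist_Vmul_div d2P) !ZR; apply: XF1 => // j lt_j.
    rewrite /w' /del; case: eqP => [->|/eqP neq_j]; first by rewrite leqnn.
    by rewrite leqNgt ltn_neqAle eq_sym neq_j lt_j.
  have := ZW _ (leq_trans le_m le_m'); have := ZW _ le_m'; rewrite exprS in le1 le2 *.
  have := half0 i; move: le1 le2; lra.
pose T i a := T' i a (M i); pose B w i := (Z w (M i) * (coded_product T w i.+1)^-1)%g.
(* The products of the [T i (w i)] follow [Z w] along the ends of the blocks up to the
   correction [B w i], which converges because the errors are summable. *)
have B_cauchy w : valid_word w -> cauchy_sequence d2 (B w).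
  move=> vw; apply: (cauchy_geometric d2P (c := 4)) => i; rewrite /B.
  rewrite [coded_product _ _ i.+2]/= invgM mulgA (dist_mulr d2P).
  rewrite -(dist_mull d2P (Z w (M i))^-1%g) mulVg mulgA (dist_div1 d2P).
  have := est w i.+1 (M i.+1) vw; rewrite leqnn andbT => /(_ (M_monoW i.+1)).
  by rewrite exprS /T; lra.
have codes w v i : coded_ratio T (fun n => (w n, v n)) i.+1 =
    ((B w i)^-1 * (Z w (M i) * (Z v (M i))^-1) * B v i)%g.
  have alg (a b s u : K2) : ((a * s^-1)^-1 * (a * b^-1) * (b * u^-1) = s * u^-1)%g.
    by rewrite invgM invgK !mulgA !mulgVK.
  by rewrite alg.
have ratioM w v i : (Z w (M i) * (Z v (M i))^-1)%g =
    (B w i * coded_ratio T (fun n => (w n, v n)) i.+1 * (B v i)^-1)%g.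
  have alg (a b s u : K2) : (a * b^-1 = (a * s^-1) * (s * u^-1) * (b * u^-1)^-1)%g.
    by rewrite invgM invgK !mulgA !mulgVK.
  exact: alg.
have est2 w v i m : valid_word w -> valid_word v -> (M i.-1 <= m <= M i)%N ->
    `|d2 (T' i (w i) m) (T' i (v i) m) -
      d2 (Z w m * (Z v m)^-1)%g (Z w (M i.-1) * (Z v (M i.-1))^-1)%g| <= 16 * 2^-1 ^+ i.
  move=> vw vv m_i; rewrite -(dist_Vmul_div d2P).
  have := est w i m vw m_i; have := est v i m vv m_i.
  set a := (_^-1 * Z w m)%g; set b := (_^-1 * Z v m)%g.
  have := dist_triangle d2P a (T' i (w i) m) (T' i (v i) m).
  have := dist_triangle d2P b a (T' i (v i) m).
  have := dist_triangle d2P (T' i (w i) m) a b.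
  have := dist_triangle d2P (T' i (v i) m) (T' i (w i) m) b.
  rewrite ![d2 (T' _ _ _) a](distC d2P) ![d2 (T' _ _ _) b](distC d2P).
  by move=> *; rewrite ler_norml; apply/andP; split; lra.
have half_cvg (q : R) : 0 < q -> exists N, forall i, (N <= i)%N -> 16 * 2^-1 ^+ i < q.
  move=> q0; have [N ltN] := ltr_half_exp (divr_gt0 q0 (ltr0n R 16)).
  exists N => i /subnKC <-; rewrite mulrC -ltr_pdivlMr //; apply: le_lt_trans ltN.
  by rewrite exprD ler_piMr ?(ltW (half0 _)) // exprn_ile1 ?invr_ge0 ?invf_le1 ?ler1n.
have valid1 x : valid_pairs x -> valid_word (fst \o x) /\ valid_word (snd \o x).
  by move=> vx; split=> i /=; have [] := vx i.
have pair_eta (x : nat -> nat * nat) : (fun n => ((fst \o x) n, (snd \o x) n)) = x.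
  by apply/funext => n /=; case: (x n).
have main x : valid_pairs x -> coded_equivalent d1 (fun=> e) (fun _ _ _ => 0) x <->
    cauchy_sequence d2 (fun m => Z (fst \o x) m * (Z (snd \o x) m)^-1)%g.
  move=> vx; have -> : (fun m => Z (fst \o x) m * (Z (snd \o x) m)^-1)%g =
      (fun m => z (X (fst \o x)) m * (z (X (snd \o x)) m)^-1)%g.
    by apply/funext => m; exact: ZR.
  rewrite -z_reduction XF3 /coded_equivalent.
  rewrite pair_eta.
  by split=> [[]//|cx]; split=> // q q0; exists 0%N.
exists T, D; split.
- by move=> i; rewrite /T /T' del0 !Z0 mulVg.
- move=> i a; rewrite /D; elim/big_ind: _ => // [x y -> ->|m _]; first exact: maxxx.
  exact: distxx.
- move=> x vx; have [vw vv] := valid1 x vx; move/(main x vx) => cZ; split.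
    apply/(cauchy_shift d2P); apply: (cauchy_ext (u := fun i => (B (fst \o x) i)^-1 *
        (Z (fst \o x) (M i) * (Z (snd \o x) (M i))^-1) * B (snd \o x) i)%g) => [i|].
      by rewrite -codes pair_eta.
    apply: (cauchy_mul d2P) (B_cauchy _ vv); apply: (cauchy_mul d2P).
      exact/(cauchy_inv d2P)/B_cauchy.
    move=> q q0; have [N NP] := (cauchy_sequenceP d2P _).1 cZ q q0.
    by exists N => i le_i; apply: NP; rewrite ?(leq_trans _ (le_M _)).
  move=> q q0; have q20 : 0 < q / 2 by rewrite divr_gt0.
  have [N NP] := (cauchy_sequenceP d2P _).1 cZ _ q20; have [N' N'P] := half_cvg _ q20.
  exists (maxn N.+1 N') => i; rewrite geq_max => /andP[lt_i le_i].
  apply: D_lt => // m m_i; have /andP[le_m _] := m_i.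
  have lt_NM : (N <= M i.-1)%N by rewrite (leq_trans _ (le_M _)) // -ltnS (leq_trans lt_i) ?leqSpred.
  have := est2 _ _ i m vw vv m_i; rewrite ler_norml => /andP[_].
  have := NP m (M i.-1) (leq_trans lt_NM le_m) lt_NM; have := N'P i le_i.
  by rewrite /=; lra.
- move=> x vx [cR cD]; have [vw vv] := valid1 x vx; apply/(main x vx).
  set C := (fun m => _).
  have cCM : cauchy_sequence d2 (C \o M).
    apply: (cauchy_ext (u := fun i =>
        B (fst \o x) i * coded_ratio T x i.+1 * (B (snd \o x) i)^-1)%g) => [i|].
      by rewrite /C [RHS]ratioM pair_eta.
    apply: (cauchy_mul d2P) (cauchy_inv d2P (B_cauchy _ vv)).
    by apply: (cauchy_mul d2P); [exact: B_cauchy|apply/(cauchy_shift d2P)].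
  apply/(cauchy_sequenceP d2P) => q q0; have q60 : 0 < q / 6 by rewrite divr_gt0.
  have [N NP] := (cauchy_sequenceP d2P _).1 cCM _ q60.
  have [[N1 N1P] [N2 N2P]] := (half_cvg _ q60, cD _ q60).
  pose L := maxn N (maxn N1 N2).
  have close m : (M L <= m)%N -> d2 (C m) (C (M L)) < q / 2.
    move=> le_m.
    have [i [le_Li le_im le_mi]] : exists i, [/\ (L <= i)%N, (M i <= m)%N & (m <= M i.+1)%N].
      have [l lt_ml] : exists l, (m < M l)%N by exists m.+1; exact: le_M.
      elim: l lt_ml => [|l IH] lt_ml.
        by move: (leq_trans lt_ml (M_homo _ _ (leq0n L))); rewrite ltnNge le_m.
      have [/IH //|le_lm] := ltnP m (M l).
      exists l; split => //; last exact: ltnW.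
      rewrite leqNgt; apply/negP => lt_lL; move: lt_ml; rewrite ltnNge => /negP; apply.
      exact: leq_trans (M_homo _ _ lt_lL) le_m.
    have lt1 : d2 (C m) (C (M i)) < q / 6 + q / 6.
      have m_i : (M i.+1.-1 <= m <= M i.+1)%N by rewrite le_im le_mi.
      have := est2 _ _ i.+1 m vw vv m_i; rewrite ler_norml => /andP[+ _].
      have := le_D i.+1 ((fst \o x) i.+1) ((snd \o x) i.+1) m m_i.
      have := N2P i.+1; rewrite (leq_trans _ (leqW le_Li)) ?(leq_trans (leq_maxr N1 N2)) ?leq_maxr // => /(_ isT).
      have := N1P i.+1; rewrite (leq_trans _ (leqW le_Li)) ?(leq_trans (leq_maxl N1 N2)) ?leq_maxr // => /(_ isT).
      by rewrite /= /C; lra.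
    have lt2 : d2 (C (M i)) (C (M L)) < q / 6.
      by apply: NP; rewrite ?leq_maxl // (leq_trans _ le_Li) ?leq_maxl.
    by have := dist_triangle d2P (C (M i)) (C m) (C (M L)); move: lt1 lt2; lra.
  exists (M L) => m m' lem lem'; rewrite [q]splitr.
  apply: le_lt_trans (dist_triangle d2P (C (M L)) _ _) _.
  by rewrite ltrD ?close // (distC d2P) close.
Qed.

End CodedReduction.

(** * The identity component of a Lie group *)

Section CompatibleMetric.
Variables (R : realType) (G : topologicalGroupType) (d : G -> G -> R).
Hypothesis dG : compatible_metric d.
Hypothesis dI : forall g h x y : G, d (g * x * h)%g (g * y * h)%g = d x y.

Lemma TSI_biinvariant : biinvariant_metric d.
Proof. by case: dG. Qed.

Let dP := TSI_biinvariant.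

Lemma nbhs_dist (x : G) (A : set G) :
  nbhs x A <-> exists2 e : R, 0 < e & forall y, d x y < e -> A y.
Proof.
by case: dG => _ ->; split=> [[e /= e0 eA]|[e e0 eA]]; exists e.
Qed.

Lemma cvg_dist (u : nat -> G) l : u @ \oo --> l <->
  forall e : R, 0 < e -> exists N, forall n, (N <= n)%N -> d (u n) l < e.
Proof.
split=> [ul e e0|ul A /nbhs_dist[e e0 eA]].
  have : nbhs l [set y | d l y < e] by apply/nbhs_dist; exists e.
  by move/ul => [N _ NP]; exists N => n /NP; rewrite /= (distC dP).
have [N NP] := ul e e0; exists N => // n /NP lt_n; apply: eA.
by rewrite (distC dP).
Qed.

Lemma open_dist_ball (x : G) (e : R) : open [set y | d y x < e].
Proof.
rewrite openE => y /= lt_yx; apply/nbhs_dist; exists (e - d y x); first by rewrite subr_gt0.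
move=> y' lt_y; apply: le_lt_trans (dist_triangle dP y _ _) _.
by rewrite (distC dP) -ltrBrDr.
Qed.

(** A TSI group with an open complete subgroup is complete. *)
Lemma E_cauchy n (psi : 'rV[R]_n -> G) kap : vector_component d psi kap ->
  forall x y : {ptws nat -> G}, E x y <-> cauchy_sequence d (fun m => x m * (y m)^-1)%g.
Proof.
move=> vP x y; split=> [[l /cvg_dist xyl]|c].
  apply/(cauchy_sequenceP dP) => e e0; have e20 : 0 < e / 2 by rewrite divr_gt0.
  have [N NP] := xyl _ e20; exists N => i j le_i le_j.
  apply: le_lt_trans (dist_triangle dP l _ _) _.
  by rewrite [e]splitr ltrD ?NP // (distC dP) NP.
by have [l lP] := vector_component_complete dP vP c; exists l; apply/cvg_dist.
Qed.

End CompatibleMetric.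

Lemma ball_connected (R : realType) m (x : 'rV[R]_m) (e : R) : 0 < e -> connected (ball x e).
Proof.
move=> e0.
have -> : ball x e = \bigcup_(y in ball x e) ((fun t : R => x + t *: (y - x)) @` `[0, 1]).
  apply/seteqP; split=> [y xy|z [y xy [t]]].
    exists y => //; exists 1; last by rewrite scale1r subrKC.
    by rewrite /= in_itv /= ler01 lexx.
  rewrite /= in_itv /= => /andP[t0 t1] <-; move: xy; rewrite -ball_normE /=.
  rewrite opprD addrA subrr add0r normrN normrZ ger0_norm // distrC.
  by apply: le_lt_trans; rewrite ler_piMl.
apply: bigcup_connected.
  exists x => y _; exists 0; last by rewrite scale0r addr0.
  by rewrite /= in_itv /= lexx ler01.
move=> y _; apply: connected_continuous_connected; first exact: segment_connected.
apply: continuous_subspaceT => t; apply: cvgD; first exact: cvg_cst.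
apply: cvgZl; exact: cvg_id.
Qed.

(** In a chart, a ball around the image of [1] is connected, so its preimage is a
    neighbourhood of [1] inside the component; translation does the rest. *)
Lemma identity_component_open (R : realType) (G : topologicalGroupType) :
  is_Lie_group R G -> open (@identity_component G).
Proof.
move=> [_ [m [A [[Acov _] _ _]]]].
have [c _ c1] := Acov 1%g.
have nbhs1 : nbhs (1%g : G) (@identity_component G).
  have img1 : (c @` chart_dom c) (c 1%g) by exists 1%g.
  have /nbhs_ballP[e e0 eP] : nbhs (c 1%g) (c @` chart_dom c).
    exact: open_nbhs_nbhs (conj (@chart_img_open _ _ _ c) img1).
  have conn : connected (chart_inv c @` ball (c 1%g) e).
    apply: connected_continuous_connected; first exact: ball_connected.
    apply: continuous_in_subspaceT => y /set_mem ye.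
    by apply: chart_inv_continuous; apply/mem_set/eP.
  have sub : chart_inv c @` ball (c 1%g) e `<=` @identity_component G.
    apply: connected_component_max => //; exists (c 1%g); first exact: ballxx.
    by apply: (chart_funK (c := c)); exact/mem_set.
  have nb : nbhs (1%g : G) (chart_dom c `&` c @^-1` ball (c 1%g) e).
    apply: filterI; first exact: open_nbhs_nbhs (conj (@chart_dom_open _ _ _ c) c1).
    by apply: (chart_fun_continuous (mem_set c1)); exact: nbhsx_ballx.
  apply: filterS nb => g [cg cge]; apply: sub; exists (c g) => //.
  exact/(chart_funK (c := c))/mem_set.
rewrite openE => g g0; rewrite /interior.
have nbg : nbhs (g^-1 * g)%g (@identity_component G) by rewrite mulVg.
have nbg' := mulg_continuousl nbg; rewrite nbhs_simpl /= in nbg'.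
apply: (@filterS _ (nbhs g) _ _ _ _ nbg') => h /= gh.
by rewrite -(mulVKg g h); apply: identity_componentM.
Qed.

Lemma nbhs_identity_component (R : realType) (G : topologicalGroupType) (d : G -> G -> R)
    (B : set (identity_component_type G)) : compatible_metric d ->
  nbhs (1%g : identity_component_type G) B ->
  exists2 r : R, 0 < r & forall g : identity_component_type G, d 1%g (val g) < r -> B g.
Proof.
move=> dG; rewrite nbhsE => -[U [[C oC CU] U1] UB].
have : nbhs (1%g : G) C by apply: open_nbhs_nbhs; split=> //; rewrite -CU in U1.
move/(nbhs_dist dG) => [r r0 rP]; exists r => // g /rP Cg.
by apply: UB; rewrite -CU.
Qed.

Lemma tiso1 (K L : topologicalGroupType) (f : topological_isomorphism K L) : f 1%g = 1%g.
Proof. by apply: (@mulgI _ (f 1%g)); rewrite -tiso_morph !mulg1. Qed.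

Lemma tiso_inv_morph (K L : topologicalGroupType) (f : topological_isomorphism K L) :
  {morph tiso_inv f : x y / (x * y)%g}.
Proof.
by move=> x y; apply: (can_inj (tiso_funK f)); rewrite tiso_morph !tiso_invK.
Qed.

Section ComponentCoordinates.
Variables (R : realType) (G : topologicalGroupType) (n : nat) (d : G -> G -> R).
Hypothesis dG : compatible_metric d.
Hypothesis dI : forall g h x y : G, d (g * x * h)%g (g * y * h)%g = d x y.
Hypothesis openG0 : open (@identity_component G).
Variable iso : topological_isomorphism (identity_component_type G) (additive_group 'rV[R]_n).

Definition component_vector (x : 'rV[R]_n) : G := val (tiso_inv iso x).

Definition component_coord (g : G) : 'rV[R]_n :=
  if pselect (identity_component g) is left g0 then
    iso (exist _ g (mem_set g0) : identity_component_type G) else 0.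

Lemma component_vector_mem x : identity_component (component_vector x).
Proof. exact: set_mem (valP (tiso_inv iso x)). Qed.

Lemma component_coordE (g : identity_component_type G) : component_coord (val g) = iso g.
Proof.
rewrite /component_coord; case: pselect => [g0|]; last by case; exact: set_mem (valP g).
by congr (iso _); apply: val_inj.
Qed.

Lemma component_vectorE g : identity_component g -> component_vector (component_coord g) = g.
Proof.
move=> g0; rewrite -[g in component_coord g]/(val (exist _ g (mem_set g0) : identity_component_type G)).
by rewrite component_coordE /component_vector tiso_funK.
Qed.

Lemma component_vectorD x y :
  component_vector (x + y) = (component_vector x * component_vector y)%g.
Proof. by rewrite /component_vector (tiso_inv_morph iso x y) valM. Qed.

Lemma component_vector_cvg : component_vector x @[x --> (0 : 'rV[R]_n)] --> (1%g : G).
Proof.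
have -> : (1%g : G) = component_vector 0.
  by apply: (@mulgI _ (component_vector 0)); rewrite -component_vectorD addr0 mulg1.
move=> A A1.
have nbA : nbhs (tiso_inv iso (0 : 'rV[R]_n)) (val @^-1` A).
  exact: (@initial_continuous _ _ (val : identity_component_type G -> G)).
exact: (@tiso_inv_continuous _ _ iso (0 : 'rV[R]_n) _ nbA).
Qed.

Lemma component_vector_component : vector_component d component_vector component_coord.
Proof.
have dP := TSI_biinvariant dG dI.
split.
- exact: component_vectorD.
- by move=> x; rewrite /component_vector component_coordE tiso_invK.
- move=> g x; exists (component_coord (g * component_vector x * g^-1)%g).
  by rewrite component_vectorE //; exact/identity_componentJ/component_vector_mem.
- move=> e e0; have : nbhs (1%g : G) [set g | d g 1%g < e].
    by apply/(nbhs_dist dG); exists e => // g; rewrite (distC dP).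
  move/component_vector_cvg => /nbhs_ballP[r /= r0 rP]; exists r => // x ltx.
  by apply: rP; rewrite -ball_normE /= sub0r normrN.
move=> e e0.
have : nbhs (iso 1%g) (ball (0 : 'rV[R]_n) e) by rewrite tiso1; exact: nbhsx_ballx.
move=> /(@tiso_fun_continuous _ _ iso 1%g _)/(nbhs_identity_component dG)[r1 r10 r1P].
have [r2 r20 r2P] : exists2 r : R, 0 < r & forall y, d 1%g y < r -> @identity_component G y.
  by apply/(nbhs_dist dG)/open_nbhs_nbhs; split => //; exact: identity_component1.
exists (Num.min r1 r2) => [|g]; first by rewrite lt_min r10.
rewrite lt_min (distC dP) => /andP[lt1 /r2P g0]; split; first exact: component_vectorE.
rewrite -[g]/(val (exist _ g (mem_set g0) : identity_component_type G)) component_coordE.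
by have := r1P (exist _ g (mem_set g0)) lt1; rewrite /= -ball_normE /= sub0r normrN.
Qed.

End ComponentCoordinates.

(** * Borel maps on sequence spaces *)
Section Borel.

Lemma ptws_cvg (Y : topologicalType) (F : set_system (nat -> Y)) {FF : Filter F} (f : nat -> Y) :
  (forall i, (fun g : nat -> Y => g i) @ F --> f i) -> F --> (f : {ptws nat -> Y}).
Proof.
move=> Ff; apply/cvg_sup => i A; rewrite nbhsE => -[B [[C oC CB] Bf] BA].
have : nbhs (f i) C by apply: open_nbhs_nbhs; split => //; rewrite -CB in Bf.
by move/Ff => FC; apply: (@filterS _ F FF _ _ _ FC) => g Cg; apply: BA; rewrite -CB.
Qed.

Lemma continuous_borel_map (X Y : topologicalType) (f : X -> Y) : continuous f -> borel_map f.
Proof.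
move=> cf B; apply: (@smallest_sub _ _ _ [set B | <<s open >> (f @^-1` B)]).
  have [s0 sC sU] := smallest_sigma_algebra [set: X] (open : set (set X)).
  split => [|A sA|A sA].
  - by rewrite /= preimage_set0.
  - by rewrite /= setTD preimage_setC -setTD; exact: sC.
  - by rewrite /= preimage_bigcup; exact: sU.
move=> O oO; apply: sub_sigma_algebra; exact: open_comp.
Qed.

(** The sets with the Baire property form a sigma-algebra. *)
Lemma decided_borel (X : topologicalType) (p : (nat -> nat) -> X) (B : set X) :
  (forall O, open O -> open_branches (p @^-1` O)) -> <<s open >> B -> decided (p @^-1` B).
Proof.
move=> cp; apply: (@smallest_sub _ _ _ [set B | decided (p @^-1` B)]).
  split => [|A dA|A dA].
  - by rewrite /= preimage_set0; apply: decided_open => y [].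
  - by rewrite /= setTD preimage_setC; exact: decided_setC.
  - by rewrite /= preimage_bigcup; exact: decided_bigcup.
by move=> O oO; apply: decided_open; exact: cp.
Qed.

End Borel.

(** * From a Borel reduction to a matrix *)

(** Supplies the letters: a sequence whose values are closed under the operations.
    Stage [k + 1] lists all values of stage [k] and all results of applying an
    operation to them. *)
Lemma countable_closure (K : Type) (mul : K -> K -> K) (inv half : K -> K) (u : nat -> K) :
  exists e : nat -> K, [/\ forall a, exists b, e b = u a,
    forall a b, exists c, e c = mul (e a) (e b),
    forall a, exists b, e b = inv (e a) & forall a, exists b, e b = half (e a)].
Proof.
pose step (v : nat -> K) (n : nat) : K :=
  if unpickle n is Some (t, i, j) then
    match t with 0%N => v i | 1%N => mul (v i) (v j) | 2%N => inv (v i) | _ => half (v i) end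
  else u 0%N.
have stepE v t i j : step v (pickle (t, i, j)) =
    match t with 0%N => v i | 1%N => mul (v i) (v j) | 2%N => inv (v i) | _ => half (v i) end.
  by rewrite /step pickleK.
pose e n := if unpickle n is Some (k, i) then iter k step u i else u 0%N.
have eE k i : e (pickle (k, i)) = iter k step u i by rewrite /e pickleK.
have up k l i : exists j, iter (k + l) step u j = iter k step u i.
  elim: l => [|l [j IH]]; first by exists i; rewrite addn0.
  by exists (pickle (0%N, j, 0%N)); rewrite addnS /= stepE.
have e_level a : exists k i, e a = iter k step u i.
  by rewrite /e; case: unpickle => [[k i]|]; [exists k, i|exists 0%N, 0%N].
exists e; split.
- by move=> a; exists (pickle (0%N, a)); rewrite eE.
- move=> a b; have [[k [i ->]] [l [j ->]]] := (e_level a, e_level b).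
  have [[i' <-] [j' <-]] := (up k l i, up l k j).
  by exists (pickle ((k + l).+1, pickle (1%N, i', j'))); rewrite eE /= stepE addnC.
- move=> a; have [k [i ->]] := e_level a.
  by exists (pickle (k.+1, pickle (2%N, i, 0%N))); rewrite eE /= stepE.
- move=> a; have [k [i ->]] := e_level a.
  by exists (pickle (k.+1, pickle (3%N, i, 0%N))); rewrite eE /= stepE.
Qed.

Lemma separable_sequence (T : topologicalType) (x0 : T) : separable T ->
  exists D : nat -> T, forall O, open O -> O !=set0 -> exists k, O (D k).
Proof.
move=> [S [/countable_injP[f f_inj] dS]].
have /choice[D DP] : forall k, exists x, (exists2 s, S s & f s = k) -> S x /\ f x = k.
  move=> k; have [[s Ss fs]|no] := pselect (exists2 s, S s & f s = k); first by exists s.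
  by exists x0 => /no.
exists D => O oO O0; have [s [Os Ss]] := dS O O0 oO; exists (f s).
have [SD fD] := DP (f s) (ex_intro2 _ _ s Ss erefl).
by rewrite (f_inj _ _ _ _ fD) ?inE.
Qed.

Section ForwardDirection.
Variables (R : realType) (G H : topologicalGroupType) (n : nat).
Variables (d1 : G -> G -> R) (d2 : H -> H -> R).
Hypotheses (d1G : compatible_metric d1) (d2H : compatible_metric d2).
Hypothesis d1I : forall g h x y : G, d1 (g * x * h)%g (g * y * h)%g = d1 x y.
Hypothesis d2I : forall g h x y : H, d2 (g * x * h)%g (g * y * h)%g = d2 x y.
Hypotheses (sepG : separable G) (sepH : separable H).
Variables (psi1 : 'rV[R]_n -> G) (kap1 : G -> 'rV[R]_n).
Variables (psi2 : 'rV[R]_n -> H) (kap2 : H -> 'rV[R]_n).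
Hypotheses (v1 : vector_component d1 psi1 kap1) (v2 : vector_component d2 psi2 kap2).

(** Coding is continuous, so the preimage of a ball under a Borel map has the Baire
    property; if no extension of [s] forced the value into a ball around some
    member of a dense sequence, a generic branch would have no value at all. *)
Lemma approximable_borel (theta : {ptws nat -> G} -> {ptws nat -> H}) (e : nat -> G) :
  borel_map theta ->
  forall m, approximable d2 (fun y => theta (coded_product (fun=> e) y) m).
Proof.
move=> Btheta m s q q0; have d2P := TSI_biinvariant d2H d2I.
have [D DP] := separable_sequence 1%g sepH.
apply: contrapT => no.
pose B k : set {ptws nat -> H} := [set f | d2 (f m) (D k) < q].
have oB k : open (B k).
  have -> : B k = proj m @^-1` [set g | d2 g (D k) < q] by [].
  by apply: open_comp; [move=> ? _; exact: proj_continuous|exact: (open_dist_ball d2H d2I)].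
have p_open O : open (O : set {ptws nat -> G}) ->
    open_branches ((coded_product (fun=> e) : (nat -> nat) -> {ptws nat -> G}) @^-1` O).
  move=> oO y Oy; pose C n := [set y' | extends_string (mkseq y n) y'].
  have FC : Filter (filter_from [set: nat] C).
    apply: filter_from_filter; first by exists 0%N.
    move=> i j _ _; exists (i + j)%N => // y' yy'; split.
      by move: yy'; rewrite /C /= mkseq_cat; exact: extends_string_catl.
    by move: yy'; rewrite /C /= addnC mkseq_cat; exact: extends_string_catl.
  pose F : set_system (nat -> G) := (coded_product (fun=> e)) @ filter_from [set: nat] C.
  have Fy : F --> (coded_product (fun=> e) y : {ptws nat -> G}).
    apply: ptws_cvg => i A /nbhs_singleton Ai; exists i => // y' yy' /=.
    suff -> : coded_product (fun=> e) y' i = coded_product (fun=> e) y i by [].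
    have yy'j j : (j < i)%N -> y' j = y j.
      by move=> ltj; rewrite (extends_string_nth yy') ?size_mkseq // nth_mkseq.
    elim: i yy'j {A Ai yy'} => //= i IH yy'; rewrite yy' // IH // => j ltj.
    by apply: yy'; exact: ltnW.
  have [i _ iP] := Fy O (open_nbhs_nbhs (conj oO Oy)).
  by exists i => y' /iP.
have : forces s (fun y => forall k, ~ B k (theta (coded_product (fun=> e) y))).
  apply: forces_all => k; apply: forces_densely => t.
  have Bk : <<s open >> (theta @^-1` B k) by apply: Btheta; exact: sub_sigma_algebra.
  have [t' [tB|tB]] := decided_borel p_open Bk (s ++ t); last by exists t'; rewrite catA.
  by case: no; exists (t ++ t'), (D k); rewrite catA.
move/forces_ex => [y _ yB].
have ne : [set g | d2 g (theta (coded_product (fun=> e) y) m) < q] !=set0.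
  by exists (theta (coded_product (fun=> e) y) m); rewrite /= (distxx d2P).
have [k kP] := DP _ (open_dist_ball d2H d2I _ _) ne.
by apply: (yB k); rewrite /B /= (distC d2P).
Qed.

(** The letters enumerate the closure of a dense sequence and of the standard basis
    of the component under products, inverses and halving of vectors, with an
    additional letter [0] for [1]. *)
Theorem reduction_matrix : borel_reducible (@E G) (@E H) ->
  finite_set (range (fun (h : H) x => (h * psi2 x * h^-1)%g)) ->
  exists2 A : 'M[R]_n, A \in unitmx & forall u : G, exists h : H, forall x y,
    psi1 y = (u * psi1 x * u^-1)%g -> (h * psi2 (x *m A) * h^-1)%g = psi2 (y *m A).
Proof.
move=> [theta [Btheta thetaP]] finJ.
have [d1P d2P] := (TSI_biinvariant d1G d1I, TSI_biinvariant d2H d2I).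
have [D DP] := separable_sequence 1%g sepG.
pose u i : G := if unpickle i is Some c then
  match c : nat + 'I_n with inl k => D k | inr j => psi1 (delta_mx 0 j) end else 1%g.
have [e' [e'u e'M e'V e'H]] :=
  countable_closure (fun x y : G => (x * y)%g) (fun x : G => (x^-1)%g)
    (fun g => psi1 (2^-1 *: kap1 g)) u.
pose e a := if a is a'.+1 then e' a' else 1%g.
have [a1 a1P] : exists a, e' a = 1%g.
  have [b bP] := e'V 0%N; have [c cP] := e'M 0%N b; exists c.
  by rewrite cP bP mulgV.
have e_e' a : exists b, e a = e' b by case: a => [|a]; [exists a1|exists a].
have e_mul a b : exists c, e c = (e a * e b)%g.
  have [[a' ->] [b' ->]] := (e_e' a, e_e' b); have [c cP] := e'M a' b'; by exists c.+1.
have e_inv a : exists b, e b = (e a)^-1%g.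
  by have [a' ->] := e_e' a; have [c cP] := e'V a'; exists c.+1.
have e_half a x : e a = psi1 x -> exists b, e b = psi1 (2^-1 *: x).
  have [a' ->] := e_e' a => ax; have [c cP] := e'H a'; exists c.+1.
  by rewrite /= cP ax (vectorK v1).
have e_basis j : exists a, e a = psi1 (delta_mx 0 j).
  by have [b bP] := e'u (pickle (inr j : nat + 'I_n)); exists b.+1; rewrite /= bP /u pickleK.
have e_dense g (r : R) : 0 < r -> exists a, d1 (e a) g < r.
  move=> r0; have ne : [set h | d1 h g < r] !=set0 by exists g; rewrite /= (distxx d1P).
  have [k kP] := DP _ (open_dist_ball d1G d1I _ _) ne.
  by have [b bP] := e'u (pickle (inl k : nat + 'I_n)); exists b.+1; rewrite /= bP /u pickleK.
have e_word_inv s : exists a, (segment_product (fun=> e) 0 s * e a)%g = 1%g.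
  have [b bP] : exists b, segment_product (fun=> e) 0 s = e b.
    elim: s 0%N => [|a s IH] N; first by exists 0%N.
    by have [b bP] := IH N.+1; have [c cP] := e_mul a b; exists c; rewrite /= bP cP.
  by have [a aP] := e_inv b; exists a; rewrite bP aP mulgV.
pose z y := theta (coded_product (fun=> e) y).
have z_red y y' : cauchy_sequence d1 (coded_ratio (fun=> e) (fun i => (y i, y' i))) <->
    cauchy_sequence d2 (fun m => z y m * (z y' m)^-1)%g.
  by rewrite -(E_cauchy d2H d2I v2) -thetaP (E_cauchy d1G d1I v1).
have [T [D' [T0 Dxx fwd bwd]]] :=
  coded_reduction d1P d2P e_word_inv (approximable_borel e Btheta) z_red.
have e0 : e 0%N = 1%g by [].
have [A [r [r0 AP AJ]]] := letter_matrix d1P d2P v1 v2 e0 T0 Dxx fwd e_mul e_inv e_half e_basis.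
exists A.
  exact: (letter_matrix_unit d1P d2P v1 v2 e0 T0 Dxx fwd bwd e_half e_dense r0 AP).
exact: (letter_matrix_conj d1P d2P v1 v2 e_dense r0 AJ finJ).
Qed.

End ForwardDirection.

(** * From an isomorphism to a reduction *)

Definition tiso_sym (K L : topologicalGroupType) (f : topological_isomorphism K L) :
  topological_isomorphism L K :=
  TopIso (tiso_inv_morph f) (@tiso_invK _ _ f) (@tiso_funK _ _ f)
    (@tiso_inv_continuous _ _ f) (@tiso_fun_continuous _ _ f).

Section ComponentExtension.
Variables (R : realType) (G H : topologicalGroupType).
Variable phi : topological_isomorphism (identity_component_type G) (identity_component_type H).

(** [phi] as a total function on [G], to be applied to products formed in [G]
    without carrying membership proofs. *)
Definition extend_by_1 (g : G) : H :=
  if pselect (identity_component g) is left g0 then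
    val (phi (exist _ g (mem_set g0) : identity_component_type G)) else 1%g.

Lemma extend_by_1E (g : identity_component_type G) : extend_by_1 (val g) = val (phi g).
Proof.
rewrite /extend_by_1; case: pselect => [g0|]; last by case; exact: set_mem (valP g).
by congr (val (phi _)); apply: val_inj.
Qed.

Lemma identity_component_val (g : G) : identity_component g ->
  exists g' : identity_component_type G, g = val g'.
Proof. by move=> g0; exists (exist _ g (mem_set g0)). Qed.

Lemma extend_by_1_mem g : identity_component (extend_by_1 g).
Proof.
rewrite /extend_by_1; case: pselect => [g0|_]; last exact: identity_component1.
exact: set_mem (valP (phi _)).
Qed.

Lemma extend_by_1M g h : identity_component g -> identity_component h ->
  extend_by_1 (g * h)%g = (extend_by_1 g * extend_by_1 h)%g.
Proof.
move=> /identity_component_val[g' ->] /identity_component_val[h' ->].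
by rewrite -valM !extend_by_1E tiso_morph valM.
Qed.

Lemma extend_by_1_1 : extend_by_1 1%g = 1%g.
Proof.
have -> : (1%g : G) = val (1%g : identity_component_type G) by [].
by rewrite extend_by_1E tiso1.
Qed.

Lemma extend_by_1V g : identity_component g ->
  extend_by_1 (g^-1)%g = (extend_by_1 g)^-1%g.
Proof.
move=> g0; apply: (@mulgI _ (extend_by_1 g)).
by rewrite -extend_by_1M ?mulgV ?extend_by_1_1 //; exact: identity_componentV.
Qed.

Variables (d1 : G -> G -> R) (d2 : H -> H -> R).
Hypotheses (d1G : compatible_metric d1) (d2H : compatible_metric d2).

Lemma extend_by_1_small (e : R) : 0 < e -> exists2 r : R, 0 < r &
  forall g, identity_component g -> d1 1%g g < r -> d2 1%g (extend_by_1 g) < e.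
Proof.
move=> e0.
have nb1 : nbhs (val (1%g : identity_component_type H)) [set h | d2 1%g h < e].
  by apply/(nbhs_dist d2H); exists e.
have : nbhs (phi 1%g) (val @^-1` [set h | d2 1%g h < e]).
  rewrite tiso1.
  exact: (@initial_continuous _ _ (val : identity_component_type H -> H) _ _ nb1).
move=> /(@tiso_fun_continuous _ _ phi 1%g _)/(nbhs_identity_component d1G)[r r0 rP].
by exists r => // g /identity_component_val[g' ->] /rP; rewrite extend_by_1E.
Qed.

End ComponentExtension.

Lemma extend_by_1K (G H : topologicalGroupType)
    (phi : topological_isomorphism (identity_component_type G) (identity_component_type H)) g :
  identity_component g -> extend_by_1 (tiso_sym phi) (extend_by_1 phi g) = g.
Proof.
by move=> /identity_component_val[g' ->]; rewrite !extend_by_1E /= tiso_funK.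
Qed.

Section BackwardDirection.
Variables (R : realType) (G H : topologicalGroupType).
Variables (d1 : G -> G -> R) (d2 : H -> H -> R).
Hypotheses (d1G : compatible_metric d1) (d2H : compatible_metric d2).
Hypothesis d1I : forall g h x y : G, d1 (g * x * h)%g (g * y * h)%g = d1 x y.
Hypothesis d2I : forall g h x y : H, d2 (g * x * h)%g (g * y * h)%g = d2 x y.
Hypothesis openG0 : open (@identity_component G).
Hypothesis G0C : forall g h : G, identity_component g -> identity_component h ->
  (g * h = h * g)%g.
Variable phi : topological_isomorphism (identity_component_type G) (identity_component_type H).
Variable t0 : H.
Hypothesis t0_neq1 : t0 <> 1%g.

Let d1P := TSI_biinvariant d1G d1I.
Let d2P := TSI_biinvariant d2H d2I.
Local Notation G0 := (@identity_component G).
Local Notation bar := (extend_by_1 phi).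

Variables (D : nat -> G) (t : nat -> H).
Hypothesis D_dense : forall O, open O -> O !=set0 -> exists k, O (D k).
Hypothesis tP : forall k g, G0 g -> bar (D k * g * (D k)^-1)%g = (t k * bar g * (t k)^-1)%g.

Definition coset_index (g : G) : nat := xget 0%N [set k | G0 ((D k)^-1 * g)%g].

Lemma open_translate (a : G) : open [set g | G0 (a * g)%g].
Proof. by apply: open_comp => // g _; exact: mulg_continuousl. Qed.

Lemma coset_indexP g : G0 ((D (coset_index g))^-1 * g)%g.
Proof.
rewrite /coset_index; case: xgetP => [k -> //|no].
have [||k kP] := D_dense (O := [set h | G0 (g^-1 * h)%g]).
- exact: open_translate.
- by exists g; rewrite /= mulVg; exact: identity_component1.
by case: (no k); have := identity_componentV kP; rewrite invgM invgK.
Qed.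

Lemma coset_index_eq g h : G0 (g^-1 * h)%g -> coset_index g = coset_index h.
Proof.
move=> gh; rewrite /coset_index; congr xget; apply/seteqP; split=> k /= kP.
  by rewrite -(mulVKg g h) mulgA; exact: identity_componentM.
rewrite -(mulVKg h g) mulgA; apply: identity_componentM => //.
by have := identity_componentV gh; rewrite invgM invgK.
Qed.

Definition increment (x : nat -> G) j := ((x j)^-1 * x j.+1)%g.
Definition increment_coset x j := coset_index (increment x j).
Definition increment_component x j := ((D (increment_coset x j))^-1 * increment x j)%g.

Fixpoint transport (x : nat -> G) j : H :=
  if j is i.+1 then
    (transport x i * t (increment_coset x i) * bar (increment_component x i))%g
  else t (coset_index (x 0%N)).

(** The set of codes of the pairs [(increment_coset x n, n)], the graph of the
    sequence of cosets. Two sequences of integers agree from some point on if and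
    only if their graphs differ by finitely many pairs, so convergence, which is
    insensitive to finitely many terms, can detect agreement. *)
Definition coset_bit (x : nat -> G) j : bool :=
  j == pickle (increment_coset x (odflt (0, 0)%N (unpickle j)).2,
               (odflt (0, 0)%N (unpickle j)).2).

(** Each term of the transport occurs twice, the second time multiplied by [t0] or
    [1] according to the next bit. A convergent ratio moves less than the distance
    of [t0] from [1] in the end, which forces the bits to agree. *)
Definition backward_reduction (x : {ptws nat -> G}) : {ptws nat -> H} :=
  fun i => (transport x i./2 * (if odd i && coset_bit x i./2 then t0 else 1))%g.

Lemma G0_conj g h : G0 g -> G0 h -> (g * h * g^-1)%g = h.
Proof. by move=> g0 h0; rewrite (G0C g0 h0) mulgK. Qed.

Lemma increment_componentP x j : G0 (increment_component x j).
Proof. exact: coset_indexP. Qed.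

Lemma incrementE x j :
  x j.+1 = (x j * D (increment_coset x j) * increment_component x j)%g.
Proof. by rewrite -mulgA !mulVKg. Qed.

(** Holds for each factor of [transport x j]: for [t k] by its choice, and for factors
    from the component because the components are commutative. *)
Lemma transport_conj x j g : G0 g ->
  bar (x j * g * (x j)^-1)%g = (transport x j * bar g * (transport x j)^-1)%g.
Proof.
have conjM (K : groupType) (a b c : K) : (a * b * c * (a * b)^-1 = a * (b * c * b^-1) * a^-1)%g.
  by rewrite invgM !mulgA.
have barC c h : G0 c -> G0 h -> (bar c * bar h * (bar c)^-1)%g = bar h.
  move=> c0 h0; rewrite -extend_by_1V // -!extend_by_1M ?G0_conj //.
    exact: identity_componentM.
  exact: identity_componentV.
elim: j g => [|j IH] g g0.
  rewrite /=; move: (coset_indexP (x 0%N)); set k := coset_index _ => c0.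
  by rewrite -[x 0%N](mulVKg (D k)) conjM (G0_conj c0) // tP.
have c0 := increment_componentP x j.
rewrite incrementE -(mulgA (x j)) conjM conjM (G0_conj c0 g0) IH ?tP //; last exact: identity_componentJ.
have -> : transport x j.+1 = (transport x j *
    (t (increment_coset x j) * bar (increment_component x j)))%g by rewrite mulgA.
by rewrite !conjM barC.
Qed.

(** When both increments lie in the coset of [D k], the ratio changes by a conjugate of
    an element of the component; by [transport_conj] the ratio of the transports
    changes by the same conjugate of its image. *)
Lemma transport_ratio x y N :
  (forall j, (N <= j)%N -> increment_coset x j = increment_coset y j) ->
  exists g : nat -> G, [/\ forall i, G0 (g i),
    forall i, (x (N + i)%N * (y (N + i)%N)^-1 = x N * (y N)^-1 * g i)%g &
    forall i, (transport x (N + i) * (transport y (N + i))^-1 =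
      transport x N * (transport y N)^-1 * bar (g i))%g].
Proof.
move=> xy.
have alg (K : groupType) (a b c p q : K) :
    (a * c * p * (b * c * q)^-1 = a * b^-1 * (b * (c * (p * q^-1) * c^-1) * b^-1))%g.
  by rewrite !invgM !mulgA mulgVK.
pose h j := (y j * (D (increment_coset y j) *
  (increment_component x j * (increment_component y j)^-1) *
  (D (increment_coset y j))^-1) * (y j)^-1)%g.
have pq0 j : G0 (increment_component x j * (increment_component y j)^-1)%g.
  apply: identity_componentM (increment_componentP _ _) _.
  exact/identity_componentV/increment_componentP.
have h0 j : G0 (h j) by do 2!apply: identity_componentJ.
have ratioS j : (N <= j)%N -> (x j.+1 * (y j.+1)^-1 = x j * (y j)^-1 * h j)%g.
  by move=> le_j; rewrite !incrementE xy // alg.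
have transportS j : (N <= j)%N -> (transport x j.+1 * (transport y j.+1)^-1 =
    transport x j * (transport y j)^-1 * bar (h j))%g.
  move=> le_j; rewrite /= xy // alg transport_conj; last exact: identity_componentJ.
  have yV := identity_componentV (increment_componentP y j).
  by rewrite tP // (extend_by_1M phi (increment_componentP x j) yV)
    (extend_by_1V phi (increment_componentP y j)).
pose g := fix g i := if i is i'.+1 then (g i' * h (N + i')%N)%g else 1%g.
have g0 i : G0 (g i).
  by elim: i => [|i IH]; [exact: identity_component1|exact: identity_componentM].
exists g; split=> // i; elim: i => [|i IH]; rewrite ?addn0 ?mulg1 ?extend_by_1_1 ?mulg1 //.
  by rewrite addnS ratioS ?leq_addr // IH /= !mulgA.
by rewrite addnS transportS ?leq_addr // IH /= (extend_by_1M phi (g0 i) (h0 _)) mulgA.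
Qed.

Lemma transport_ratio_cauchy x y :
  (exists N, forall j, (N <= j)%N -> increment_coset x j = increment_coset y j) ->
  cauchy_sequence d1 (fun j => x j * (y j)^-1)%g <->
  cauchy_sequence d2 (fun j => transport x j * (transport y j)^-1)%g.
Proof.
move=> [N /transport_ratio[g [g0 xg tg]]].
have dist1 i j : d1 (x (N + i)%N * (y (N + i)%N)^-1)%g (x (N + j)%N * (y (N + j)%N)^-1)%g =
    d1 1%g ((g i)^-1 * g j)%g.
  by rewrite !xg (dist_mull d1P) (distC d1P 1%g) (dist_Vmul1 d1P).
have dist2 i j : d2 (transport x (N + i) * (transport y (N + i))^-1)%g
    (transport x (N + j) * (transport y (N + j))^-1)%g = d2 1%g (bar ((g i)^-1 * g j)%g).
  rewrite !tg (dist_mull d2P) extend_by_1M ?extend_by_1V //; last exact: identity_componentV.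
  by rewrite (distC d2P 1%g) (dist_Vmul1 d2P).
have gg0 i j : G0 ((g i)^-1 * g j)%g by apply: identity_componentM => //; exact: identity_componentV.
rewrite (cauchy_sequenceP d1P) (cauchy_sequenceP d2P); split=> c e e0.
  have [r r0 rP] := extend_by_1_small phi d1G d2H e0; have [M MP] := c r r0.
  exists (N + M)%N => i j le_i le_j.
  rewrite -(subnKC (leq_trans (leq_addr M N) le_i)) -(subnKC (leq_trans (leq_addr M N) le_j)).
  rewrite dist2; apply: rP => //; rewrite -dist1 !subnKC ?(leq_trans (leq_addr M N)) //.
  by apply: MP; [apply: leq_trans le_i|apply: leq_trans le_j]; exact: leq_addl.
have [r r0 rP] := extend_by_1_small (tiso_sym phi) d2H d1G e0; have [M MP] := c r r0.
exists (N + M)%N => i j le_i le_j.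
rewrite -(subnKC (leq_trans (leq_addr M N) le_i)) -(subnKC (leq_trans (leq_addr M N) le_j)).
rewrite dist1 -(extend_by_1K phi (gg0 _ _)); apply: rP; first exact: extend_by_1_mem.
rewrite -dist2 !subnKC ?(leq_trans (leq_addr M N)) //.
by apply: MP; [apply: leq_trans le_i|apply: leq_trans le_j]; exact: leq_addl.
Qed.

(** A small movement of the ratio is, up to conjugation, the ratio of the two
    increments, and an element near [1] lies in the component. *)
Lemma cauchy_coset_agree x y : cauchy_sequence d1 (fun j => x j * (y j)^-1)%g ->
  exists N, forall j, (N <= j)%N -> increment_coset x j = increment_coset y j.
Proof.
have [r r0 rP] : exists2 r : R, 0 < r & forall g, d1 1%g g < r -> G0 g.
  by apply/(nbhs_dist d1G)/open_nbhs_nbhs; split => //; exact: identity_component1.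
move=> /(cauchy_sequenceP d1P)/(_ r r0)[N NP]; exists N => j le_j.
apply/esym/coset_index_eq.
have := NP j j.+1 le_j (leqW le_j).
rewrite -(dist_mull d1P (x j * (y j)^-1)^-1)%g mulVg => /rP/(identity_componentJ (y j.+1)^-1)%g.
by rewrite /increment !invgM !invgK !mulgA mulgVK.
Qed.

Lemma coset_bits_agree x y :
  (exists N, forall j, (N <= j)%N -> increment_coset x j = increment_coset y j) <->
  (exists J, forall j, (J <= j)%N -> coset_bit x j = coset_bit y j).
Proof.
pose dec j : nat * nat := odflt (0, 0)%N (unpickle j).
split=> [[N NP]|[J JP]].
  pose c (x : nat -> G) n := pickle (increment_coset x n, n).
  exists (\max_(n < N) maxn (c x n) (c y n)).+1 => j lt_j.
  rewrite /coset_bit -/(dec j); have [/NP -> //|lt_n] := leqP N (dec j).2.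
  have : (maxn (c x (dec j).2) (c y (dec j).2) < j)%N.
    apply: leq_trans lt_j; rewrite ltnS.
    exact: (leq_bigmax (F := fun n : 'I_N => maxn (c x n) (c y n)) (Ordinal lt_n)).
  by rewrite gtn_max => /andP[/gtn_eqF -> /gtn_eqF ->].
exists (\max_(j < J) (dec j).2).+1 => n lt_n; apply: contrapT => neq.
pose j := pickle (increment_coset x n, n).
have dec_j : dec j = (increment_coset x n, n) by rewrite /dec pickleK.
have lt_j : (j < J)%N.
  rewrite ltnNge; apply/negP => /JP; rewrite /coset_bit -/(dec j) dec_j /= eqxx.
  by move/esym/eqP/(pcan_inj pickleK) => -[]; exact: neq.
have := leq_bigmax (F := fun j : 'I_J => (dec j).2) (Ordinal lt_j).
by rewrite /= dec_j leqNgt lt_n.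
Qed.

Lemma backward_reductionP (x y : nat -> G) :
  cauchy_sequence d1 (fun j => x j * (y j)^-1)%g <->
  cauchy_sequence d2 (fun i => backward_reduction x i * (backward_reduction y i)^-1)%g.
Proof.
pose L j := (transport x j * (transport y j)^-1)%g.
pose M i := (backward_reduction x i * (backward_reduction y i)^-1)%g; rewrite -/M.
have ML J : (forall j, (J <= j)%N -> coset_bit x j = coset_bit y j) ->
    cauchy_sequence d2 M <-> cauchy_sequence d2 (fun i => L (J + i)%N).
  move=> JP; apply: (cauchy_reindex d2P (g := fun i => (i./2 - J)%N)
    (k := fun i => (J + i).*2)) => [i|i|N|i j le_ij|i].
  - rewrite addn0 => le_i; have le_Ji : (J <= i./2)%N by rewrite -[J]doubleK half_leq.
    by rewrite /M /backward_reduction JP // subnKC // mulgKA.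
  - by rewrite doubleK addKn.
  - exists (J + N).*2 => i le_i; rewrite leq_subRL.
      by rewrite -[(J + N)%N]doubleK half_leq.
    by rewrite -[J]doubleK half_leq // (leq_trans _ le_i) // leq_double leq_addr.
  - by rewrite leq_double leq_add2l.
  - by rewrite -addnn -addnA addnCA leq_addr.
have L_shift J : cauchy_sequence d2 (fun i => L (J + i)%N) <-> cauchy_sequence d2 L.
  elim: J => [|J IH]; first by [].
  by rewrite -IH -(cauchy_shift d2P (fun i => L (J + i)%N)); split; apply: cauchy_ext => i; rewrite addnS.
split=> [cx|cM].
  have agree := cauchy_coset_agree cx; have [J JP] := (coset_bits_agree x y).1 agree.
  by apply/(ML J JP)/L_shift/(transport_ratio_cauchy agree).
have [J JP] : exists J, forall j, (J <= j)%N -> coset_bit x j = coset_bit y j.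
  have dt0 : 0 < d2 t0 1%g.
    rewrite lt_def (dist_ge0 d2P) andbT; apply/eqP => /(dist_eq0 d2P); exact: t0_neq1.
  have [N NP] := (cauchy_sequenceP d2P _).1 cM _ dt0; exists N => j le_j.
  have le_2j : (N <= j.*2)%N by rewrite -addnn (leq_trans le_j) // leq_addr.
  have := NP _ _ (leqW le_2j) le_2j.
  rewrite /M /backward_reduction !oddS !odd_double /= uphalf_double doubleK !mulg1.
  rewrite invgM !mulgA (dist_mulr d2P) -(mulgA (transport x j)).
  rewrite -[X in d2 _ X](mulg1 (transport x j)) (dist_mull d2P) (dist_div1 d2P).
  by case: coset_bit; case: coset_bit => //; rewrite ?[d2 1%g _](distC d2P) ltxx.
have agree := (coset_bits_agree x y).2 (ex_intro _ J JP).
by apply/(transport_ratio_cauchy agree)/(L_shift J)/(ML J JP).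
Qed.

Lemma cvg_mulg (T : Type) (K : topologicalGroupType) (F : set_system T) {FF : Filter F}
    (f g : T -> K) a b :
  f @ F --> a -> g @ F --> b -> (fun x => f x * g x)%g @ F --> (a * b)%g.
Proof.
move=> fa gb; apply: (cvg_comp (fun x => (f x, g x)) (fun z : K * K => (z.1 * z.2)%g)).
  exact: cvg_pair fa gb.
exact: (mulg_continuous (s := K) (a, b)).
Qed.

Lemma cvg_invg (T : Type) (K : topologicalGroupType) (F : set_system T) (f : T -> K) a :
  f @ F --> a -> (fun x => (f x)^-1)%g @ F --> (a^-1)%g.
Proof.
by move=> fa A nA; exact: (fa ((fun z : K => z^-1)%g @^-1` A) (@invg_continuous K a A nA)).
Qed.

Lemma cvg_bar (T : Type) (F : set_system T) {FF : Filter F} (f : T -> G) a :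
  G0 a -> f @ F --> a -> (fun x => bar (f x)) @ F --> bar a.
Proof.
move=> a0 fa A /(nbhs_dist d2H)[e e0 eA].
have [r r0 rP] := extend_by_1_small phi d1G d2H e0.
have : nbhs a ([set g | d1 g a < r] `&` [set g | G0 (a^-1 * g)%g]).
  apply: open_nbhs_nbhs; split; first by apply: openI (open_dist_ball d1G d1I _ _) (open_translate _).
  by split; rewrite /= ?(distxx d1P) // mulVg; exact: identity_component1.
move/fa => near_a; apply: (@filterS _ F FF _ _ _ near_a) => x [/= lt_x x0]; apply: eA.
rewrite -(mulVKg a (f x)) (extend_by_1M phi a0 x0) -{1}(mulg1 (bar a)) (dist_mull d2P).
by apply: rP => //; rewrite -(dist_mull d1P a) mulg1 mulVKg (distC d1P).
Qed.

(** Cosets of the open component are open. *)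
Lemma near_coset (T : Type) (F : set_system T) {FF : Filter F} (f : T -> G) a :
  f @ F --> a -> \forall x \near F, coset_index (f x) = coset_index a.
Proof.
move=> fa; have : nbhs a [set g | G0 (a^-1 * g)%g].
  apply: open_nbhs_nbhs; split; first exact: open_translate.
  by rewrite /= mulVg; exact: identity_component1.
by move/fa => near_a; apply: (@filterS _ F FF _ _ _ near_a) => x /= /coset_index_eq.
Qed.

Section CoordinatewiseLimit.
Variables (F : set_system (nat -> G)) (x : nat -> G).
Hypothesis FF : Filter F.
Hypothesis Fx : forall i, (fun y : nat -> G => y i) @ F --> x i.

Lemma cvg_increment j : (fun y => increment y j) @ F --> increment x j.
Proof. by apply: (@cvg_mulg _ _ F FF); [exact: cvg_invg|exact: Fx]. Qed.

Lemma near_increment_coset j : \forall y \near F, increment_coset y j = increment_coset x j.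
Proof. exact: (@near_coset _ F FF _ _ (cvg_increment (j := j))). Qed.

Lemma cvg_transport j : (fun y => transport y j) @ F --> transport x j.
Proof.
elim: j => [|j IH].
  apply: (@cvg_near_cst _ _ _ _ F FF).
  by apply: (@filterS _ F FF _ _ _ (@near_coset _ F FF _ _ (@Fx 0%N))) => y /= ->.
pose k := increment_coset x j.
pose f (y : nat -> G) := (transport y j * t k * bar ((D k)^-1 * increment y j))%g.
have fx : f @ F --> f x.
  apply: (@cvg_mulg _ _ F FF); first by apply: (@cvg_mulg _ _ F FF) => //; exact: cvg_cst.
  apply: (@cvg_bar _ F FF); first exact: increment_componentP.
  by apply: (@cvg_mulg _ _ F FF); [exact: cvg_cst|exact: cvg_increment].
apply: cvg_trans fx; apply: near_eq_cvg.
apply: (@filterS _ F FF _ _ _ (near_increment_coset j)) => y yk.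
by rewrite /f /= /increment_component yk.
Qed.

Lemma cvg_backward_reduction i :
  (fun y => backward_reduction y i) @ F --> backward_reduction x i.
Proof.
apply: (@cvg_mulg _ _ F FF); first exact: cvg_transport.
apply: (@cvg_near_cst _ _ _ _ F FF); rewrite /coset_bit; set n := (_).2.
by apply: (@filterS _ F FF _ _ _ (near_increment_coset n)) => y ->.
Qed.

End CoordinatewiseLimit.

Lemma backward_reduction_continuous : continuous backward_reduction.
Proof.
move=> x; apply: (@ptws_cvg H (backward_reduction @ nbhs x)) => i.
have := @cvg_backward_reduction (nbhs x) x (nbhs_filter x).
apply=> j; exact: (@proj_continuous _ (fun=> G) j x).
Qed.

End BackwardDirection.

(** * The equivalence *)

Lemma mulmx_continuous (R : realType) m n (A : 'M[R]_(m, n)) :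
  continuous (fun x : 'rV[R]_m => x *m A).
Proof.
have [C C0 CP] := norm_mulmx_le A => x B /nbhs_ballP[e /= e0 eB].
apply/nbhs_ballP; exists (e / C); first exact: divr_gt0.
move=> y; rewrite -ball_normE /= => lt_xy; apply: eB; rewrite -ball_normE /= -mulmxBl.
by rewrite (le_lt_trans (CP _)) // mulrC -ltr_pdivlMr.
Qed.

Section MatrixIsomorphism.
Variables (R : realType) (n : nat) (K L : topologicalGroupType).
Variable isoK : topological_isomorphism K (additive_group 'rV[R]_n).
Variable isoL : topological_isomorphism L (additive_group 'rV[R]_n).

Definition matrix_map (A : 'M[R]_n) (x : additive_group 'rV[R]_n) :
  additive_group 'rV[R]_n := (x : 'rV[R]_n) *m A.

Lemma matrix_map_morph A : {morph matrix_map A : x y / (x * y)%g}.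
Proof. by move=> x y; exact: mulmxDl. Qed.

Lemma matrix_map_continuous A : continuous (matrix_map A).
Proof. exact: mulmx_continuous. Qed.

Lemma matrix_mapK A B : A *m B = 1%:M -> cancel (matrix_map A) (matrix_map B).
Proof. by move=> AB x; rewrite /matrix_map -mulmxA AB mulmx1. Qed.

Definition matrix_conjugate A : K -> L := tiso_inv isoL \o matrix_map A \o isoK.
Definition matrix_conjugate_inv B : L -> K := tiso_inv isoK \o matrix_map B \o isoL.

Lemma continuous_comp3 (T1 T2 T3 T4 : topologicalType) (f : T1 -> T2) (g : T2 -> T3) (h : T3 -> T4) :
  continuous f -> continuous g -> continuous h -> continuous (h \o g \o f).
Proof.
move=> cf cg ch x; apply: (@continuous_comp _ _ _ f (h \o g)); first exact: cf.
by apply: (@continuous_comp _ _ _ g h); [exact: cg|exact: ch].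
Qed.

Lemma matrix_conjugate_morph A : {morph matrix_conjugate A : x y / (x * y)%g}.
Proof.
by move=> x y; rewrite /matrix_conjugate /= tiso_morph matrix_map_morph tiso_inv_morph.
Qed.

Lemma matrix_conjugateK A B : A *m B = 1%:M ->
  cancel (matrix_conjugate A) (matrix_conjugate_inv B).
Proof.
move=> AB x; rewrite /matrix_conjugate_inv /matrix_conjugate /= tiso_invK.
by rewrite (matrix_mapK AB) tiso_funK.
Qed.

Lemma matrix_conjugate_invK A B : A *m B = 1%:M ->
  cancel (matrix_conjugate_inv A) (matrix_conjugate B).
Proof.
move=> AB x; rewrite /matrix_conjugate_inv /matrix_conjugate /= tiso_invK.
by rewrite (matrix_mapK AB) tiso_funK.
Qed.

Lemma matrix_conjugate_continuous A : continuous (matrix_conjugate A).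
Proof.
apply: continuous_comp3; [exact: tiso_fun_continuous|exact: matrix_map_continuous|].
exact: tiso_inv_continuous.
Qed.

Lemma matrix_conjugate_inv_continuous A : continuous (matrix_conjugate_inv A).
Proof.
apply: continuous_comp3; [exact: tiso_fun_continuous|exact: matrix_map_continuous|].
exact: tiso_inv_continuous.
Qed.

Definition matrix_tiso (A : 'M[R]_n) (A_unit : A \in unitmx) : topological_isomorphism K L :=
  TopIso (@matrix_conjugate_morph A) (matrix_conjugateK (mulmxV A_unit))
    (matrix_conjugate_invK (mulVmx A_unit)) (@matrix_conjugate_continuous A)
    (@matrix_conjugate_inv_continuous (invmx A)).

End MatrixIsomorphism.

Theorem corollary3p13 (R : realType) (n : nat) (hn : (1 <= n)%N)
    (G H : topologicalGroupType)
    (lieG : is_Lie_group R G) (lieH : is_Lie_group R H)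
    (sepG : separable G) (sepH : separable H)
    (tsiG : TSI R G) (tsiH : TSI R H)
    (G0Rn : topologically_isomorphic
              (identity_component_type G) (additive_group 'rV[R]_n))
    (H0Rn : topologically_isomorphic
              (identity_component_type H) (additive_group 'rV[R]_n))
    (finH : finite_set (@Inn H)) :
  borel_reducible (@E G) (@E H) <->
  exists phi : topological_isomorphism
                 (identity_component_type G) (identity_component_type H),
    [set phi \o f \o tiso_inv phi | f in @Inn G] `<=` @Inn H.
Proof.
have [[d1 [d1G d1I]] [d2 [d2H d2I]]] := (tsiG, tsiH).
have [[isoG] [isoH]] := (G0Rn, H0Rn).
have openG0 := identity_component_open lieG; have openH0 := identity_component_open lieH.
have v1 := component_vector_component d1G d1I openG0 isoG.
have v2 := component_vector_component d2H d2I openH0 isoH.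
split=> [red|[phi phiJ]].
  have finJ : finite_set (range (fun (h : H) x => (h * component_vector isoH x * h^-1)%g)).
    have -> : range (fun (h : H) x => (h * component_vector isoH x * h^-1)%g) =
        (fun f x => val (f (tiso_inv isoH x))) @` @Inn H.
      apply/seteqP; split=> [_ [h _ <-]|_ [_ [h _ <-] <-]]; last by exists h.
      by exists (conj_identity_component h) => //; exists h.
    exact: finite_image.
  have [A A_unit AJ] := reduction_matrix d1G d2H d1I d2I sepG sepH v1 v2 red finJ.
  exists (matrix_tiso isoG isoH A_unit) => _ [_ [u _ <-] <-].
  have [h hP] := AJ u; exists h => //; apply/funext => w; apply: val_inj => /=.
  pose x : 'rV[R]_n := isoG (matrix_conjugate_inv isoG isoH (invmx A) w).
  have wE : w = tiso_inv isoH (x *m A).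
    rewrite /x /matrix_conjugate_inv /= tiso_invK -[_ *m A]/(matrix_map A _).
    by rewrite (matrix_mapK (mulVmx A_unit)) tiso_funK.
  rewrite [in LHS]wE; apply: hP.
  by rewrite /component_vector tiso_funK /= tiso_funK.
have G0C (g h : G) : identity_component g -> identity_component h -> (g * h = h * g)%g.
  move=> g0 h0; rewrite -(component_vectorE isoG g0) -(component_vectorE isoG h0).
  exact: (vectorC v1).
have barJ (u : G) : exists t : H, forall g, identity_component g ->
    extend_by_1 phi (u * g * u^-1)%g = (t * extend_by_1 phi g * t^-1)%g.
  have [|t _ tE] := phiJ (phi \o conj_identity_component u \o tiso_inv phi).
    by exists (conj_identity_component u) => //; exists u.
  exists t => g /identity_component_val[g' ->].
  rewrite -[(u * val g' * u^-1)%g]/(val (conj_identity_component u g')) !extend_by_1E.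
  by rewrite -{1}(tiso_funK phi g') -[phi _]/((phi \o conj_identity_component u \o tiso_inv phi) (phi g')) -tE.
have [t0 t0_neq1] : exists t0 : H, t0 <> 1%g.
  exists (component_vector isoH (const_mx 1)); rewrite -(vector0 v2) => /(can_inj (vectorK v2)).
  by move/rowP/(_ (Ordinal hn)); rewrite !mxE => /eqP; rewrite oner_eq0.
have [D DP] := separable_sequence 1%g sepG.
have /choice[t tP] := fun k => barJ (D k).
exists (backward_reduction phi t0 D t); split.
  apply: continuous_borel_map.
  exact: (backward_reduction_continuous d1G d2H d1I d2I openG0 DP).
move=> x y; rewrite (E_cauchy d1G d1I v1) (E_cauchy d2H d2I v2).
exact: (backward_reductionP d1G d2H d1I d2I openG0 G0C t0_neq1 DP tP).
Qed.
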